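(* There are universal constants $0<c<1<C$, with $C$ an integer, such that for every non-increasing sequence $\sigma_0\ge\sigma_1\ge\dots\ge 0$ of real numbers and every integer $n\ge0$, $$c\,\sigma^*_{Cn}\;\le\; e_n^*(\sigma)\;\le\; g_n^*(\sigma)\;\le\; C\,\sigma^*_{\lfloor cn\rfloor}.$$
   Context: Let $\Omega$ be the class of all pairs $(H,\mu)$ consisting of a separable reproducing kernel Hilbert space $H$ of complex-valued functions on an arbitrary set $D$ (i.e. point evaluations are continuous on $H$) and a measure $\mu$ on $D$ such that $H$ is (continuously) embedded into $L_2(D,\mu)$. Let $\Omega_0$ be the class of those $(H,\mu)\in\Omega$ for which $\mu$ is a probability measure. $H'$ denotes the space of continuous linear functionals on $H$. For $n\in\mathbb{N}_0$ define the sampling numbers $$g_n(H,\mu)=\inf_{\substack{x_1,\dots,x_n\in D\\ g_1,\dots,g_n\in L_2(D,\mu)}}\ \sup_{\|f\|_H\le1}\Big\|f-\sum_{i=1}^nf(x_i)g_i\Big\|_{L_2(D,\mu)},$$ the approximation numbers $$a_n(H,\mu)=\inf_{\substack{L_1,\dots,L_n\in H'\\ g_1,\dots,g_n\in L_2(D,\mu)}}\ \sup_{\|f\|_H\le1}\Big\|f-\sum_{i=1}^nL_i(f)g_i\Big\|_{L_2(D,\mu)},$$ and, for $(H,\mu)\in\Omega_0$, the minimal integration error $$e_n(H,\mathrm{INT}_\mu)=\inf_{\substack{x_1,\dots,x_n\in D\\ a_1,\dots,a_n\in\mathbb{C}}}\ \sup_{\|f\|_H\le1}\Big|\sum_{k=1}^na_kf(x_k)-\int_Df\,d\mu\Big|.$$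 For a sequence $\sigma=(\sigma_m)_{m\in\mathbb{N}_0}$ set $$g_n^*(\sigma)=\sup\{g_n(H,\mu): (H,\mu)\in\Omega,\ a_m(H,\mu)=\sigma_m\ \forall m\in\mathbb{N}_0\},$$ $$e_n^*(\sigma)=\sup\{e_n(H,\mathrm{INT}_\mu): (H,\mu)\in\Omega_0,\ a_m(H,\mu)=\sigma_m\ \forall m\in\mathbb{N}_0\},$$ $$\sigma_n^*=\min\Big\{\sigma_0,\ \sqrt{\tfrac1n\sum_{k\ge n}\sigma_k^2}\Big\},$$ where $\sigma_n^*=\sigma_0$ if $n=0$ or if $\sum_k\sigma_k^2=\infty$. *)

(* Defs.v *)
From HB Require Import structures.
From mathcomp Require Import all_boot all_order all_algebra.
From mathcomp Require Import all_classical all_reals all_analysis.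
From mathcomp Require Import complex.

Set Implicit Arguments.
Unset Strict Implicit.
Unset Printing Implicit Defensive.

Import Order.TTheory GRing.Theory Num.Theory.
Import numFieldNormedType.Exports.

Local Open Scope classical_set_scope.
Local Open Scope ring_scope.
Local Open Scope complex_scope.

(* A separable Hilbert space of complex-valued functions on D with continuous
   point evaluations.  The points of rkhs_space are identified with functions
   through the injective linear map rkhs_fun.  [R[i]^o] is the complex field
   as a normed space over itself. *)
Record rkhs (R : realType) (D : Type) := RKHS {
  rkhs_space :> completeNormedModType R[i] ;
  rkhs_dot : {dot rkhs_space for (@Num.conj R[i])} ;
  rkhs_normE : forall f : rkhs_space, `|f| ^+ 2 = rkhs_dot f f ;
  rkhs_fun : {linear rkhs_space -> (D -> R[i])} ;
  rkhs_fun_inj : injective rkhs_fun ;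
  rkhs_eval_continuous : forall x : D,
    continuous (fun f : rkhs_space => (rkhs_fun f x : R[i]^o)) ;
  rkhs_separable : exists2 S : set rkhs_space, countable S & dense S
}.
Arguments rkhs_fun {R D} r.

(* The norm of a normed space over R[i] takes its values in R[i]. *)
Definition unit_ball (R : realType) (D : Type) (H : rkhs R D) : set H :=
  [set f | `|f| <= 1].
Arguments unit_ball {R D} H.

Section ComplexL2.
Context d (D : measurableType d) (R : realType).
Variable mu : {measure set D -> \bar R}.

(* Square-integrable representatives; equality almost everywhere is not
   quotiented out. *)
Definition L2 : set (D -> R[i]) :=
  [set g | (fun x => complex.Re (g x)) \in Lfun mu 2%:E /\
           (fun x => complex.Im (g x)) \in Lfun mu 2%:E].

Definition L2norm (g : D -> R[i]) : \bar R :=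
  'N[mu]_(2%:E)[(fun x => (Normc.normc (g x))%:E)].

Definition cintegral (g : D -> R[i]) : R[i] :=
  Complex (\int[mu]_(x in setT) complex.Re (g x))
          (\int[mu]_(x in setT) complex.Im (g x)).

(* The map sending f to its class is a continuous injection H -> L_2(D, mu). *)
Definition embedded_in_L2 (H : rkhs R D) : Prop :=
  [/\ forall f : H, L2 (rkhs_fun H f),
      forall f : H, (\forall x \ae mu, rkhs_fun H f x = 0) -> f = 0
    & exists M : R, forall f : H,
        (L2norm (rkhs_fun H f) <= (M * complex.Re `|f|)%:E)%E].

Definition sampling_number (n : nat) (H : rkhs R D) : \bar R :=
  ereal_inf [set s | exists (x : 'I_n -> D) (g : 'I_n -> D -> R[i]),
    (forall i, L2 (g i)) /\
    s = ereal_sup [set L2norm (fun t =>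
          rkhs_fun H f t - \sum_(i < n) rkhs_fun H f (x i) * g i t)
        | f in unit_ball H]].

Definition approximation_number (n : nat) (H : rkhs R D) : \bar R :=
  ereal_inf [set s | exists (L : 'I_n -> {linear H -> R[i]^o})
                            (g : 'I_n -> D -> R[i]),
    [/\ forall i, continuous (L i),
        forall i, L2 (g i)
      & s = ereal_sup [set L2norm (fun t =>
              rkhs_fun H f t - \sum_(i < n) (L i f : R[i]) * g i t)
            | f in unit_ball H]]].

Definition integration_error (n : nat) (H : rkhs R D) : \bar R :=
  ereal_inf [set s | exists (x : 'I_n -> D) (a : 'I_n -> R[i]),
    s = ereal_sup [set (Normc.normc (\sum_(k < n) a k * rkhs_fun H f (x k)
                                     - cintegral (rkhs_fun H f)))%:E
        | f in unit_ball H]].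

End ComplexL2.

(* A measurableType is pointed, so D ranges over all nonempty measurable
   spaces. *)
Definition g_star (R : realType) (sigma : nat -> R) (n : nat) : \bar R :=
  ereal_sup [set s | exists (d : measure_display) (D : measurableType d)
      (mu : {measure set D -> \bar R}) (H : rkhs R D),
    [/\ embedded_in_L2 mu H,
        forall m, approximation_number mu m H = (sigma m)%:E
      & s = sampling_number mu n H]].

Definition e_star (R : realType) (sigma : nat -> R) (n : nat) : \bar R :=
  ereal_sup [set s | exists (d : measure_display) (D : measurableType d)
      (mu : probability D R) (H : rkhs R D),
    [/\ embedded_in_L2 mu H,
        forall m, approximation_number mu m H = (sigma m)%:E
      & s = integration_error mu n H]].

Definition sigma_star (R : realType) (sigma : nat -> R) (n : nat) : R :=
  if (n == 0)%N || (\sum_(0 <= k <oo) (sigma k ^+ 2)%:E == +oo)%E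
  then sigma 0%N
  else Num.min (sigma 0%N)
    (Num.sqrt (n%:R^-1 * fine (\sum_(n <= k <oo) (sigma k ^+ 2)%:E)%E)).

(* Main.v *)
Require Import Defs.
From HB Require Import structures.
From mathcomp Require Import all_boot all_order all_algebra.
From mathcomp Require Import all_classical all_reals all_analysis.
From mathcomp Require Import measurable_realfun complex.
From mathcomp Require Import ring lra.

Set Implicit Arguments.
Unset Strict Implicit.
Unset Printing Implicit Defensive.
Import Order.TTheory GRing.Theory Num.Theory.
Import numFieldNormedType.Exports.

(** Upper bound. Let W be the Gram matrix in L_2 of finitely many orthonormal
    elements e_k of H; its sorted eigenvalues are at most sigma_k ^ 2. With eps of
    the order of (sum_(k >= m) sigma_k ^ 2) / m, a one-sided version of the barrier
    method of Batson, Spielman and Srivastava starts from M = eps + W and, in each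
    of 16 m steps, subtracts a multiple of W and adds t w(x) w(x)^*, where
    w(x) = (e_k(x))_k and the point x is found by averaging over mu, keeping M
    positive definite and tr (W M^-1) bounded. It ends with
    W <= eps + sum_i t_i w(x_i) w(x_i)^*, so the regularised least squares
    approximation at the points x_i has error O(sqrt eps). The part of H that the
    e_k miss is handled by keeping t_i times its squared evaluation norm at x_i
    small during the selection.

    Lower bound. Half of the mass is uniform on a power of a set with 2n + 2
    points; on it H is spanned by sigma_k times the tensor products of the rows of
    an orthogonal matrix, of which only the constant and the functions of one
    coordinate are used. A quadrature rule with n points and total weight S errs by
    at least sigma_0 |S - 1/2| on the constants, and by at least a multiple of |S|
    on the functions of each coordinate, since n points hit at most half of the
    values. The other half of the mass sits on atoms carrying one basis function
    each; they realise the remaining approximation numbers. *)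

(** * Barrier argument for matrices *)

(** Only an upper bound for W is wanted, so one barrier suffices: no upper bound on sum_i t_i w(x_i)
    w(x_i)^* is needed, and the number of steps alone fixes the number of points. Write K = 2m for
    the bound on the initial trace. Each step subtracts W / (4K), so after 8K = 16m steps the
    coefficient of W in M has gone from 1 to -1. Neither K nor the number of steps depends on how
    many e_k are used. Hence that number can be chosen last, large enough to make the missed part of
    H negligible, and no singular value decomposition of the embedding is needed.

    In the lower bound, a single factor with 2n + 2 points would only involve sigma_0, ...,
    sigma_(2n+1). In a power of it the same n nodes are seen by every coordinate, so all coordinates
    give a bound in terms of the same S. Each of them owns a block of 2n + 1 consecutive indices,
    and monotonicity compares the sum of sigma_(j(2n+1)) ^ 2 over j with a tail of the series. The
    number of coordinates depends on sigma, but it is finite even when the series diverges. *)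

Section GenericMatrices.
Local Open Scope ring_scope.
Variables (F : comUnitRingType) (n : nat).
Implicit Types S T M Z W : 'M[F]_n.

(** Both sides are the inverse of [M]. *)
Lemma congruence_inverse S' T' S T M Z :
  S' *m M *m T' = 1%:M -> S *m M *m T *m Z = 1%:M ->
  T' *m S' = T *m Z *m S.
Proof.
move=> h1 h2.
have E1 : T' *m S' *m M = 1%:M by apply/mulmx1C; rewrite mulmxA; apply/mulmx1C; rewrite mulmxA.
have E2 : M *m (T *m Z *m S) = 1%:M by rewrite !mulmxA; apply/mulmx1C; rewrite !mulmxA.
by rewrite -[LHS]mulmx1 -E2 mulmxA E1 mul1mx.
Qed.

(** Both traces equal tr (W M^-1), so the potential does not depend on the congruence by which it is
    computed. *)
Lemma mxtrace_congruence S' T' S T M Z W :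
  S' *m M *m T' = 1%:M -> S *m M *m T *m Z = 1%:M ->
  \tr (S' *m W *m T') = \tr (S *m W *m T *m Z).
Proof.
move=> E1 E2; rewrite mxtrace_mulC mulmxA (congruence_inverse E1 E2).
by rewrite -!mulmxA mxtrace_mulC -!mulmxA mxtrace_mulC -!mulmxA mxtrace_mulC -!mulmxA.
Qed.
End GenericMatrices.

Section ComplexMatrices.
Variable R : rcfType.
Local Open Scope ring_scope.
Local Open Scope complex_scope.
Local Open Scope sesquilinear_scope.

Implicit Types (n : nat) (z : R[i]).

Definition sqn z : R := complex.Re z ^+ 2 + complex.Im z ^+ 2.

Lemma sqn_ge0 z : 0 <= sqn z.
Proof. by rewrite addr_ge0 ?sqr_ge0. Qed.

Lemma mulC_sqn z : z * Num.conj z = (sqn z)%:C.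
Proof. by rewrite /sqn add_Re2_Im2 -normCK. Qed.

Lemma sqn_scale (x : R) z : sqn (x%:C * z) = x ^+ 2 * sqn z.
Proof. by case: z => a b; rewrite /sqn /=; ring. Qed.

Lemma conjC_real (x : R) : Num.conj x%:C = x%:C :> R[i].
Proof. by rewrite /Num.conj /= oppr0. Qed.

Lemma ltr0c (x : R) : (0 < x%:C) = (0 < x).
Proof. by rewrite -ltcR. Qed.

Definition qform n (M : 'M[R[i]]_n) (u : 'rV_n) : R[i] := (u *m M *m u^t*) 0 0.

Definition posdef n (M : 'M[R[i]]_n) :=
  M^t* = M /\ forall u, u != 0 -> 0 < qform M u.

Definition psd n (M : 'M[R[i]]_n) := M^t* = M /\ forall u, 0 <= qform M u.

Definition rdiag n (q : 'I_n -> R) : 'M[R[i]]_n := diag_mx (\row_i (q i)%:C).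

Lemma trmxC_mul m n p (A : 'M[R[i]]_(m, n)) (B : 'M[R[i]]_(n, p)) :
  (A *m B)^t* = B^t* *m A^t*.
Proof. by rewrite trmx_mul map_mxM. Qed.

Lemma trmxCD m n (A B : 'M[R[i]]_(m, n)) : (A + B)^t* = A^t* + B^t*.
Proof. by apply/matrixP => i j; rewrite !mxE rmorphD. Qed.

Lemma trmxC_rdiag n (q : 'I_n -> R) : (rdiag q)^t* = rdiag q.
Proof.
apply/matrixP => i j; rewrite !mxE eq_sym.
case: eqP => [->|_]; rewrite ?mulr1n ?mulr0n ?rmorph0 //.
exact: conjC_real.
Qed.

Lemma trmxCE m n (A : 'M[R[i]]_(m, n)) i j : (A^t*) i j = Num.conj (A j i).
Proof. by rewrite !mxE. Qed.

Lemma rdiag_mulE m n (q : 'I_m -> R) (A : 'M[R[i]]_(m, n)) i j :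
  (rdiag q *m A) i j = (q i)%:C * A i j.
Proof. by rewrite mul_diag_mx !mxE. Qed.

Lemma rdiagM n (p q : 'I_n -> R) :
  rdiag p *m rdiag q = rdiag (fun i => p i * q i).
Proof.
rewrite /rdiag mulmx_diag; congr diag_mx; apply/rowP => i.
by rewrite !mxE rmorphM.
Qed.

Lemma rdiag1 n (q : 'I_n -> R) : (forall i, q i = 1) -> rdiag q = 1%:M.
Proof.
by move=> q1; apply/matrixP => i j; rewrite !mxE q1.
Qed.

Lemma qform_rdiag n (q : 'I_n -> R) u :
  qform (rdiag q) u = (\sum_i q i * sqn (u 0 i))%:C.
Proof.
rewrite /qform /rdiag mul_mx_diag !mxE rmorph_sum /=; apply: eq_bigr => i _.
by rewrite !mxE mulrAC mulC_sqn rmorphM mulrC.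
Qed.

Lemma qformD n (M N : 'M[R[i]]_n) u : qform (M + N) u = qform M u + qform N u.
Proof. by rewrite /qform mulmxDr mulmxDl mxE. Qed.

Lemma qformZ n a (M : 'M[R[i]]_n) u : qform (a *: M) u = a * qform M u.
Proof. by rewrite /qform -scalemxAr -scalemxAl mxE. Qed.

Lemma qform_rank1 n (w : 'cV[R[i]]_n) u :
  qform (w *m w^t*) u = (sqn ((u *m w) 0 0))%:C.
Proof.
rewrite /qform mulmxA -mulmxA -trmxC_mul mxE big_ord1 -mulC_sqn.
by congr (_ * _); rewrite !mxE.
Qed.

Lemma qform_conj n (M : 'M[R[i]]_n) m (S : 'M[R[i]]_(m, n)) (u : 'rV_m) :
  qform (S *m M *m S^t*) u = qform M (u *m S).
Proof. by rewrite /qform trmxC_mul !mulmxA. Qed.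

Lemma mulmx_conj n m p (U : 'M[R[i]]_(m, n)) (S : 'M[R[i]]_(n, p)) (M : 'M[R[i]]_p) :
  (U *m S) *m M *m (U *m S)^t* = U *m (S *m M *m S^t*) *m U^t*.
Proof. by rewrite trmxC_mul !mulmxA. Qed.

Lemma hermitian_diag n (M : 'M[R[i]]_n) : M^t* = M ->
  exists (U : 'M[R[i]]_n) (q : 'I_n -> R),
    U *m U^t* = 1%:M /\ U *m M *m U^t* = rdiag q.
Proof.
move=> hM.
have Mh : M \is hermsymmx.
  by apply/is_hermitianmxP; rewrite expr0 scale1r hM.
have /orthomx_spectralP E := hermitian_normalmx Mh.
have uU := spectral_unitarymx M.
exists (spectralmx M), (fun i => complex.Re (spectral_diag M 0 i)).
have /unitarymxP UU := uU; split=> //.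
have -> : rdiag (fun i => complex.Re (spectral_diag M 0 i)) =
          diag_mx (spectral_diag M).
  congr diag_mx; apply/rowP => i; rewrite !mxE.
  have /mxOverP /(_ 0 i) r := hermitian_spectral_diag_real Mh.
  by rewrite RRe_real.
rewrite {2}E invmx_unitary // !mulmxA UU mul1mx -mulmxA UU mulmx1 //.
Qed.

Lemma row_qform n m (S : 'M[R[i]]_(m, n)) (M : 'M[R[i]]_n) i :
  (S *m M *m S^t*) i i = qform M (row i S).
Proof.
rewrite /qform; have -> : (row i S)^t* = col i (S^t*).
  by apply/matrixP => j k; rewrite !mxE.
by rewrite -row_mul !mxE; apply: eq_bigr => j _; rewrite !mxE.
Qed.

Lemma rdiagE n (q : 'I_n -> R) i : rdiag q i i = (q i)%:C.
Proof. by rewrite !mxE eqxx mulr1n. Qed.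

Lemma row_neq0_unit n (S : 'M[R[i]]_n) i : S \in unitmx -> row i S != 0.
Proof.
move=> uS; apply/eqP => r0.
have /rowP/(_ i) : row i (S *m invmx S) = 0 by rewrite row_mul r0 mul0mx.
by rewrite mulmxV // !mxE eqxx => /eqP; rewrite oner_eq0.
Qed.

(** Rescaled eigenvectors of [M] turn [M] into the identity; a further unitary change of basis keeps
    the identity and diagonalises [W]. *)
Lemma simultaneous_diag n (M W : 'M[R[i]]_n) : posdef M -> W^t* = W ->
  exists (S : 'M[R[i]]_n) (q : 'I_n -> R),
    S *m M *m S^t* = 1%:M /\ S *m W *m S^t* = rdiag q.
Proof.
move=> [hM pM] hW.
have [U [d [UU UM]]] := hermitian_diag hM.
have uU : U \in unitmx by case/mulmx1_unit: UU.
have d0 i : 0 < d i.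
  by rewrite -ltr0c -rdiagE -UM row_qform pM // row_neq0_unit.
pose S1 := rdiag (fun i => (Num.sqrt (d i))^-1) *m U.
have S1M : S1 *m M *m S1^t* = 1%:M.
  rewrite trmxC_mul trmxC_rdiag -!mulmxA (mulmxA M) (mulmxA U) (mulmxA U) UM.
  rewrite !rdiagM rdiag1 // => i.
  have s0 : Num.sqrt (d i) != 0 by rewrite sqrtr_eq0 -ltNge.
  by rewrite -[X in _ * (X * _)](sqr_sqrtr (ltW (d0 i))); field.
have hW1 : (S1 *m W *m S1^t*)^t* = S1 *m W *m S1^t*.
  by rewrite (trmxC_mul _ (S1^t*)) (trmxC_mul S1) trmxCK hW; exact: mulmxA.
have [U2 [q [UU2 Uq]]] := hermitian_diag hW1.
exists (U2 *m S1), q; split.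
  by rewrite mulmx_conj S1M mulmx1.
by rewrite mulmx_conj.
Qed.

Lemma psd_diag_ge0 n m (W : 'M[R[i]]_n) (S : 'M[R[i]]_(m, n)) (q : 'I_m -> R) i :
  psd W -> S *m W *m S^t* = rdiag q -> 0 <= q i.
Proof. by move=> [_ pW] E; rewrite -ler0c -rdiagE -E row_qform. Qed.

(* tr (W M^-1) <= K, expressed through a simultaneous diagonalisation of M and W. *)
Definition potential_le n (W M : 'M[R[i]]_n) (K : R) :=
  exists (S : 'M[R[i]]_n) (q : 'I_n -> R),
    [/\ S *m M *m S^t* = 1%:M, S *m W *m S^t* = rdiag q & \sum_i q i <= K].

Lemma scalar_sub_rdiag n (q : 'I_n -> R) (d : R) :
  1%:M - d%:C *: rdiag q = rdiag (fun i => 1 - d * q i).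
Proof.
apply/matrixP => i j; rewrite !mxE; case: eqP => _; rewrite ?mulr1n ?mulr0n.
  by rewrite rmorphB rmorphM.
by rewrite mulr0 subr0.
Qed.

Lemma sherman_morrison n (e : 'I_n -> R) (s : 'cV[R[i]]_n) (t : R) :
  (forall i, 0 < e i) -> 0 <= t ->
  let a := \sum_i sqn (s i 0) / e i in
  let Z := rdiag (fun i => (e i)^-1) -
    (t / (1 + t * a))%:C *: ((rdiag (fun i => (e i)^-1) *m s) *m
                             (rdiag (fun i => (e i)^-1) *m s)^t*) in
  (rdiag e + t%:C *: (s *m s^t*)) *m Z = 1%:M.
Proof.
move=> e0 t0 a Z; set I := rdiag (fun i => (e i)^-1).
have EI : rdiag e *m I = 1%:M.
  by rewrite rdiagM rdiag1 // => i; rewrite divff ?gt_eqF.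
have aE : s^t* *m (I *m s) = a%:C%:M.
  apply/matrixP => i j; rewrite !ord1 !mxE eqxx mulr1n rmorph_sum /=.
  apply: eq_bigr => k _; rewrite mul_diag_mx !mxE mulrCA mulrC.
  by rewrite [_ * s k 0]mulrC mulC_sqn rmorphM.
have a0 : 0 <= a by apply: sumr_ge0 => i _; rewrite divr_ge0 ?sqn_ge0 // ltW.
have n0 : 1 + t * a != 0 by rewrite gt_eqF // ltr_pwDl // mulr_ge0.
pose c := t / (1 + t * a); pose r := (I *m s)^t*.
have sr : s *m s^t* *m I = s *m r by rewrite /r trmxC_mul trmxC_rdiag mulmxA.
rewrite /Z -/I -/c -/r mulmxBr mulmxDl EI -scalemxAl sr -addrA.
rewrite -scalemxAr mulmxDl (mulmxA (rdiag e)) (mulmxA (rdiag e)) EI mul1mx.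
have -> : t%:C *: (s *m s^t*) *m (I *m s *m r) = (t * a)%:C *: (s *m r).
  rewrite -scalemxAl -mulmxA (mulmxA (s^t*)) aE mul_scalar_mx -scalemxAr scalerA.
  by rewrite rmorphM.
rewrite -[X in X + _ *: _]scale1r -scalerDl scalerA -scalerBl.
set k := (X in X *: _); suff -> : k = 0 by rewrite scale0r addr0.
rewrite /k -(rmorph1 (real_complex R)) -rmorphD -rmorphM -rmorphB /= /c.
by rewrite -(rmorph0 (real_complex R)); congr (_ %:C); field; rewrite n0.
Qed.

(** In the coordinates given by [S], [M] is the identity and [W] is [rdiag q], so [M'] becomes
    [rdiag e] plus a rank-one term. [sherman_morrison] inverts it, and the quantity assumed to be at
    most [K] is exactly tr (W M'^-1). *)
Lemma barrier_step n (W M S : 'M[R[i]]_n) (q : 'I_n -> R) (w : 'cV_n)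
    (d t K : R) :
  S *m M *m S^t* = 1%:M -> S *m W *m S^t* = rdiag q -> W^t* = W -> M^t* = M ->
  0 <= t -> (forall i, d * q i < 1) ->
  let s := fun i => sqn ((S *m w) i 0) in
  let e := fun i => 1 - d * q i in
  \sum_i q i / e i -
    t / (1 + t * \sum_i s i / e i) * \sum_i q i * s i / e i ^+ 2 <= K ->
  let M' := M - d%:C *: W + t%:C *: (w *m w^t*) in
  posdef M' /\ potential_le W M' K.
Proof.
move=> SM SW hW hM t0 dq s e le_K M'.
have uS : S \in unitmx by move: SM; rewrite -mulmxA => /mulmx1_unit[].
have uSt : S^t* \in unitmx by case/mulmx1_unit: SM.
have e0 i : 0 < e i by rewrite subr_gt0.
have SM' : S *m M' *m S^t* = rdiag e + t%:C *: ((S *m w) *m (S *m w)^t*).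
  rewrite /M' mulmxDr mulmxDl mulmxBr mulmxBl SM -!scalemxAr -!scalemxAl SW.
  by rewrite scalar_sub_rdiag trmxC_mul !mulmxA.
have hM' : M'^t* = M'.
  apply/matrixP => i j; rewrite !mxE !rmorphD rmorphN !rmorphM /= !conjC_real.
  congr (_ - _ * _ + _ * _).
  - by rewrite -{2}hM !mxE.
  - by rewrite -{2}hW !mxE.
  - rewrite !big_ord1 !mxE rmorphM /= mulrC; congr (_ * _).
    by rewrite -[RHS]conjCK.
have pM' : posdef M'.
  split=> // u u0; rewrite -[u](mulmxKV uS) -qform_conj SM' qformD qformZ.
  rewrite qform_rdiag qform_rank1 -rmorphM -rmorphD ltr0c.
  set v := u *m invmx S.
  have [i vi] : exists i, v 0 i != 0.
    apply/rV0Pn; apply: contraNneq u0 => v0.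
    by rewrite -[u](mulmxKV uS) -/v v0 mul0mx.
  apply: ltr_pwDl; last by rewrite mulr_ge0 ?sqn_ge0.
  rewrite (bigD1 i) //= ltr_pwDl //; last first.
    by apply: sumr_ge0 => j _; rewrite mulr_ge0 ?sqn_ge0 // ltW.
  rewrite mulr_gt0 // lt_neqAle sqn_ge0 andbT eq_sym.
  apply: contra_neq vi => sv0; apply/eqP.
  by rewrite -normr_eq0 -sqrf_eq0 normCK mulC_sqn sv0.
split=> //.
have [S' [q' [S'M S'W]]] := simultaneous_diag pM' hW.
exists S', q'; split=> //; apply: le_trans le_K.
have Z1 := sherman_morrison (S *m w) e0 t0.
move: Z1 => /=; set a := (X in 1 + t * X); set Z := (X in _ *m X = _) => Z1.
rewrite -SM' in Z1.
have : (\sum_i q' i)%:C = \tr (rdiag q *m Z) :> R[i].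
  rewrite rmorph_sum /= -SW -(mxtrace_congruence _ S'M Z1) S'W.
  apply: eq_bigr => i _; rewrite rdiagE; reflexivity.
have -> : \tr (rdiag q *m Z) = (\sum_i q i / e i -
    t / (1 + t * a) * \sum_i q i * s i / e i ^+ 2)%:C.
  rewrite mulr_sumr -sumrB rmorph_sum /=; apply: eq_bigr => i _.
  rewrite /Z mul_diag_mx !mxE eqxx mulr1n big_ord1.
  rewrite trmxCE mulC_sqn rdiag_mulE sqn_scale -/(s i) -rmorphM -rmorphB -rmorphM.
  congr (real_complex_def _ _); move: (t / _) (e i) (e0 i) (s i) => c x x0 y; field.
  by rewrite gt_eqF.
by case=> ->; rewrite -/e -/s.
Qed.

End ComplexMatrices.

(** * Square-integrable complex functions *)

Section ComplexL2Theory.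
Local Open Scope classical_set_scope.
Local Open Scope ring_scope.
Local Open Scope complex_scope.
Context d (D : measurableType d) (R : realType).
Variable mu : {measure set D -> \bar R}.
Implicit Types (f g h : D -> R[i]) (r : R).

Lemma sqr_normc (z : R[i]) : Normc.normc z ^+ 2 = sqn z.
Proof. by case: z => a b; rewrite /sqn /= sqr_sqrtr // addr_ge0 ?sqr_ge0. Qed.

Lemma normc_ge0 (z : R[i]) : 0 <= Normc.normc z.
Proof. by case: z => a b; rewrite /= sqrtr_ge0. Qed.

Definition sqint f : \bar R := (\int[mu]_x (sqn (f x))%:E)%E.

Lemma sqint_ge0 f : (0 <= sqint f)%E.
Proof. by apply: integral_ge0 => x _; rewrite lee_fin sqn_ge0. Qed.

Lemma L2norm_sqr f : (L2norm mu f `^ 2 = sqint f)%E.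
Proof.
rewrite /L2norm poweR_Lnorm //; apply: eq_integral => x _.
by rewrite abse_EFin poweR_EFin ger0_norm ?normc_ge0 // powR_mulrn ?normc_ge0 // sqr_normc.
Qed.

Lemma poweR2_mono (x y : \bar R) : (0 <= x)%E -> (0 <= y)%E ->
  (x `^ 2 <= y `^ 2)%E = (x <= y)%E.
Proof.
move=> x0 y0; have mono r u v : 0 <= r -> (0 <= u)%E -> (0 <= v)%E ->
    (u <= v)%E -> (u `^ r <= v `^ r)%E.
  move=> r0 u0 v0; apply: gt0_ler_poweR => //.
    by rewrite in_itv /= u0 leey.
  by rewrite in_itv /= v0 leey.
apply/idP/idP => [le_xy|]; last exact: mono.
have : ((x `^ 2) `^ (2^-1) <= (y `^ 2) `^ (2^-1))%E.
  by apply: mono => //; rewrite ?poweR_ge0.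
by rewrite -!poweRrM divff // !poweRe1.
Qed.

Lemma L2norm_ge0 f : (0 <= L2norm mu f)%E.
Proof. exact: Lnorm_ge0. Qed.

Lemma L2norm_le f r : 0 <= r -> (L2norm mu f <= r%:E)%E = (sqint f <= (r ^+ 2)%:E)%E.
Proof.
by move=> r0; rewrite -L2norm_sqr -powR_mulrn // -poweR_EFin poweR2_mono ?L2norm_ge0.
Qed.

Lemma L2norm_ge f r : 0 <= r -> (r%:E <= L2norm mu f)%E = ((r ^+ 2)%:E <= sqint f)%E.
Proof.
by move=> r0; rewrite -L2norm_sqr -powR_mulrn // -poweR_EFin poweR2_mono ?L2norm_ge0.
Qed.

Definition cintegrable f :=
  mu.-integrable setT (EFin \o (fun x => complex.Re (f x))) /\
  mu.-integrable setT (EFin \o (fun x => complex.Im (f x))).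

Lemma L2_measurable f : L2 mu f ->
  measurable_fun setT (fun x => complex.Re (f x)) /\
  measurable_fun setT (fun x => complex.Im (f x)).
Proof.
have H (u : D -> R) : u \in Lfun mu 2%:E -> measurable_fun setT u.
  by case/andP=> mu_ _; move: mu_; rewrite inE.
by case=> /H ? /H.
Qed.

Lemma cintegrableD f g : cintegrable f -> cintegrable g ->
  cintegrable (fun x => f x + g x) /\
  cintegral mu (fun x => f x + g x) = cintegral mu f + cintegral mu g.
Proof.
move=> [f1 f2] [g1 g2].
have ReD : (fun x => complex.Re (f x + g x)) = fun x => complex.Re (f x) + complex.Re (g x).
  by apply/funext => x; case: (f x) (g x) => ? ? [].
have ImD : (fun x => complex.Im (f x + g x)) = fun x => complex.Im (f x) + complex.Im (g x).
  by apply/funext => x; case: (f x) (g x) => ? ? [].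
split; first split.
- by rewrite ReD; exact: (integrableD measurableT f1 g1).
- by rewrite ImD; exact: (integrableD measurableT f2 g2).
by rewrite /cintegral ReD ImD !RintegralD.
Qed.

Lemma cintegrableZ (a : R[i]) f : cintegrable f ->
  cintegrable (fun x => a * f x) /\
  cintegral mu (fun x => a * f x) = a * cintegral mu f.
Proof.
move=> [f1 f2]; case: a => a b.
have ReM : (fun x => complex.Re (Complex a b * f x)) =
    fun x => a * complex.Re (f x) - b * complex.Im (f x).
  by apply/funext => x; case: (f x).
have ImM : (fun x => complex.Im (Complex a b * f x)) =
    fun x => a * complex.Im (f x) + b * complex.Re (f x).
  by apply/funext => x; case: (f x).
have iZ (c : R) (h : D -> R) : mu.-integrable setT (EFin \o h) ->
    mu.-integrable setT (EFin \o (fun x => c * h x)).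
  by move=> ih; exact: (integrableZl measurableT c ih).
split; first split.
- rewrite ReM; exact: (integrableB measurableT (iZ a _ f1) (iZ b _ f2)).
- rewrite ImM; exact: (integrableD measurableT (iZ a _ f2) (iZ b _ f1)).
rewrite /cintegral ReM ImM RintegralB ?RintegralD ?RintegralZl //; exact: iZ.
Qed.

Lemma cintegrable0 : cintegrable (fun=> 0) /\ cintegral mu (fun=> 0) = 0.
Proof.
have i0 : mu.-integrable setT (EFin \o (fun=> 0 : R)) by exact: integrable0.
by split; [split|rewrite /cintegral /= /Rintegral integral0].
Qed.

Lemma cintegrable_sum (I : Type) (s : seq I) (F : I -> D -> R[i]) :
  (forall i, cintegrable (F i)) ->
  cintegrable (fun x => \sum_(i <- s) F i x) /\
  cintegral mu (fun x => \sum_(i <- s) F i x) = \sum_(i <- s) cintegral mu (F i).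
Proof.
move=> iF; elim: s => [|i s [IH1 IH2]].
  have -> : (fun x => \sum_(i <- [::]) F i x) = fun=> 0.
    by apply/funext => x; rewrite big_nil.
  by rewrite big_nil; exact: cintegrable0.
have -> : (fun x => \sum_(j <- i :: s) F j x) = fun x => F i x + \sum_(j <- s) F j x.
  by apply/funext => x; rewrite big_cons.
by have [H1 H2] := cintegrableD (iF i) IH1; rewrite big_cons -IH2; split.
Qed.

Lemma L2_mul_conj f g : L2 mu f -> L2 mu g -> cintegrable (fun x => f x * Num.conj (g x)).
Proof.
move=> [f1 f2] [g1 g2].
have ReM : (fun x => complex.Re (f x * Num.conj (g x))) =
    fun x => complex.Re (f x) * complex.Re (g x) + complex.Im (f x) * complex.Im (g x).
  by apply/funext => x; case: (f x) (g x) => a b [c e] /=; rewrite mulrN opprK.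
have ImM : (fun x => complex.Im (f x * Num.conj (g x))) =
    fun x => complex.Im (f x) * complex.Re (g x) - complex.Re (f x) * complex.Im (g x).
  by apply/funext => x; case: (f x) (g x) => a b [c e] /=; rewrite mulrN addrC.
have iM u v : u \in Lfun mu 2%:E -> v \in Lfun mu 2%:E -> mu.-integrable setT (EFin \o (u \* v)).
  by move=> lu lv; apply/Lfun1_integrable; exact: Lfun2_mul_Lfun1.
split.
- rewrite ReM; exact: (integrableD measurableT (iM _ _ f1 g1) (iM _ _ f2 g2)).
- rewrite ImM; exact: (integrableB measurableT (iM _ _ f2 g1) (iM _ _ f1 g2)).
Qed.

Lemma L2D f g : L2 mu f -> L2 mu g -> L2 mu (fun x => f x + g x).
Proof.
move=> [f1 f2] [g1 g2].
have [_ cl] := Lfun_submod_closed mu (lee1n 2).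
split.
- rewrite (_ : (fun x => _) = 1 *: (fun x => complex.Re (f x)) + (fun x => complex.Re (g x))).
    exact: cl.
  by apply/funext => x; rewrite scale1r /= -[RHS]/(_ + _); case: (f x) (g x) => ? ? [].
- rewrite (_ : (fun x => _) = 1 *: (fun x => complex.Im (f x)) + (fun x => complex.Im (g x))).
    exact: cl.
  by apply/funext => x; rewrite scale1r /= -[RHS]/(_ + _); case: (f x) (g x) => ? ? [].
Qed.

Lemma L2Z (a : R[i]) f : L2 mu f -> L2 mu (fun x => a * f x).
Proof.
move=> [f1 f2]; case: a => a b.
have [z cl] := Lfun_submod_closed mu (lee1n 2).
have clZ (c : R) (h : D -> R) : h \in Lfun mu 2%:E -> c *: h \in Lfun mu 2%:E.
  by move=> lh; rewrite -[c *: h]addr0; exact: cl.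
split.
- rewrite (_ : (fun x => _) = a *: (fun x => complex.Re (f x)) + (- b) *: (fun x => complex.Im (f x))).
    by apply: cl => //; exact: clZ.
  by apply/funext => x; rewrite /= -[RHS]/(_ * _ + _ * _); case: (f x) => u v /=; rewrite mulNr.
- rewrite (_ : (fun x => _) = a *: (fun x => complex.Im (f x)) + b *: (fun x => complex.Re (f x))).
    by apply: cl => //; exact: clZ.
  by apply/funext => x; rewrite /= -[RHS]/(_ * _ + _ * _); case: (f x) => u v /=.
Qed.

Lemma L2_0 : L2 mu (fun=> 0).
Proof. by have [z _] := Lfun_submod_closed mu (lee1n 2); split. Qed.

Lemma L2_sum (I : Type) (s : seq I) (F : I -> D -> R[i]) :
  (forall i, L2 mu (F i)) -> L2 mu (fun x => \sum_(i <- s) F i x).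
Proof.
move=> iF; elim: s => [|i s IH].
  rewrite (_ : (fun x => _) = fun=> 0); first exact: L2_0.
  by apply/funext => x; rewrite big_nil.
rewrite (_ : (fun x => _) = fun x => F i x + \sum_(j <- s) F j x).
  exact: L2D.
by apply/funext => x; rewrite big_cons.
Qed.

Lemma sqint_L2 f : L2 mu f -> sqint f = (complex.Re (cintegral mu (fun x => f x * Num.conj (f x))))%:E.
Proof.
move=> lf; have [H _] := L2_mul_conj lf lf.
rewrite /cintegral /= /Rintegral fineK ?integrable_fin_num //.
by apply: eq_integral => x _; rewrite mulC_sqn.
Qed.

Definition gram n (e : 'I_n -> D -> R[i]) : 'M[R[i]]_n :=
  \matrix_(j, k) cintegral mu (fun x => e j x * Num.conj (e k x)).

Lemma sqint_gram n (e : 'I_n -> D -> R[i]) (u : 'rV_n) : (forall i, L2 mu (e i)) ->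
  sqint (fun x => \sum_i u 0 i * e i x) = (complex.Re (qform (gram e) u))%:E.
Proof.
move=> le; rewrite sqint_L2; last by apply: L2_sum => i; exact: L2Z.
congr (complex.Re _)%:E.
have -> : (fun x => (\sum_i u 0 i * e i x) * Num.conj (\sum_i u 0 i * e i x)) =
  fun x => \sum_k \sum_j (u 0 j * Num.conj (u 0 k)) * (e j x * Num.conj (e k x)).
  apply/funext => x; rewrite rmorph_sum mulr_sumr; apply: eq_bigr => k _.
  rewrite mulr_suml; apply: eq_bigr => j _; rewrite rmorphM /=; ring.
have iE j k := L2_mul_conj (le j) (le k).
have iS k : cintegrable (fun x => \sum_j (u 0 j * Num.conj (u 0 k)) * (e j x * Num.conj (e k x))).
  by apply: (cintegrable_sum _ _).1 => j; exact: (cintegrableZ _ _).1.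
rewrite (cintegrable_sum _ iS).2 /qform !mxE; apply: eq_bigr => k _.
rewrite (cintegrable_sum _ _).2 => [|j]; last exact: (cintegrableZ _ _).1.
rewrite !mxE mulr_suml; apply: eq_bigr => j _.
by rewrite (cintegrableZ _ _).2 // !mxE mulrAC.
Qed.

Lemma cintegral_conj f : cintegrable f ->
  cintegral mu (fun x => Num.conj (f x)) = Num.conj (cintegral mu f).
Proof.
move=> [_ iI]; rewrite /cintegral.
have -> : (fun x => complex.Im (Num.conj (f x))) = (fun x => -1 * complex.Im (f x)).
  by apply/funext => x; case: (f x) => a b /=; rewrite mulN1r.
have -> : (fun x => complex.Re (Num.conj (f x))) = (fun x => complex.Re (f x)).
  by apply/funext => x; case: (f x).
by rewrite RintegralZl // mulN1r.
Qed.

Lemma gram_herm n (e : 'I_n -> D -> R[i]) : (forall i, L2 mu (e i)) ->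
  (map_mx Num.conj (gram e)^T) = gram e.
Proof.
move=> le; apply/matrixP => j k; rewrite !mxE -cintegral_conj; last exact: L2_mul_conj.
by congr cintegral; apply/funext => x; rewrite rmorphM /= conjCK mulrC.
Qed.

Lemma gram_psd n (e : 'I_n -> D -> R[i]) : (forall i, L2 mu (e i)) -> psd (gram e).
Proof.
move=> le; split=> [|u]; first exact: gram_herm.
have H : Num.conj (qform (gram e) u) = qform (gram e) u.
  rewrite /qform -trmxCE (trmxC_mul _ (map_mx _ _)) (trmxC_mul u) trmxCK (gram_herm le).
  by rewrite mulmxA.
rewrite lecE; have -> : complex.Im (qform (gram e) u) = 0.
  by move: H; case: (qform _ _) => a b /(congr1 (@complex.Im R)) /=; lra.
by rewrite eqxx /= -lee_fin -sqint_gram // sqint_ge0.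
Qed.

End ComplexL2Theory.

Section QformSum.
Local Open Scope ring_scope.
Local Open Scope complex_scope.
Variable R : rcfType.

Lemma qform_sum n (I : Type) (s : seq I) (M : I -> 'M[R[i]]_n) (u : 'rV_n) :
  qform (\sum_(i <- s) M i) u = \sum_(i <- s) qform (M i) u.
Proof.
elim: s => [|i s IH]; last by rewrite !big_cons qformD IH.
by rewrite !big_nil /qform mulmx0 mul0mx mxE.
Qed.

Lemma sqn_eq0 (z : R[i]) : (sqn z == 0) = (z == 0).
Proof.
case: z => a b; rewrite /sqn /= paddr_eq0 ?sqr_ge0 // !sqrf_eq0.
by rewrite eq_complex.
Qed.

Lemma sqn_gt0 (z : R[i]) : (0 < sqn z) = (z != 0).
Proof. by rewrite lt_neqAle sqn_ge0 andbT eq_sym sqn_eq0. Qed.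
End QformSum.

(** * Selection of sampling points *)

Section BarrierSelection.
Local Open Scope classical_set_scope.
Local Open Scope ring_scope.
Local Open Scope complex_scope.
Local Open Scope sesquilinear_scope.
Context d (D : measurableType d) (R : realType).
Variable mu : {measure set D -> \bar R}.

Lemma measurable_sqn (f : D -> R[i]) : L2 mu f ->
  measurable_fun setT (fun x => (sqn (f x) : R)%:E).
Proof.
move=> /L2_measurable [mR mI]; apply/measurable_EFinP.
by apply: measurable_funD; apply: measurable_funX.
Qed.

Lemma integral_sqn_sum n (g : 'I_n -> D -> R[i]) (q c : 'I_n -> R) :
  (forall i, L2 mu (g i)) -> (forall i, 0 <= c i) ->
  (forall i, sqint mu (g i) = (q i)%:E) ->
  (\int[mu]_x (\sum_i c i * sqn (g i x))%:E)%E = (\sum_i c i * q i)%:E.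
Proof.
move=> lg c0 gq; under eq_integral => x _ do rewrite -sumEFin.
rewrite ge0_integral_sum //; last 2 first.
- move=> i; under eq_fun do rewrite EFinM.
  by apply: emeasurable_funM => //; exact: measurable_sqn.
- by move=> i x _; rewrite lee_fin mulr_ge0 ?sqn_ge0.
rewrite -sumEFin; apply: eq_bigr => i _; under eq_integral => x _ do rewrite EFinM.
rewrite ge0_integralZl_EFin //; first by rewrite EFinM -gq.
- by move=> x _; rewrite lee_fin sqn_ge0.
- exact: measurable_sqn.
Qed.

Variables (n : nat) (e : 'I_n -> D -> R[i]).
Hypothesis L2e : forall i, L2 mu (e i).
Variable (r : D -> \bar R).
Hypotheses (r0 : forall x, (0 <= r x)%E) (mr : measurable_fun setT r).

Definition col_at (x : D) : 'cV[R[i]]_n := \col_i e i x.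

(** Subtracting W / (4K) raises the trace by [Delta]; adding the rank-one term lowers it by t B / (1
    + t A). The two balance when 1/t = (B - Delta A) / Delta, and the condition t r <= rho reads r /
    rho <= 1/t. So a point with Delta A + (Delta / rho) r < B is wanted, and comparing integrals
    provides one. The cost [r] will be the squared evaluation norm on the part of the space that [e]
    misses. *)
Lemma exists_barrier_point (S : 'M[R[i]]_n) (q : 'I_n -> R) (K rho : R) :
  S *m gram mu e *m S^t* = rdiag q -> (forall i, 0 <= q i) ->
  0 < K -> \sum_i q i <= K -> 0 < rho ->
  (\int[mu]_x r x <= (rho * K)%:E)%E ->
  let s := fun x i => sqn ((S *m col_at x) i 0) in
  let f := fun i => 1 - (4 * K)^-1 * q i in
  exists (x : D) (t : R), [/\ 0 <= t, (t%:E * r x <= rho%:E)%E &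
    \sum_i q i / f i -
      t / (1 + t * \sum_i s x i / f i) * \sum_i q i * s x i / f i ^+ 2 <= K].
Proof.
move=> SW q0 K0 qK rho0 rK s f.
pose dl := (4 * K)^-1.
have dl0 : 0 < dl by rewrite invr_gt0 mulr_gt0.
have q_le i : q i <= K.
  by apply: le_trans qK; rewrite (bigD1 i) //= lerDl sumr_ge0.
have dq i : 0 <= dl * q i <= 1 / 4.
  have K4 : 0 < 4 * K by rewrite mulr_gt0.
  apply/andP; split; first by rewrite mulr_ge0 // invr_ge0 ltW.
  have -> : 1 / 4 = dl * K by rewrite /dl; field; rewrite gt_eqF.
  by rewrite ler_wpM2l // invr_ge0 ltW.
have f34 i : 3 / 4 <= f i <= 1.
  by have := dq i; rewrite /f -/dl => /andP[]; lra.
have fp i : 0 < f i by have /andP[] := f34 i; lra.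
pose g i x := (S *m col_at x) i 0.
have gE i : g i = fun x => \sum_k (row i S) 0 k * e k x.
  by apply/funext => x; rewrite /g !mxE; apply: eq_bigr => k _; rewrite !mxE.
have lg i : L2 mu (g i) by rewrite gE; apply: L2_sum => k; exact: L2Z.
have gq i : sqint mu (g i) = (q i)%:E.
  by rewrite gE sqint_gram // -row_qform SW rdiagE.
pose Delta := \sum_i q i / f i - \sum_i q i.
have DE : Delta = dl * \sum_i q i ^+ 2 / f i.
  rewrite /Delta -sumrB mulr_sumr; apply: eq_bigr => i _.
  have fn := lt0r_neq0 (fp i); rewrite -[X in _ - X](mulfK fn) -mulrBl.
  by rewrite mulrA; congr (_ / _); rewrite /f -/dl; ring.
pose Q2 := \sum_i q i / f i ^+ 2 * q i.
have D_le : Delta <= dl * Q2.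
  rewrite DE ler_wpM2l ?(ltW dl0) //.
  apply: ler_sum => i _; rewrite [leRHS]mulrAC -expr2 ler_wpM2l ?sqr_ge0 //.
  have /andP[_ f1] := f34 i.
  by rewrite lef_pV2 ?posrE ?exprn_gt0 // expr2 ler_piMl // ltW.
have D0 : 0 <= Delta.
  by rewrite DE mulr_ge0 ?(ltW dl0) // sumr_ge0 // => i _; rewrite divr_ge0 ?sqr_ge0 // ltW.
(* The trace does not grow, so weight 0 works at any point. *)
have [D00|Dn0] := eqVneq Delta 0.
  exists point, 0; split=> //; first by rewrite mul0e lee_fin ltW.
  by rewrite !mul0r subr0; move: D00 => /eqP; rewrite subr_eq0 => /eqP ->.
have Dp : 0 < Delta by rewrite lt_neqAle eq_sym Dn0.
pose A x := \sum_i (f i)^-1 * sqn (g i x).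
pose B x := \sum_i (q i / f i ^+ 2) * sqn (g i x).
have [x xlt] : exists x, ((Delta * A x)%:E + (Delta / rho)%:E * r x < (B x)%:E)%E.
  apply: contrapT => /forallNP H.
  have H' x : ((B x)%:E <= (Delta * A x)%:E + (Delta / rho)%:E * r x)%E.
    by rewrite leNgt; apply/negP/H.
  have A0 x : 0 <= A x.
    by apply: sumr_ge0 => i _; rewrite mulr_ge0 ?sqn_ge0 // invr_ge0 ltW.
  have mA (c : 'I_n -> R) : measurable_fun setT (fun x => \sum_i c i * sqn (g i x)).
    apply: measurable_sum => i; apply: measurable_funM => //.
    by apply/measurable_EFinP; exact: measurable_sqn.
  have mDA : measurable_fun setT (fun x => (Delta * A x)%:E).
    apply/measurable_EFinP; apply: measurable_funM => //; exact: mA.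
  have mr' : measurable_fun setT (fun x => (Delta / rho)%:E * r x)%E.
    exact: emeasurable_funM.
  have Dr0 : 0 <= Delta / rho by rewrite divr_ge0 // ltW.
  have : (\int[mu]_x (B x)%:E <= \int[mu]_x ((Delta * A x)%:E + (Delta / rho)%:E * r x))%E.
    apply: ge0_le_integral => //.
    - move=> x _; rewrite lee_fin sumr_ge0 // => i _.
      by rewrite mulr_ge0 ?sqn_ge0 // divr_ge0 ?exprn_ge0 // ltW.
    - by apply/measurable_EFinP; exact: mA.
    - exact: emeasurable_funD.
  rewrite ge0_integralD //; last 2 first.
  - by move=> x _; rewrite lee_fin mulr_ge0.
  - by move=> x _; rewrite mule_ge0.
  rewrite [X in (_ <= _ + X)%E -> _]ge0_integralZl_EFin //.
  have -> : (\int[mu]_x (Delta * A x)%:E = \int[mu]_x (Delta%:E * (A x)%:E))%E.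
    by apply: eq_integral => x _; rewrite EFinM.
  rewrite ge0_integralZl_EFin //; last 2 first.
  - by move=> x _; rewrite lee_fin.
  - by apply/measurable_EFinP; exact: mA.
  rewrite (integral_sqn_sum lg _ gq); last by move=> i; rewrite divr_ge0 ?exprn_ge0 // ltW.
  rewrite (integral_sqn_sum lg _ gq); last by move=> i; rewrite invr_ge0 ltW.
  apply/negP; rewrite -ltNge -/Q2.
  apply: (@le_lt_trans _ _ (Delta%:E * (4 / 3 * K)%:E + (Delta / rho)%:E * (rho * K)%:E)%E).
    apply: leeD; last by rewrite lee_wpmul2l.
    rewrite lee_wpmul2l // lee_fin.
    apply: (@le_trans _ _ (4 / 3 * \sum_i q i)); last by rewrite ler_wpM2l.
    rewrite mulr_sumr; apply: ler_sum => i _; rewrite ler_wpM2r //.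
    have /andP[f3 _] := f34 i.
    rewrite -[4 / 3]invf_div lef_pV2 ?posrE ?fp ?divr_gt0 //.
  (* The integral of [A] is at most 4K/3 because [f i >= 3/4], and that of r / rho is at most K. As
     Delta <= Q2 / (4K), the left side is at most 7/12 Q2. *)
  rewrite -!EFinM -EFinD lte_fin.
  have -> : Delta * (4 / 3 * K) + Delta / rho * (rho * K) = Delta * (7 / 3 * K).
    by field; rewrite gt_eqF.
  have Q20 : 0 < Q2.
    by move: (lt_le_trans Dp D_le); rewrite pmulr_rgt0 // invr_gt0 mulr_gt0.
  apply: (@le_lt_trans _ _ (dl * Q2 * (7 / 3 * K))).
    by rewrite ler_wpM2r // mulr_ge0 // ltW.
  rewrite [X in X < _](_ : _ = 7 / 12 * Q2); last by rewrite /dl; field; rewrite gt_eqF.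
  lra.
have AE : \sum_i s x i / f i = A x by apply: eq_bigr => i _; rewrite mulrC.
have BE : \sum_i q i * s x i / f i ^+ 2 = B x by apply: eq_bigr => i _; rewrite mulrAC.
have A0 : 0 <= A x.
  by apply: sumr_ge0 => i _; rewrite mulr_ge0 ?sqn_ge0 // invr_ge0 ltW.
have Dr0 : 0 < Delta / rho by rewrite divr_gt0.
(* An infinite cost would make the left side of [xlt] infinite. *)
have rfin : r x \is a fin_num.
  rewrite ge0_fin_numE //; case: (r x) (r0 x) xlt => [y| |] // _.
    by rewrite ltry.
  by rewrite gt0_muley ?lte_fin.
have [y rE] : exists y, r x = y%:E by exists (fine (r x)); rewrite fineK.
have y0 : 0 <= y by rewrite -lee_fin -rE.
rewrite rE -EFinM -EFinD lte_fin in xlt.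
exists x.
(* The inverse of the weight: t = 1/u solves t B / (1 + t A) = Delta, which brings the trace back to
   the sum of the [q i]. *)
pose u := (B x - Delta * A x) / Delta.
have u_gt : y / rho < u.
  rewrite ltr_pdivlMr // ltrBrDl; apply: le_lt_trans xlt.
  by rewrite lerD2l mulrAC [leRHS]mulrAC [y * _]mulrC.
have u0 : 0 < u by apply: le_lt_trans u_gt; rewrite divr_ge0 // ltW.
exists u^-1; rewrite AE BE; split; first by rewrite invr_ge0 ltW.
  rewrite rE -EFinM lee_fin mulrC ler_pdivrMr //.
  by move: u_gt; rewrite ltr_pdivrMr // mulrC => /ltW.
rewrite lerBlDr; have -> : u^-1 / (1 + u^-1 * A x) * B x = Delta.
  have un : u != 0 by rewrite gt_eqF.
  have E : Delta * (u + A x) = B x by rewrite /u; field.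
  rewrite -E; field; rewrite un /= gt_eqF //; exact: ltr_wpDr.
by rewrite /Delta addrCA addrC; lra.
Qed.

Definition barrier_mx (eps l : R) (x : nat -> D) (t : nat -> R) (j : nat) : 'M[R[i]]_n :=
  eps%:C%:M + l%:C *: gram mu e +
  \sum_(i < j) (t i)%:C *: (col_at (x i) *m (col_at (x i))^t*).

Lemma barrier_iterate (eps K rho : R) : 0 < eps -> 0 < K -> 0 < rho ->
  (\int[mu]_x r x <= (rho * K)%:E)%E ->
  potential_le (gram mu e) (eps%:C%:M + gram mu e) K ->
  forall j, exists (x : nat -> D) (t : nat -> R),
  [/\ forall i, 0 <= t i, forall i, ((t i)%:E * r (x i) <= rho%:E)%E,
    posdef (barrier_mx eps (1 - j%:R / (4 * K)) x t j) &
    potential_le (gram mu e) (barrier_mx eps (1 - j%:R / (4 * K)) x t j) K].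
Proof.
move=> eps0 K0 rho0 rK pot0; elim=> [|j [x [t [t0 tr pM [S [q [SM SW qK]]]]]]].
  exists (fun=> point), (fun=> 0).
  rewrite /barrier_mx big_ord0 addr0 mul0r subr0 scale1r; split=> //.
    by move=> i; rewrite mul0e lee_fin ltW.
  have [gh gp] := gram_psd L2e; split.
    rewrite trmxCD gh; congr (_ + _); apply/matrixP => i k; rewrite !mxE eq_sym.
    by case: eqP => _; rewrite ?mulr1n ?mulr0n ?rmorph0 ?conjC_real.
  move=> u u0; rewrite qformD ltr_pwDl //.
  have -> : eps%:C%:M = rdiag (fun=> eps) :> 'M[R[i]]_n.
    by apply/matrixP => i k; rewrite !mxE.
  rewrite qform_rdiag ltr0c; have [i ui] := rV0Pn _ u0.
  rewrite (bigD1 i) //= ltr_pwDl //.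
    by rewrite mulr_gt0 // sqn_gt0.
  by apply: sumr_ge0 => k _; rewrite mulr_ge0 ?sqn_ge0 // ltW.
have gpsd := gram_psd L2e.
have q0 i : 0 <= q i by exact: psd_diag_ge0 SW.
have [y [u [u0 ur le_K]]] := exists_barrier_point SW q0 K0 qK rho0 rK.
have dq i : (4 * K)^-1 * q i < 1.
  have q_le : q i <= K.
    by apply: le_trans qK; rewrite (bigD1 i) //= lerDl sumr_ge0.
  by rewrite mulrC ltr_pdivrMr ?mulr_gt0 // mul1r; lra.
have [pM' potM'] := barrier_step SM SW gpsd.1 pM.1 u0 dq le_K.
(* Only the first [j] entries of [x] and [t] enter the current matrix, so entry [j] is free to be
   overwritten. *)
exists (fun i => if i == j then y else x i), (fun i => if i == j then u else t i).
set x' := fun i => _; set t' := fun i => _.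
have E : barrier_mx eps (1 - j.+1%:R / (4 * K)) x' t' j.+1 =
    barrier_mx eps (1 - j%:R / (4 * K)) x t j - (4 * K)^-1%:C *: gram mu e +
    u%:C *: (col_at y *m (col_at y)^t*).
  rewrite /barrier_mx big_ord_recr /= /x' /t' eqxx addrA; congr (_ + _).
  rewrite (eq_bigr (fun i : 'I_j => (t i)%:C *: (col_at (x i) *m (col_at (x i))^t*))); last first.
    by move=> i _; rewrite ltn_eqF.
  rewrite [in RHS]addrAC; congr (_ + _); rewrite -addrA -scalerBl -rmorphB.
  by congr (_ + _%:C *: _); rewrite -natr1 mulrDl mul1r opprD addrA.
rewrite E; split=> //.
  by move=> i; rewrite /t'; case: eqP.
by move=> i; rewrite /t' /x'; case: eqP.
Qed.

(** After [m >= 8 * K] steps the coefficient of the Gram matrix is at most -1, so positivity of the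
    final matrix is the claimed inequality. *)
Lemma barrier_selection (eps K rho : R) (m : nat) : 0 < eps -> 0 < K -> 0 < rho ->
  (\int[mu]_x r x <= (rho * K)%:E)%E ->
  potential_le (gram mu e) (eps%:C%:M + gram mu e) K ->
  8 * K <= m%:R ->
  exists (x : nat -> D) (t : nat -> R),
  [/\ forall i, 0 <= t i, forall i, ((t i)%:E * r (x i) <= rho%:E)%E &
    forall u : 'rV_n, complex.Re (qform (gram mu e) u) <=
      eps * \sum_i sqn (u 0 i) +
      \sum_(i < m) t i * sqn (\sum_k u 0 k * e k (x i))].
Proof.
move=> eps0 K0 rho0 rK pot0 mK.
have [x [t [t0 tr [_ pM] _]]] := barrier_iterate eps0 K0 rho0 rK pot0 m.
exists x, t; split=> // u.
have [->|u0] := eqVneq u 0.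
  rewrite /qform mul0mx mul0mx mxE addr_ge0 ?mulr_ge0 ?(ltW eps0) //.
    by apply: sumr_ge0 => i _; exact: sqn_ge0.
  by apply: sumr_ge0 => i _; rewrite mulr_ge0 ?sqn_ge0.
have := pM u u0; rewrite /barrier_mx !qformD qformZ.
have -> : eps%:C%:M = rdiag (fun=> eps) :> 'M[R[i]]_n.
  by apply/matrixP => i k; rewrite !mxE.
rewrite qform_rdiag qform_sum.
rewrite (eq_bigr (fun i : 'I_m => (t i * sqn (\sum_k u 0 k * e k (x i)))%:C)); last first.
  move=> i _; rewrite qformZ qform_rank1 [RHS]rmorphM /=; congr (_ * (sqn _)%:C).
  by rewrite !mxE; apply: eq_bigr => k _; rewrite !mxE.
rewrite -rmorph_sum -mulr_sumr.
have := (gram_psd L2e).2 u; case: (qform _ _) => a b; rewrite lecE => /andP[/eqP /= b0 a0].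
rewrite b0 complexr0; rewrite -!rmorphM -!rmorphD ltr0c => H.
have : 2 <= m%:R / (4 * K) by rewrite ler_pdivlMr ?mulr_gt0 //; lra.
nra.
Qed.

End BarrierSelection.

Section SqnFacts.
Local Open Scope ring_scope.
Local Open Scope complex_scope.
Variable R : rcfType.
Implicit Types (z w : R[i]) (a b : R).

Lemma sqnM z w : sqn (z * w) = sqn z * sqn w.
Proof. by case: z w => a b [c e]; rewrite /sqn /=; ring. Qed.

Lemma sqnN z : sqn (- z) = sqn z.
Proof. by case: z => a b; rewrite /sqn /=; ring. Qed.

Lemma sqnD_le z w : sqn (z + w) <= 2 * sqn z + 2 * sqn w.
Proof.
case: z w => a b [c e]; rewrite /sqn /= -subr_ge0.
have -> : 2 * (a ^+ 2 + b ^+ 2) + 2 * (c ^+ 2 + e ^+ 2) - ((a + c) ^+ 2 + (b + e) ^+ 2)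
  = (a - c) ^+ 2 + (b - e) ^+ 2 by ring.
by rewrite addr_ge0 ?sqr_ge0.
Qed.

Lemma Re_mulconj_le z w : 2 * complex.Re (z * Num.conj w) <= sqn z + sqn w.
Proof.
case: z w => a b [c e]; rewrite /sqn /= -subr_ge0.
have -> : a ^+ 2 + b ^+ 2 + (c ^+ 2 + e ^+ 2) - 2 * (a * c - b * - e)
  = (a - c) ^+ 2 + (b - e) ^+ 2 by ring.
by rewrite addr_ge0 ?sqr_ge0.
Qed.

Lemma sqnD z w : sqn (z + w) = sqn z + 2 * complex.Re (z * Num.conj w) + sqn w.
Proof. by case: z w => a b [c e]; rewrite /sqn /=; ring. Qed.

Lemma sqr_Re_mulconj_le z w :
  (2 * complex.Re (z * Num.conj w)) ^+ 2 <= 4 * sqn z * sqn w.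
Proof.
case: z w => a b [c e]; rewrite /sqn /= -subr_ge0.
have -> : 4 * (a ^+ 2 + b ^+ 2) * (c ^+ 2 + e ^+ 2) - (2 * (a * c - b * - e)) ^+ 2
  = (2 * (a * e - b * c)) ^+ 2 by ring.
exact: sqr_ge0.
Qed.

(** Cauchy-Schwarz. In the inductive step, with f and g the squared moduli of the new terms, the
    square of the cross term is at most 4 (f B) (A g), hence at most (f B + A g)^2. *)
Lemma sqn_sum_le (I : Type) (s : seq I) (F G : I -> R[i]) :
  sqn (\sum_(i <- s) F i * G i) <=
  (\sum_(i <- s) sqn (F i)) * (\sum_(i <- s) sqn (G i)).
Proof.
elim: s => [|i s IH]; first by rewrite !big_nil /sqn /= !expr0n addr0 mulr0.
rewrite !big_cons; move: IH.
set A := (X in _ <= X * _ -> _); set B := (X in _ <= _ * X -> _); set S := (X in sqn X <= _ -> _).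
have A0 : 0 <= A by apply: sumr_ge0 => j _; exact: sqn_ge0.
have B0 : 0 <= B by apply: sumr_ge0 => j _; exact: sqn_ge0.
move: (sqn_ge0 (F i)) (sqn_ge0 (G i)) => f0 g0 SAB.
have -> : (sqn (F i) + A) * (sqn (G i) + B) =
  sqn (F i * G i) + (sqn (F i) * B + A * sqn (G i)) + A * B by rewrite sqnM; ring.
pose p := 2 * complex.Re (F i * G i * Num.conj S).
rewrite sqnD -/p.
suff : p <= sqn (F i) * B + A * sqn (G i) by lra.
have X0 : 0 <= sqn (F i) * B + A * sqn (G i) by rewrite addr_ge0 ?mulr_ge0.
have [p0|p0] := lerP p 0; first exact: le_trans X0.
rewrite -ler_sqr ?nnegrE ?(ltW p0) //.
apply: (@le_trans _ _ (4 * (sqn (F i) * sqn (G i)) * sqn S)).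
  by rewrite -sqnM; exact: sqr_Re_mulconj_le.
apply: (@le_trans _ _ (4 * (sqn (F i) * sqn (G i)) * (A * B))).
  by rewrite ler_wpM2l // mulr_ge0 // mulr_ge0.
rewrite -subr_ge0.
have -> : (sqn (F i) * B + A * sqn (G i)) ^+ 2 - 4 * (sqn (F i) * sqn (G i)) * (A * B)
  = (sqn (F i) * B - A * sqn (G i)) ^+ 2 by ring.
exact: sqr_ge0.
Qed.
End SqnFacts.

(** * Orthonormal systems in a reproducing kernel Hilbert space *)

Section Rkhs.
Local Open Scope classical_set_scope.
Local Open Scope ring_scope.
Local Open Scope complex_scope.
Variables (R : realType) (D : Type) (H : rkhs R D).
Implicit Types f g : H.
Local Notation dot := (rkhs_dot H).

Definition sqnorm f : R := complex.Re (dot f f).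

Lemma dot_sqnorm f : dot f f = (sqnorm f)%:C.
Proof.
rewrite /sqnorm -rkhs_normE RRe_real //; apply: rpredX; exact: normr_real.
Qed.

Lemma sqnorm_ge0 f : 0 <= sqnorm f.
Proof. by rewrite -ler0c -dot_sqnorm -rkhs_normE exprn_ge0. Qed.

Lemma norm_sqnorm f : `|f| = (Num.sqrt (sqnorm f))%:C.
Proof.
apply/eqP; rewrite -(@eqrXn2 _ 2) //; last by rewrite ler0c sqrtr_ge0.
by rewrite rkhs_normE dot_sqnorm -rmorphXn /= sqr_sqrtr ?sqnorm_ge0.
Qed.

Lemma sqnorm_eq0 f : (sqnorm f == 0) = (f == 0).
Proof.
apply/eqP/eqP => [s0|->]; last by rewrite /sqnorm linear0l.
by apply/eqP; rewrite -normr_eq0 norm_sqnorm s0 sqrtr0.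
Qed.

Lemma unit_ballE f : unit_ball H f <-> sqnorm f <= 1.
Proof.
rewrite /unit_ball /= norm_sqnorm -(rmorph1 (real_complex R)) lecR.
by rewrite -[X in _ <= X]sqrtr1 ler_sqrt.
Qed.

Lemma dotC f g : dot f g = Num.conj (dot g f).
Proof. by rewrite hermC expr0 mul1r. Qed.

Lemma dotZl (a : R[i]) f g : dot (a *: f) g = a * dot f g.
Proof. exact: linearZl_LR. Qed.

Lemma dotBl f g h : dot (f - g) h = dot f h - dot g h.
Proof. exact: linearBl. Qed.

Lemma dot0l f : dot 0 f = 0.
Proof. exact: linear0l. Qed.

Lemma dot0r f : dot f 0 = 0.
Proof. exact: linear0r. Qed.

Lemma dotZr (a : R[i]) f g : dot f (a *: g) = Num.conj a * dot f g.
Proof. exact: linearZr. Qed.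

Lemma sqnormZ (a : R[i]) f : sqnorm (a *: f) = sqn a * sqnorm f.
Proof.
rewrite /sqnorm dotZl dotZr mulrA mulC_sqn dot_sqnorm -rmorphM //.
Qed.

Lemma dotDl f g h : dot (f + g) h = dot f h + dot g h.
Proof. exact: linearDl. Qed.

Lemma dotDr f g h : dot h (f + g) = dot h f + dot h g.
Proof. exact: linearDr. Qed.

Lemma sqnormDd f g : dot f g = 0 -> sqnorm (f + g) = sqnorm f + sqnorm g.
Proof.
move=> fg0; rewrite /sqnorm dotDl !dotDr fg0 dotC -dotC [dot g f]dotC fg0 rmorph0.
by rewrite addr0 add0r raddfD.
Qed.

Section GramSchmidt.
Variable v : nat -> H.

Definition normalize f : H := if f == 0 then 0 else `|f|^-1 *: f.

(** The list keeps all earlier vectors, on which the next one depends, so that the recursion is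
    structural. *)
Fixpoint gs (n : nat) : seq H :=
  if n is k.+1 then
    rcons (gs k) (normalize (v k - \sum_(i < k) dot (v k) (gs k)`_i *: (gs k)`_i))
  else [::].

(* Linearly dependent terms of v yield the vector 0, so gse v is orthonormal only
   up to vanishing terms. *)
Definition gse (k : nat) : H := (gs k.+1)`_k.

Lemma size_gs n : size (gs n) = n.
Proof. by elim: n => //= n IH; rewrite size_rcons IH. Qed.

Lemma nth_gs n i : (i < n)%N -> (gs n)`_i = gse i.
Proof.
elim: n => // n IH; rewrite ltnS leq_eqVlt => /predU1P[->//|ltin].
by rewrite /= nth_rcons size_gs ltin IH.
Qed.

Definition resid (n : nat) f : H := f - \sum_(i < n) dot f (gse i) *: gse i.

Lemma gseE n : gse n = normalize (resid n (v n)).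
Proof.
rewrite /gse /= nth_rcons size_gs ltnn eqxx; congr (normalize (_ - _)).
by apply: eq_bigr => i _; rewrite nth_gs.
Qed.

Lemma dot_normalize f : dot (normalize f) (normalize f) = (normalize f != 0)%:R.
Proof.
rewrite /normalize; have [_|f0] := eqVneq f 0; first by rewrite dot0l eqxx.
have nf : `|f| != 0 by rewrite normr_eq0.
rewrite dotZl dotZr -rkhs_normE scaler_eq0 invr_eq0 (negbTE nf) (negbTE f0) /=.
by rewrite fmorphV /= (CrealP (normr_real f)) expr2 mulKf // mulVf.
Qed.

Lemma gse_sq n : dot (gse n) (gse n) = (gse n != 0)%:R.
Proof. by rewrite gseE dot_normalize. Qed.

Lemma dot_suml (I : Type) (s : seq I) (F : I -> H) g :
  dot (\sum_(i <- s) F i) g = \sum_(i <- s) dot (F i) g.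
Proof.
by apply: (big_morph (fun f => dot f g)) => [x y|]; [exact: linearDl|exact: dot0l].
Qed.

Lemma dot_sumr (I : Type) (s : seq I) (F : I -> H) g :
  dot g (\sum_(i <- s) F i) = \sum_(i <- s) dot g (F i).
Proof.
by apply: (big_morph (dot g)) => [x y|]; [exact: linearDr|exact: dot0r].
Qed.

(** Orthogonality is assumed only below [n] because this lemma serves inside the induction that
    proves it. *)
Lemma resid_ortho_aux n : (forall i j, (i < n)%N -> (j < n)%N -> i != j -> dot (gse i) (gse j) = 0) ->
  forall f k, (k < n)%N -> dot (resid n f) (gse k) = 0.
Proof.
move=> O f k kn; rewrite /resid dotBl dot_suml (bigD1 (Ordinal kn)) //= dotZl gse_sq.
rewrite big1 ?addr0 => [|i ik]; last first.
  by rewrite dotZl O ?mulr0.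
case: eqP => [->|_]; last by rewrite mulr1 subrr.
by rewrite dot0r mulr0 subr0.
Qed.

Lemma gse_ortho_lt n : forall i j, (i < n)%N -> (j < n)%N -> i != j -> dot (gse i) (gse j) = 0.
Proof.
elim: n => // n IH.
have ON k : (k < n)%N -> dot (gse n) (gse k) = 0.
  move=> kn; rewrite gseE /normalize; case: eqP => _; first by rewrite dot0l.
  by rewrite dotZl resid_ortho_aux ?mulr0.
move=> i j; rewrite ltnS leq_eqVlt => /predU1P[->|lti];
  rewrite ltnS leq_eqVlt => /predU1P[->|ltj].
- by move=> /eqP /(_ erefl) [].

- by move=> _; exact: ON.
- by move=> _; rewrite dotC ON // rmorph0.
- exact: IH.
Qed.

Lemma gse_ortho i j : i != j -> dot (gse i) (gse j) = 0.
Proof.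
by move=> ij; apply: (@gse_ortho_lt (maxn i j).+1) => //; rewrite ltnS ?leq_maxl ?leq_maxr.
Qed.

Lemma resid_ortho n f k : (k < n)%N -> dot (resid n f) (gse k) = 0.
Proof. by apply: resid_ortho_aux => i j _ _; exact: gse_ortho. Qed.

Lemma residS n f : resid n.+1 f = resid n f - dot f (gse n) *: gse n.
Proof. by rewrite /resid big_ord_recr /= opprD addrA. Qed.

Lemma dot_resid n f k : (n <= k)%N -> dot (resid n f) (gse k) = dot f (gse k).
Proof.
move=> nk; rewrite /resid dotBl dot_suml big1 ?subr0 // => i _.
by rewrite dotZl gse_ortho ?mulr0 // ltn_eqF // (leq_trans (ltn_ord i)).
Qed.

Lemma sqnorm_residS n f : sqnorm (resid n f) = sqnorm (resid n.+1 f) + sqn (dot f (gse n)).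
Proof.
have E : resid n f = resid n.+1 f + dot f (gse n) *: gse n by rewrite residS subrK.
rewrite {1}E sqnormDd; last by rewrite dotZr resid_ortho ?mulr0.
congr (_ + _); rewrite sqnormZ /sqnorm gse_sq.
case: eqP => [->|_]; last by rewrite mulr1.
by rewrite dot0r /sqn /= !expr0n addr0 mul0r.
Qed.

Lemma bessel n f : sqnorm f = sqnorm (resid n f) + \sum_(i < n) sqn (dot f (gse i)).
Proof.
elim: n => [|n IH]; first by rewrite big_ord0 addr0 /resid big_ord0 subr0.
rewrite big_ord_recr /= [LHS]IH sqnorm_residS.
by rewrite -addrA; congr (_ + _); rewrite addrC.
Qed.

Lemma sqnorm_comb n (c : 'I_n -> R[i]) :
  sqnorm (\sum_i c i *: gse i) <= \sum_i sqn (c i).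
Proof.
rewrite /sqnorm dot_suml raddf_sum /=; apply: ler_sum => i _.
rewrite dotZl dot_sumr (bigD1 i) //= big1 ?addr0 => [|j ji]; last first.
  by rewrite dotZr gse_ortho ?mulr0 // eq_sym.
rewrite dotZr gse_sq mulrA mulC_sqn; case: eqP => _; last by rewrite mulr1.
by rewrite mulr0 sqn_ge0.
Qed.

Lemma resid_lin n f g : resid n (f - g) = resid n f - resid n g.
Proof.
have E : \sum_(i < n) dot (f - g) (gse i) *: gse i =
    \sum_(i < n) dot f (gse i) *: gse i - \sum_(i < n) dot g (gse i) *: gse i.
  by rewrite -sumrB; apply: eq_bigr => i _; rewrite dotBl scalerBl.
rewrite /resid E !opprB addrACA [RHS]addrACA; congr (_ + _).
by rewrite addrC.
Qed.

Lemma resid_v n m : (n < m)%N -> resid m (v n) = 0.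
Proof.
move=> nm; apply/eqP; rewrite -sqnorm_eq0 eq_le sqnorm_ge0 andbT.
have : resid n.+1 (v n) = 0.
  rewrite residS -(dot_resid (v n) (leqnn n)) gseE /normalize.
  case: eqP => [->|/eqP f0]; first by rewrite dot0l scale0r subr0.
  set f := resid n (v n) in f0 *; have nf : `|f| != 0 by rewrite normr_eq0.
  rewrite dotZr -rkhs_normE fmorphV /= (CrealP (normr_real f)) scalerA.
  by rewrite expr2 mulKf // divff // scale1r subrr.
elim: m nm => // m IH; rewrite ltnS leq_eqVlt => /predU1P[->->|nm r0].
  by rewrite /sqnorm dot0l.
apply: le_trans (IH nm r0); rewrite [leRHS]sqnorm_residS lerDl sqn_ge0 //.
Qed.

Lemma sqnorm_resid_le n f : sqnorm (resid n f) <= sqnorm f.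
Proof. by rewrite [leRHS](bessel n) lerDl sumr_ge0 // => i _; exact: sqn_ge0. Qed.

(** [resid m] does not increase norms and kills [v n] for [m > n]. It therefore has the same value
    at [f] as at [f - v n], which is small if [v n] is close to [f]. *)
Lemma resid_dense : dense (range v) ->
  forall f (eps : R), 0 < eps -> exists n, forall m, (n <= m)%N -> sqnorm (resid m f) < eps ^+ 2.
Proof.
move=> dv f eps eps0.
have [g [bg [n _ ng]]] : ball f eps%:C `&` range v !=set0.
  apply: dv; last by apply: ball_open; rewrite ltr0c.
  by exists f; apply: ballxx; rewrite ltr0c.
exists n.+1 => m nm; rewrite -[resid m f]subr0 -(resid_v nm) -resid_lin ng.
apply: le_lt_trans (sqnorm_resid_le _ _) _.
move: bg; rewrite -ball_normE /= norm_sqnorm ltcR => H1.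
rewrite -[ltLHS]sqr_sqrtr ?sqnorm_ge0 // ltr_pXn2r ?nnegrE ?sqrtr_ge0 ?(ltW eps0) //.
Qed.

End GramSchmidt.

Lemma exists_dense_seq : exists v : nat -> H, dense (range v).
Proof.
have [S cS dS] := rkhs_separable H.
have /countable_injP [phi phi_inj] := cS.
(* Indices that are not the code of a point of [S] yield 0. *)
pose v i := xget 0 [set s | S s /\ phi s = i].
exists v => O O0 oO; have [s [Os Ss]] := dS O O0 oO.
exists s; split=> //; exists (phi s) => //.
have [Sv vs] : [set s' | S s' /\ phi s' = phi s] (v (phi s)).
  by apply: (@xgetPex _ 0); exists s.
by apply: phi_inj => //; rewrite inE.
Qed.

Section Evaluation.
Variables (v : nat -> H) (dv : dense (range v)).
Local Notation ev := (fun f x => rkhs_fun H f x).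
Local Notation e := (gse v).

Lemma eval_sum (I : Type) (s : seq I) (F : I -> H) x :
  rkhs_fun H (\sum_(i <- s) F i) x = \sum_(i <- s) rkhs_fun H (F i) x.
Proof.
rewrite linear_sum; elim: s => [|i s IH]; first by rewrite !big_nil.
by rewrite !big_cons -IH.
Qed.

Lemma evalZ (a : R[i]) f x : rkhs_fun H (a *: f) x = a * rkhs_fun H f x.
Proof. by rewrite linearZ. Qed.

Lemma evalB f g x : rkhs_fun H (f - g) x = rkhs_fun H f x - rkhs_fun H g x.
Proof. by rewrite linearB. Qed.

Lemma evalD f g x : rkhs_fun H (f + g) x = rkhs_fun H f x + rkhs_fun H g x.
Proof. by rewrite linearD. Qed.

Lemma eval_resid n f x :
  rkhs_fun H (resid v n f) x = rkhs_fun H f x - \sum_(i < n) dot f (e i) * rkhs_fun H (e i) x.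
Proof.
by rewrite /resid evalB eval_sum; congr (_ - _); apply: eq_bigr => i _; rewrite evalZ.
Qed.

Lemma eval_small x (eps : R) : 0 < eps -> exists2 delta : R, 0 < delta &
  forall f, sqnorm f < delta ^+ 2 -> sqn (rkhs_fun H f x) < eps ^+ 2.
Proof.
move=> eps0; have := @rkhs_eval_continuous _ _ H x (0 : H).
move=> /cvgrPdist_lt /(_ eps%:C); rewrite ltr0c => /(_ eps0).
move=> /nbhs_ballP [dc /= dc0 sub].
have dr : (complex.Re dc)%:C = dc by rewrite RRe_real // gtr0_real.
exists (complex.Re dc); first by rewrite -ltr0c dr.
move=> f fd; have /sub : ball (0 : H) dc f.
  rewrite -ball_normE /= sub0r normrN norm_sqnorm -dr ltcR.
  have d0 : 0 < complex.Re dc by rewrite -ltr0c dr.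
  by rewrite -[ltRHS]gtr0_norm // -sqrtr_sqr ltr_sqrt // exprn_gt0.
rewrite /= linear0 sub0r normrN normc_def ltcR -/(sqn _) => H1.
rewrite -[ltRHS]ger0_norm ?exprn_ge0 ?(ltW eps0) // -[ltLHS]sqr_sqrtr ?sqn_ge0 //.
by rewrite ger0_norm ?exprn_ge0 ?(ltW eps0) // ltr_pXn2r ?nnegrE ?sqrtr_ge0 ?(ltW eps0).
Qed.

Lemma resid_tail n m f : (n <= m)%N ->
  resid v n f = resid v m f + \sum_(n <= k < m) dot f (e k) *: e k.
Proof.
elim: m => [|m IH]; first by rewrite leqn0 => /eqP ->; rewrite big_geq // addr0.
rewrite leq_eqVlt => /predU1P[->|]; first by rewrite big_geq // addr0.
by rewrite ltnS => nm; rewrite big_nat_recr //= residS addrA addrAC subrK IH.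
Qed.

(** For finite tails this is Cauchy-Schwarz with Bessel's inequality. The rest [resid v m f] tends
    to 0 in [H], and so does its value at [x] by continuity of the evaluation; no series in [H] has
    to be summed. *)
Lemma sqn_eval_resid n f x (r : R) :
  (\sum_(n <= k <oo) (sqn (rkhs_fun H (e k) x) : R)%:E <= r%:E)%E ->
  sqn (rkhs_fun H (resid v n f) x) <= sqnorm f * r.
Proof.
move=> le_r.
have part m : \sum_(n <= k < m) sqn (rkhs_fun H (e k) x) <= r.
  rewrite -lee_fin -sumEFin; apply: le_trans le_r.
  by apply: nneseries_lim_ge => k _ _; rewrite lee_fin sqn_ge0.
have r0 : 0 <= r by apply: le_trans (part 0%N); rewrite big_geq.
have b0 : 0 <= sqnorm f * r by rewrite mulr_ge0 ?sqnorm_ge0.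
set b := sqnorm f * r in b0 *; set y := rkhs_fun H _ x.
have key (eps : R) : 0 < eps -> Num.sqrt (sqn y) <= Num.sqrt b + eps.
  move=> eps0; have [delta delta0 small] := eval_small x eps0.
  have [m0 hm] := resid_dense dv f delta0.
  pose m := maxn n m0.
  have nm : (n <= m)%N by exact: leq_maxl.
  have ym : sqn (rkhs_fun H (resid v m f) x) < eps ^+ 2.
    by apply: small; apply: hm; exact: leq_maxr.
  have -> : y = rkhs_fun H (resid v m f) x +
      \sum_(n <= k < m) dot f (e k) * rkhs_fun H (e k) x.
    rewrite /y (resid_tail f nm) evalD eval_sum; congr (_ + _).
    by apply: eq_bigr => k _; rewrite evalZ.
  apply: le_trans (_ : Num.sqrt (sqn (rkhs_fun H (resid v m f) x)) +
    Num.sqrt (sqn (\sum_(n <= k < m) dot f (e k) * rkhs_fun H (e k) x)) <= _).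
    by rewrite -lecR rmorphD /= /sqn -!normc_def ler_normD.
  rewrite addrC lerD //; last first.
    by rewrite -[leRHS]gtr0_norm // -sqrtr_sqr ler_wsqrtr // ltW.
  rewrite ler_wsqrtr // (le_trans (sqn_sum_le _ _ _)) // ler_pM //.
  - by apply: sumr_ge0 => k _; exact: sqn_ge0.
  - by apply: sumr_ge0 => k _; exact: sqn_ge0.
  - rewrite [leRHS](bessel v m) -(big_mkord xpredT (fun k => sqn (dot f (e k)))).
    rewrite [X in _ <= _ + X](@big_cat_nat _ _ _ n) //= addrA lerDr addr_ge0 ?sqnorm_ge0 //.
    by apply: sumr_ge0 => k _; exact: sqn_ge0.
have le_sb : Num.sqrt (sqn y) <= Num.sqrt b by apply/ler_addgt0Pr.
by rewrite -[leLHS]sqr_sqrtr ?sqn_ge0 // -[leRHS]sqr_sqrtr // ler_pXn2r ?nnegrE ?sqrtr_ge0.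
Qed.

End Evaluation.

End Rkhs.

(** * Approximation numbers and eigenvalues of finite Gram matrices *)

Section ApproximationNumbers.
Local Open Scope classical_set_scope.
Local Open Scope ring_scope.
Local Open Scope complex_scope.
Local Open Scope sesquilinear_scope.
Context d (D : measurableType d) (R : realType).
Variable mu : {measure set D -> \bar R}.
Variable H : rkhs R D.

Definition lincomb n (h : 'I_n -> H) (a : 'rV[R[i]]_n) : H := \sum_i a 0 i *: h i.

Lemma eval_lincomb n (h : 'I_n -> H) a x :
  rkhs_fun H (lincomb h a) x = \sum_i a 0 i * rkhs_fun H (h i) x.
Proof. by rewrite eval_sum; apply: eq_bigr => i _; rewrite evalZ. Qed.

Lemma linear_lincomb (L : {linear H -> R[i]^o}) n (h : 'I_n -> H) (a : 'rV_n) :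
  (L (lincomb h a) : R[i]) = \sum_i a 0 i * (L (h i) : R[i]).
Proof.
rewrite /lincomb; elim/big_ind2: _ => [|x1 x2 y1 y2 <- <-|i _].
- exact: linear0.
- exact: linearD.
- exact: linearZ.
Qed.

Lemma qform1 n (u : 'rV[R[i]]_n) : qform 1%:M u = (\sum_i sqn (u 0 i))%:C.
Proof.
rewrite -(@rdiag1 _ _ (fun=> 1)) // qform_rdiag; congr (_%:C).
by apply: eq_bigr => i _; rewrite mul1r.
Qed.

Lemma exists_kernel_unit m (B : 'M[R[i]]_(m.+1, m)) :
  exists a : 'rV_m.+1, a *m B = 0 /\ \sum_i sqn (a 0 i) = 1.
Proof.
have /rowV0Pn[a aK a0] : kermx B != 0.
  by rewrite -mxrank_eq0 mxrank_ker subn_eq0 -ltnNge ltnS rank_leq_col.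
pose s := \sum_i sqn (a 0 i).
have s0 : 0 < s.
  have /rV0Pn[i ai] := a0; rewrite /s (bigD1 i) //= ltr_pwDl ?sqn_gt0 //.
  by apply: sumr_ge0 => j _; exact: sqn_ge0.
exists (((Num.sqrt s)^-1)%:C *: a); split.
  by rewrite -scalemxAl (sub_kermxP aK) scaler0.
under eq_bigr do rewrite mxE sqn_scale.
by rewrite -mulr_sumr exprVn sqr_sqrtr ?(ltW s0) // mulVf ?gt_eqF.
Qed.

(** Any [m] functionals vanish together on a unit combination of [m.+1] vectors, and an algorithm
    built on them returns 0 there. The norm condition is an inequality, which is what a Gram-Schmidt
    family with vanishing terms provides. *)
Lemma approximation_number_ge m (h : 'I_m.+1 -> H) (lam : R) : 0 <= lam ->
  (forall a : 'rV_m.+1, sqnorm (lincomb h a) <= \sum_i sqn (a 0 i)) ->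
  (forall a : 'rV_m.+1, ((lam * \sum_i sqn (a 0 i))%:E <=
              sqint mu (fun x => rkhs_fun H (lincomb h a) x))%E) ->
  ((Num.sqrt lam)%:E <= approximation_number mu m H)%E.
Proof.
move=> lam0 h_norm h_int; apply: le_ereal_inf_tmp => _ [L [g [_ _ ->]]].
have [a [aB a1]] := exists_kernel_unit (\matrix_(i, j) (L j (h i) : R[i])).
apply: le_trans; last first.
  apply: ereal_sup_ubound; exists (lincomb h a) => //.
  by apply/unit_ballE; rewrite -a1.
rewrite /= L2norm_ge ?sqrtr_ge0 // sqr_sqrtr //.
rewrite [X in sqint mu X](_ : _ = fun x => rkhs_fun H (lincomb h a) x).
  by apply: le_trans (h_int a); rewrite a1 mulr1.
apply/funext => t; rewrite big1 ?subr0 // => j _.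
suff -> : (L j (lincomb h a) : R[i]) = 0 by rewrite mul0r.
rewrite linear_lincomb; have /rowP/(_ j) := aB; rewrite !mxE => aBj; rewrite -[RHS]aBj.
by apply: eq_bigr => i _; rewrite !mxE.
Qed.

Lemma rdiag_mxsub n m (f : 'I_m -> 'I_n) (q : 'I_n -> R) : injective f ->
  mxsub f f (rdiag q) = rdiag (q \o f).
Proof.
by move=> f_inj; apply/matrixP => i j; rewrite !mxE (inj_eq f_inj).
Qed.

Variable v : nat -> H.
Hypothesis L2H : forall f : H, L2 mu (rkhs_fun H f).
Local Notation e := (gse v).

(** Min-max principle: [approximation_number_ge], applied to the eigenvectors of the [k.+1] largest
    eigenvalues, shows that the smallest of these is at most [sigma k ^+ 2]. The monotone [F] covers
    both uses, the identity for the trace and x / (eps + x) for the potential. *)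
Lemma eigenvalues_sorted (sigma : nat -> R) (N : nat) (U : 'M[R[i]]_N) (q : 'I_N -> R) :
  (forall m, 0 <= sigma m) ->
  (forall m, approximation_number mu m H = (sigma m)%:E) ->
  U *m U^t* = 1%:M ->
  U *m gram mu (fun (k : 'I_N) => rkhs_fun H (e k)) *m U^t* = rdiag q ->
  forall F : R -> R, (forall x y, 0 <= x -> x <= y -> F x <= F y) ->
  \sum_i F (q i) <= \sum_(k < N) F (sigma k ^+ 2).
Proof.
move=> sigma0 apx UU UW F Fmono; set W := gram _ _ in UW.
have Wpsd : psd W by apply: gram_psd.
have q0 i : 0 <= q i by exact: psd_diag_ge0 UW.
pose le_q (i j : 'I_N) := q j <= q i.
have le_q_total : total le_q by move=> i j; exact: le_total.
have le_q_trans : transitive le_q by move=> j i k; rewrite /le_q => ji kj; exact: le_trans kj ji.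
pose s := sort le_q (enum 'I_N).
have perm_s : perm_eq s (enum 'I_N) by apply/permPl; exact: perm_sort.
have size_s : size s = N by rewrite (perm_size perm_s) size_enum_ord.
have uniq_s : uniq s by rewrite (perm_uniq perm_s) enum_uniq.
have sorted_s : sorted le_q s by exact: sort_sorted.
have [N0|N0] := posnP N.
  have noI (i : 'I_N) : False by have := leq_ltn_trans (leq0n i) (ltn_ord i); rewrite [X in (_ < X)%N]N0.
  by rewrite !big1 // => i; case: (noI i).
pose i0 := Ordinal N0.
pose iota_ (k : nat) : 'I_N := nth i0 s k.
have sumE : \sum_i F (q i) = \sum_(k < N) F (q (iota_ k)).
  have -> : \sum_i F (q i) = \sum_(i <- s) F (q i).
    by rewrite (perm_big (enum 'I_N) perm_s) big_enum.
  by rewrite (big_nth i0) size_s big_mkord.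
rewrite sumE; apply: ler_sum => k _; apply: Fmono => //.
pose f (i : 'I_k.+1) := iota_ i.
have lt_s (i : 'I_k.+1) : (i < size s)%N.
  by rewrite size_s (leq_trans (ltn_ord i)).
have f_inj : injective f.
  move=> i j /eqP; rewrite nth_uniq // => /eqP ij; exact: val_inj.
have q_ge i : q (iota_ k) <= q (f i).
  have := sorted_leq_nth le_q_trans (fun i => lexx (q i)) i0 sorted_s.
  by apply; rewrite ?inE // ?size_s // -ltnS.
pose V := rowsub f U.
have VV : V *m V^t* = 1%:M.
  have -> : V *m V^t* = mxsub f f (U *m U^t*).
    by apply/matrixP => i j; rewrite !mxE; apply: eq_bigr => l _; rewrite !mxE.
  by rewrite UU; apply/matrixP => i j; rewrite !mxE (inj_eq f_inj).
have VW : V *m W *m V^t* = rdiag (q \o f).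
  rewrite -rdiag_mxsub // -UW; apply/matrixP => i j.
  rewrite !mxE; apply: eq_bigr => l _; rewrite !mxE; congr (_ * _).
  by apply: eq_bigr => l' _; rewrite !mxE.
pose h i := lincomb (fun k : 'I_N => e k) (row i V).
have hE a : lincomb h a = lincomb (fun k : 'I_N => e k) (a *m V).
  rewrite /lincomb /h /lincomb.
  under eq_bigr do rewrite scaler_sumr; rewrite exchange_big /=.
  apply: eq_bigr => l _; rewrite mxE scaler_suml; apply: eq_bigr => i _.
  by rewrite scalerA !mxE.
have normE (a : 'rV_k.+1) : \sum_l sqn ((a *m V) 0 l) = \sum_i sqn (a 0 i).
  apply: complexI; rewrite -[LHS]qform1 -[RHS]qform1.
  by rewrite -qform_conj mulmx1 VV.
have := @approximation_number_ge k h (q (iota_ k)) (q0 _).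
rewrite apx lee_fin => H1.
have {}H1 : Num.sqrt (q (iota_ k)) <= sigma k.
  apply: H1 => a.
    by rewrite hE -normE; exact: sqnorm_comb.
  rewrite hE [X in sqint mu X](_ : _ = fun x => \sum_l (a *m V) 0 l * rkhs_fun H (e l) x); last first.
    by apply/funext => x; rewrite eval_lincomb.
  rewrite (sqint_gram _ (fun l : 'I_N => L2H (e l))) -/W -qform_conj VW qform_rdiag /=.
  rewrite lee_fin mulr_sumr; apply: ler_sum => i _.
  by rewrite ler_wpM2r ?sqn_ge0.
by rewrite -[leLHS]sqr_sqrtr // ler_pXn2r ?nnegrE ?sqrtr_ge0.
Qed.

End ApproximationNumbers.

(** * Upper bound for sampling numbers *)

Section UpperBound.
Local Open Scope classical_set_scope.
Local Open Scope ring_scope.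
Local Open Scope complex_scope.
Local Open Scope sesquilinear_scope.

Lemma complex_ReD (R : rcfType) (x y : R[i]) : complex.Re (x + y) = complex.Re x + complex.Re y.
Proof. by case: x y => ? ? []. Qed.

Lemma complex_Re_sum (R : rcfType) (I : Type) (s : seq I) (F : I -> R[i]) :
  complex.Re (\sum_(i <- s) F i) = \sum_(i <- s) complex.Re (F i).
Proof. by apply: (big_morph (@complex.Re R)) => // x y; exact: complex_ReD. Qed.

Lemma complex_ReZ (R : rcfType) (a : R) (x : R[i]) :
  complex.Re (a%:C * x) = a * complex.Re x.
Proof. by case: x => x1 x2 /=; rewrite mul0r subr0. Qed.

Section LeastSquares.
Variables (R : rcfType) (N n : nat) (G : 'M[R[i]]_N) (w : 'I_n -> 'cV[R[i]]_N).
Variables (eps : R) (t : 'I_n -> R).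
Hypotheses (eps0 : 0 < eps) (t0 : forall i, 0 <= t i).

(** The matrix of the normal equations for minimising eps |z|^2 + sum_i t_i |y_i - z w_i|^2 over
    rows z; the minimiser is the sum of the y_i times [ls_row i]. *)
Definition ls_mx : 'M[R[i]]_N := eps%:C%:M + \sum_i (t i)%:C *: (w i *m (w i)^t*).

Lemma qform_ls_mx (u : 'rV_N) :
  qform ls_mx u = (eps * \sum_k sqn (u 0 k) + \sum_i t i * sqn ((u *m w i) 0 0))%:C.
Proof.
rewrite /ls_mx qformD qform_sum rmorphD /= rmorph_sum /=; congr (_ + _).
  have -> : eps%:C%:M = rdiag (fun=> eps) :> 'M[R[i]]_N.
    by apply/matrixP => i k; rewrite !mxE.
  by rewrite qform_rdiag mulr_sumr.
by apply: eq_bigr => i _; rewrite qformZ qform_rank1 rmorphM.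
Qed.

Lemma ls_mx_unit : ls_mx \in unitmx.
Proof.
rewrite -row_free_unit -kermx_eq0; apply/negPn/negP => /rowV0Pn[u /sub_kermxP uG u0].
have /rV0Pn[i ui] := u0; have := qform_ls_mx u.
rewrite {1}/qform uG mul0mx mxE => /(congr1 (@complex.Re R)) /= /esym /eqP.
apply/negP; rewrite gt_eqF // ltr_pwDl //; last first.
  by apply: sumr_ge0 => j _; rewrite mulr_ge0 ?sqn_ge0.
rewrite mulr_gt0 // (bigD1 i) //= ltr_pwDl ?sqn_gt0 //.
by apply: sumr_ge0 => j _; exact: sqn_ge0.
Qed.

Definition ls_row (i : 'I_n) : 'rV[R[i]]_N := (t i)%:C *: ((w i)^t* *m invmx ls_mx).

(** The normal equations say that z times [ls_mx] is eps c - sum_i t_i r_i w_i^*. After pairing with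
    z, the inequality 2 Re (a conj b) <= |a|^2 + |b|^2 lets half of the left side absorb the terms
    in z. *)
Lemma ls_error (c z : 'rV[R[i]]_N) (r y : 'I_n -> R[i]) :
  (forall i, y i = (c *m w i) 0 0 + r i) ->
  z = c - \sum_i y i *: ls_row i ->
  eps * (\sum_k sqn (z 0 k)) + \sum_i t i * sqn ((z *m w i) 0 0) <=
  eps * (\sum_k sqn (c 0 k)) + \sum_i t i * sqn (r i).
Proof.
move=> yE zE.
have zG : z *m ls_mx = eps%:C *: c - \sum_i ((t i)%:C * r i) *: (w i)^t*.
  have cG : c *m ls_mx = eps%:C *: c + \sum_i ((t i)%:C * (c *m w i) 0 0) *: (w i)^t*.
    rewrite /ls_mx mulmxDr mul_mx_scalar mulmx_sumr; congr (_ + _).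
    apply: eq_bigr => i _; rewrite -scalemxAr mulmxA.
    by rewrite {1}[c *m w i]mx11_scalar mul_scalar_mx scalerA.
  rewrite zE mulmxBl cG mulmx_suml -addrA -sumrB -sumrN; congr (_ + _).
  apply: eq_bigr => i _; rewrite /ls_row -!scalemxAl mulmxKV ?ls_mx_unit //.
  rewrite scalerA -scalerBl yE -[RHS]scaleNr; congr (_ *: _); ring.

have QE : qform ls_mx z = eps%:C * (\sum_k c 0 k * Num.conj (z 0 k)) +
    \sum_i (t i)%:C * (- r i * Num.conj ((z *m w i) 0 0)).
  rewrite /qform zG mulmxBl mxE -scalemxAl mxE; congr (_ * _ + _).
    by rewrite mxE; apply: eq_bigr => k _; rewrite !mxE.
  rewrite mxE mulmx_suml summxE -sumrN; apply: eq_bigr => i _.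
  by rewrite -scalemxAl -trmxC_mul mxE trmxCE mulNr mulrN mulrA.
have := congr1 (@complex.Re R) (etrans (esym (qform_ls_mx z)) QE).
rewrite complex_ReD complex_ReZ !complex_Re_sum.
under [X in _ = _ + X -> _]eq_bigr do rewrite complex_ReZ.
set A := \sum_k sqn (z 0 k); set B := \sum_i t i * sqn ((z *m w i) 0 0).
set P := \sum_k complex.Re _; set T := (X in _ = _ + X -> _).
rewrite [LHS]/= -/A -/B => E.
have leP : 2 * P <= \sum_k sqn (c 0 k) + A.
  by rewrite mulr_sumr -big_split; apply: ler_sum => k _; exact: Re_mulconj_le.
have leT : 2 * T <= \sum_i t i * sqn (r i) + B.
  rewrite mulr_sumr -big_split /=; apply: ler_sum => i _.
  by rewrite mulrCA -mulrDr ler_wpM2l // -(sqnN (r i)); exact: Re_mulconj_le.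
have := ler_wpM2l (ltW eps0) leP; nra.
Qed.

End LeastSquares.
End UpperBound.

Section SqintSum.
Local Open Scope classical_set_scope.
Local Open Scope ring_scope.
Context d (D : measurableType d) (R : realType).
Variable mu : {measure set D -> \bar R}.

Lemma measurable_scale_sqn (a : R) (f : D -> R[i]) : L2 mu f ->
  measurable_fun setT (fun x => (a * sqn (f x))%:E).
Proof.
move=> /measurable_sqn /measurable_EFinP mf; apply/measurable_EFinP.
exact: measurable_funM.
Qed.

Lemma integral_scale_sqn (a : R) (f : D -> R[i]) : 0 <= a -> L2 mu f ->
  (\int[mu]_x (a * sqn (f x))%R%:E = a%:E * sqint mu f)%E.
Proof.
move=> a0 lf; under eq_integral do rewrite EFinM.
apply: ge0_integralZl_EFin => //; last exact: (measurable_sqn lf).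
by move=> y _; rewrite lee_fin sqn_ge0.
Qed.

Lemma sqintD_le (f g : D -> R[i]) : L2 mu f -> L2 mu g ->
  (sqint mu (fun x => (f x + g x)%R) <= 2%:E * sqint mu f + 2%:E * sqint mu g)%E.
Proof.
move=> lf lg; rewrite -!integral_scale_sqn // -ge0_integralD //.
- apply: ge0_le_integral => //.
  + by move=> y _; rewrite lee_fin sqn_ge0.
  + exact: (measurable_sqn (L2D lf lg)).
  + by apply: emeasurable_funD; [exact: (measurable_scale_sqn _ lf)|exact: (measurable_scale_sqn _ lg)].
  + by move=> y _; rewrite -EFinD lee_fin sqnD_le.
- by move=> y _; rewrite lee_fin mulr_ge0 ?sqn_ge0.
- exact: (measurable_scale_sqn _ lf).
- by move=> y _; rewrite lee_fin mulr_ge0 ?sqn_ge0.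
- exact: (measurable_scale_sqn _ lg).
Qed.
End SqintSum.

Section SamplingUpperBound.
Local Open Scope classical_set_scope.
Local Open Scope ring_scope.
Local Open Scope complex_scope.
Local Open Scope sesquilinear_scope.
Context d (D : measurableType d) (R : realType).
Variable mu : {measure set D -> \bar R}.
Variable H : rkhs R D.
Hypothesis L2H : forall f : H, L2 mu (rkhs_fun H f).
Variable sigma : nat -> R.
Hypothesis sigma0 : forall m, 0 <= sigma m.
Hypothesis apx : forall m, approximation_number mu m H = (sigma m)%:E.
Variables (v : nat -> H) (dv : dense (range v)).
Local Notation e := (gse v).
Local Notation fe := (fun k => rkhs_fun H (gse v k)).

Lemma mxE_sub (F : zmodType) m n (A B : 'M[F]_(m, n)) i j :
  (A - B) i j = A i j - B i j.
Proof. by rewrite !mxE. Qed.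

(** The left side is the trace of a Gram matrix, hence the sum of its eigenvalues. *)
Lemma sum_sqint_gse N :
  (\sum_(k < N) sqint mu (fe k) <= (\sum_(k < N) sigma k ^+ 2)%:E)%E.
Proof.
pose W := gram mu (fun k : 'I_N => fe k).
have Wpsd : psd W by apply: gram_psd.
have [U [q [UU UW]]] := hermitian_diag Wpsd.1.
have le_q := eigenvalues_sorted L2H sigma0 apx UU UW (F := id) (fun x y _ xy => xy).
rewrite (eq_bigr (fun k : 'I_N => (complex.Re (W k k))%:E)); last first.
  by move=> k _; rewrite sqint_L2 // /W mxE.
rewrite sumEFin lee_fin -complex_Re_sum -/(\tr W).
have -> : \tr W = \tr (rdiag q).
  by rewrite -UW mxtrace_mulC mulmxA (mulmx1C UU) mul1mx.
apply: le_trans le_q; rewrite /mxtrace complex_Re_sum.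
by apply: ler_sum => i _; rewrite rdiagE.
Qed.

(** By [sqn_eval_resid] this bounds the squared norm of the map from [f] to the value of
    [resid v N f] at [x]. It may be infinite at some points; only its integral is controlled. *)
Definition tail_sqn N (x : D) : \bar R := (\sum_(k <oo) (sqn (fe (k + N)%N x) : R)%:E)%E.

Lemma tail_sqn_ge0 N x : (0 <= tail_sqn N x)%E.
Proof. by apply: nneseries_ge0 => k _ _; rewrite lee_fin sqn_ge0. Qed.

Lemma measurable_tail_sqn N : measurable_fun setT (tail_sqn N).
Proof.
apply: ge0_emeasurable_sum => [k x _ _|k _]; first by rewrite lee_fin sqn_ge0.
exact: (measurable_sqn (L2H _)).
Qed.

Lemma integral_tail_sqn N :
  (\int[mu]_x tail_sqn N x = \sum_(N <= k <oo) sqint mu (fe k))%E.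
Proof.
rewrite integral_nneseries //.
- by rewrite -nneseries_addn // => i; exact: sqint_ge0.
- by move=> k; exact: (measurable_sqn (L2H _)).
- by move=> k x _; rewrite lee_fin sqn_ge0.
Qed.

Lemma exists_small_tail (eta : R) : 0 < eta ->
  (\sum_(0 <= k <oo) (sigma k ^+ 2)%:E < +oo)%E ->
  exists N, (\int[mu]_x tail_sqn N x <= eta%:E)%E.
Proof.
move=> eta0 fin.
have sq_fin : (\sum_(0 <= k <oo) sqint mu (fe k) < +oo)%E.
  apply: le_lt_trans fin; apply: lime_le.
    by apply: is_cvg_nneseries => k _ _; exact: sqint_ge0.
  apply: nearW => N; rewrite big_mkord; apply: le_trans (sum_sqint_gse N) _.
  rewrite -sumEFin -(big_mkord xpredT (fun k => (sigma k ^+ 2)%:E)).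
  by apply: nneseries_lim_ge => k _ _; rewrite lee_fin sqr_ge0.
have := nneseries_tail_cvg sq_fin (fun k _ => sqint_ge0 mu (fe k)).
move=> /fine_cvgP [finN] /cvgrPdist_lt /(_ _ eta0) small.
have [N _ HN] := filterI finN small; exists N; rewrite integral_tail_sqn.
have [/= fN sN] := HN N (leqnn N).
rewrite -(fineK fN) lee_fin.
by move: sN; rewrite sub0r normrN => /ltW; apply: le_trans; exact: ler_norm.
Qed.

Lemma initial_potential N (eps : R) m : 0 < eps -> (0 < m)%N ->
  (\sum_(m <= k <oo) (sigma k ^+ 2)%:E <= (m%:R * eps)%:E)%E ->
  let W := gram mu (fun k : 'I_N => fe k) in
  potential_le W (eps%:C%:M + W) (2 * m%:R).
Proof.
move=> eps0 m0 tail_le W.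
have Wpsd : psd W by apply: gram_psd.
have [U [q [UU UW]]] := hermitian_diag Wpsd.1.
have q0 i : 0 <= q i by exact: psd_diag_ge0 UW.
have eq0 i : 0 < eps + q i by rewrite ltr_pwDl.
pose c i := (Num.sqrt (eps + q i))^-1.
have c2 i : c i ^+ 2 = (eps + q i)^-1 by rewrite exprVn sqr_sqrtr // ltW.
have conjE (M : 'M[R[i]]_N) p : U *m M *m U^t* = rdiag p ->
    (rdiag c *m U) *m M *m (rdiag c *m U)^t* = rdiag (fun i => p i / (eps + q i)).
  move=> E; rewrite mulmx_conj E trmxC_rdiag !rdiagM; congr rdiag.
  by apply/funext => i; rewrite mulrAC -expr2 c2 mulrC.
exists (rdiag c *m U), (fun i => q i / (eps + q i)); split.
- rewrite (conjE _ (fun i => eps + q i)).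
    by rewrite rdiag1 // => i; rewrite divff // gt_eqF.
  rewrite mulmxDr mulmxDl UW mul_mx_scalar -scalemxAl UU.
  by apply/matrixP => i j; rewrite !mxE rmorphD /= mulrnDl mulr_natr.
- exact: conjE.
have mono (x y : R) : 0 <= x -> x <= y -> x / (eps + x) <= y / (eps + y).
  move=> x0 xy; have y0 := le_trans x0 xy.
  rewrite ler_pdivrMr ?ltr_pwDl // mulrAC ler_pdivlMr ?ltr_pwDl //.
  by rewrite !mulrDr [x * y]mulrC lerD2r ler_wpM2r // ltW.
apply: le_trans (eigenvalues_sorted L2H sigma0 apx UU UW mono) _.
have part (n : nat) : \sum_(k < n) sigma k ^+ 2 / (eps + sigma k ^+ 2) <= 2 * m%:R.
  rewrite -(big_mkord xpredT (fun k => sigma k ^+ 2 / (eps + sigma k ^+ 2))).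
  have F0 k : 0 <= sigma k ^+ 2 / (eps + sigma k ^+ 2).
    by rewrite divr_ge0 ?addr_ge0 ?sqr_ge0 // ltW.
  (* The sum is extended so that it contains the first [m] terms even if [n < m]. These are at most
     1 each; the others are at most sigma_k^2 / eps and add up to at most m. *)
  apply: (@le_trans _ _ (\sum_(0 <= k < m + n) sigma k ^+ 2 / (eps + sigma k ^+ 2))).
    rewrite [leRHS](@big_cat_nat _ _ _ n) ?leq_addl //= lerDl.
    by apply: sumr_ge0 => k _; exact: F0.
  rewrite (@big_cat_nat _ _ _ m) ?leq_addr //= mulr_natl mulr2n lerD //.
    rewrite -[leRHS](_ : \sum_(0 <= k < m) 1 = _); last first.
      by rewrite sumr_const_nat subn0.
    apply: ler_sum => k _; rewrite ler_pdivrMr ?mul1r ?lerDr ?(ltW eps0) //.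
    by rewrite ltr_pwDl // sqr_ge0.
  apply: (@le_trans _ _ ((\sum_(m <= k < m + n) sigma k ^+ 2) / eps)).
    rewrite mulr_suml; apply: ler_sum => k _; rewrite ler_wpM2l ?sqr_ge0 //.
    by rewrite lef_pV2 ?posrE ?lerDl ?sqr_ge0 // ltr_pwDl ?sqr_ge0.
  rewrite ler_pdivrMr // -lee_fin -sumEFin; apply: le_trans tail_le.
  by apply: nneseries_lim_ge => k _ _; rewrite lee_fin sqr_ge0.
exact: part.
Qed.

Lemma sqint_resid_le N (f : H) (eta : R) : sqnorm f <= 1 ->
  (\int[mu]_x tail_sqn N x <= eta%:E)%E ->
  (sqint mu (rkhs_fun H (resid v N f)) <= eta%:E)%E.
Proof.
move=> f1 ht; apply: le_trans ht; apply: ge0_le_integral => //.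
- by move=> x _; rewrite lee_fin sqn_ge0.
- exact: (measurable_sqn (L2H _)).
- exact: measurable_tail_sqn.
move=> x _; case E : (tail_sqn N x) => [r| |].
- rewrite lee_fin.
  have le_r : (\sum_(N <= k <oo) (sqn (fe k x) : R)%:E <= r%:E)%E.
    by rewrite -nneseries_addn -?E // => k; rewrite lee_fin sqn_ge0.
  apply: le_trans (sqn_eval_resid dv f le_r) _.
  have r0 : 0 <= r by rewrite -lee_fin -E tail_sqn_ge0.
  by rewrite ler_piMl.
- by rewrite leey.
- by have := tail_sqn_ge0 N x; rewrite E.
Qed.

(** Origin of the 6: with rho = eps / n the missed part contributes at most eps at the nodes, so
    [ls_error] gives 2 eps, and the selected points turn this into a squared L_2 norm of at most 2
    eps. The missed part itself has squared L_2 norm at most eps, and the sum of both at most 2 * 2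
    eps + 2 * eps. *)
Lemma sampling_number_le n m (eps : R) : (0 < m)%N -> (16 * m <= n)%N -> 0 < eps ->
  (\sum_(0 <= k <oo) (sigma k ^+ 2)%:E < +oo)%E ->
  (\sum_(m <= k <oo) (sigma k ^+ 2)%:E <= (m%:R * eps)%:E)%E ->
  (sampling_number mu n H <= (Num.sqrt (6 * eps))%:E)%E.
Proof.
move=> m0 mn eps0 fin tail_le.
have n0 : (0 < n)%N by apply: leq_trans mn; rewrite muln_gt0.
have n0R : 0 < n%:R :> R by rewrite ltr0n.
have m0R : 0 < m%:R :> R by rewrite ltr0n.
pose rho : R := eps / n%:R; pose K : R := 2 * m%:R.
have rho0 : 0 < rho by rewrite divr_gt0.
have K0 : 0 < K by rewrite mulr_gt0.
(* The bound [eps] is for the missed part in L_2, the bound [rho * K] is the budget of the point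
   selection. As [K] does not involve [N], it can be fixed before [N]. *)
have [N HN] : exists N, (\int[mu]_x tail_sqn N x <= (Num.min eps (rho * K))%:E)%E.
  by apply: exists_small_tail => //; rewrite lt_min eps0 mulr_gt0.
have HNeps : (\int[mu]_x tail_sqn N x <= eps%:E)%E.
  by apply: le_trans HN _; rewrite lee_fin ge_min lexx.
have HNrho : (\int[mu]_x tail_sqn N x <= (rho * K)%:E)%E.
  by apply: le_trans HN _; rewrite lee_fin ge_min lexx orbT.
have nK : 8 * K <= n%:R.
  by rewrite /K mulrA -natrM -natrM ler_nat.
have [x [t [t0 tr sel]]] := barrier_selection (fun k : 'I_N => L2H (e k))
  (tail_sqn_ge0 N) (measurable_tail_sqn N) eps0 K0 rho0 HNrho
  (initial_potential N eps0 m0 tail_le) nK.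
pose w (i : 'I_n) : 'cV[R[i]]_N := \col_k fe k (x i).
pose T (i : 'I_n) := t i.
have T0 i : 0 <= T i by exact: t0.
pose g i y := \sum_k ls_row w eps T i 0 k * fe k y.
apply: ge_ereal_inf; exists (ereal_sup [set L2norm mu (fun y =>
   rkhs_fun H f y - \sum_(i < n) rkhs_fun H f (x i) * g i y) | f in unit_ball H]).
  exists (fun i : 'I_n => x i), g; split=> // i.
  by apply: L2_sum => k; exact: L2Z.
apply: ge_ereal_sup => _ [f /unit_ballE f1 <-].
rewrite L2norm_le ?sqrtr_ge0 // sqr_sqrtr ?mulr_ge0 ?(ltW eps0) //.
pose c : 'rV[R[i]]_N := \row_k rkhs_dot H f (e k).
pose r i := rkhs_fun H (resid v N f) (x i).
pose z := c - \sum_(i < n) rkhs_fun H f (x i) *: ls_row w eps T i.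
have fE y : rkhs_fun H f y = \sum_k c 0 k * fe k y + rkhs_fun H (resid v N f) y.
  rewrite eval_resid [RHS]addrC; have -> : \sum_k c 0 k * fe k y = \sum_(k < N) rkhs_dot H f (e k) * fe k y.
    by apply: eq_bigr => k _; rewrite mxE.
  by rewrite subrK.
have yE (i : 'I_n) : rkhs_fun H f (x i) = (c *m w i) 0 0 + r i.
  by rewrite fE; congr (_ + _); rewrite mxE; apply: eq_bigr => k _; rewrite [w i k _]mxE.
have tr' i : t i * sqn (r i) <= rho.
  have := tr i; case E : (tail_sqn N (x i)) => [s| |].
  - rewrite -EFinM lee_fin; apply: le_trans; rewrite ler_wpM2l //.
    have le_s : (\sum_(N <= k <oo) (sqn (fe k (x i)) : R)%:E <= s%:E)%E.
      by rewrite -nneseries_addn -?E // => k; rewrite lee_fin sqn_ge0.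
    apply: le_trans (sqn_eval_resid dv f le_s) _.
    have s0 : 0 <= s by rewrite -lee_fin -E tail_sqn_ge0.
    by rewrite ler_piMl.
  (* An infinite tail at a node forces its weight to be 0. *)
  - move: (t0 i); rewrite le_eqVlt => /predU1P[<-|ti]; first by rewrite mul0r mul0e lee_fin.
    by rewrite gt0_muley ?lte_fin.
  - by have := tail_sqn_ge0 N (x i); rewrite E.
have err := ls_error eps0 T0 yE (erefl z).
have errE : (fun y => rkhs_fun H f y - \sum_(i < n) rkhs_fun H f (x i) * g i y) =
    fun y => \sum_k z 0 k * fe k y + rkhs_fun H (resid v N f) y.
  apply/funext => y; rewrite fE addrAC; congr (_ + _).
  have -> : \sum_(i < n) rkhs_fun H f (x i) * g i y =
      \sum_k (\sum_(i < n) rkhs_fun H f (x i) *: ls_row w eps T i) 0 k * fe k y.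
    rewrite /g; under eq_bigr do rewrite mulr_sumr.
    rewrite exchange_big /=; apply: eq_bigr => k _.
    rewrite summxE mulr_suml; apply: eq_bigr => i _.
    by rewrite [in RHS]mxE mulrA.
  by rewrite -sumrB; apply: eq_bigr => k _; rewrite /z mxE_sub mulrBl.
pose zf y := \sum_k z 0 k * fe k y.
have int_z : (sqint mu zf <= (2 * eps)%:E)%E.
  rewrite (sqint_gram _ (fun k : 'I_N => L2H (e k))) lee_fin.
  apply: le_trans (sel z) _.
  have -> : \sum_(i < n) t i * sqn (\sum_k z 0 k * fe k (x i)) =
      \sum_i T i * sqn ((z *m w i) 0 0).
    apply: eq_bigr => i _; congr (_ * sqn _); rewrite mxE.
    by apply: eq_bigr => k _; rewrite [w i k _]mxE.
  apply: le_trans err _; rewrite mulr_natl mulr2n lerD //.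
    rewrite ler_piMr ?(ltW eps0) //; apply: le_trans f1.
    rewrite (bessel v N f) [leLHS](_ : _ = \sum_(k < N) sqn (rkhs_dot H f (e k))).
      by rewrite lerDr sqnorm_ge0.
    by apply: eq_bigr => k _; rewrite mxE.
  have -> : eps = \sum_(i < n) rho.
    by rewrite sumr_const card_ord -mulr_natl /rho mulrC divfK ?gt_eqF.
  by apply: ler_sum => i _; exact: tr'.
have int_r := sqint_resid_le f1 HNeps.
have L2z : L2 mu zf by apply: L2_sum => k; exact: L2Z.
rewrite errE; apply: le_trans (sqintD_le L2z (L2H _)) _.
have -> : ((6 * eps)%:E = 2%:E * (2 * eps)%:E + 2%:E * eps%:E)%E.
  by rewrite -!EFinM -EFinD; congr (_%:E); ring.
by rewrite leeD // lee_wpmul2l // lee_fin.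
Qed.

End SamplingUpperBound.

(** * Comparison of integration errors and sampling numbers *)

Section IntegrationVersusSampling.
Local Open Scope classical_set_scope.
Local Open Scope ring_scope.
Local Open Scope complex_scope.
Context d (D : measurableType d) (R : realType).
Variable P : probability D R.

Lemma L2_cst (c : R[i]) : L2 P (fun=> c).
Proof. by split; exact: Lfun_cst. Qed.

Lemma cintegral_cst (c : R[i]) : cintegral P (fun=> c) = c.
Proof.
have PT : (P : {measure set D -> \bar R}) setT = 1%E := probability_setT P.
by rewrite /cintegral !Rintegral_cst // PT /= !mulr1; case: c.
Qed.

Lemma L2_cintegrable (f : D -> R[i]) : L2 P f -> cintegrable P f.
Proof.
move=> lf; have := L2_mul_conj lf (L2_cst 1).
by rewrite (_ : (fun x => _) = f) //; apply/funext => x; rewrite rmorph1 mulr1.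
Qed.

(** The integral of |f - I|^2, where I is the integral of f, equals that of |f|^2 minus |I|^2
    because the total mass is 1. *)
Lemma sqn_cintegral_le (f : D -> R[i]) : L2 P f ->
  ((sqn (cintegral P f))%:E <= sqint P f)%E.
Proof.
move=> lf; pose I := cintegral P f.
have li : L2 P (fun x => f x + - I) by apply: L2D => //; exact: L2_cst.
have := sqint_ge0 P (fun x => f x + - I); rewrite !sqint_L2 // !lee_fin.
have i1 := L2_mul_conj lf lf.
have i2 := cintegrableZ (- Num.conj I) (L2_cintegrable lf).
have i3 := L2_mul_conj (L2_cst 1) lf.
have i4 := cintegrableZ (- I) i3.
have i5 := L2_cintegrable (L2_cst (I * Num.conj I)).
have -> : (fun x => (f x + - I) * Num.conj (f x + - I)) = fun x =>
   f x * Num.conj (f x) + (- Num.conj I * f x +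
   (- I * (1 * Num.conj (f x)) + I * Num.conj I)).
  by apply/funext => x; rewrite rmorphD rmorphN /=; ring.
have [j1 e1] := cintegrableD i4.1 i5.
have [j2 e2] := cintegrableD i2.1 j1.
rewrite (cintegrableD i1 j2).2 e2 e1 i2.2 i4.2 cintegral_cst.
have -> : cintegral P (fun x => 1 * Num.conj (f x)) = Num.conj I.
  rewrite -cintegral_conj; last exact: L2_cintegrable.
  by congr cintegral; apply/funext => x; rewrite mul1r.
rewrite -/I (_ : _ + _ = cintegral P (fun x => f x * Num.conj (f x)) - I * Num.conj I); last by ring.
by rewrite mulC_sqn complex_ReD /= subr_ge0.
Qed.

Variables (H : rkhs R D) (n : nat).

(** Integrating a sampling algorithm yields a quadrature rule with weights [cintegral P (g i)],
    whose error is the integral of the sampling error. *)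
Lemma integration_error_le : embedded_in_L2 P H ->
  (integration_error P n H <= sampling_number P n H)%E.
Proof.
move=> [L2H _ _]; apply: le_ereal_inf_tmp => _ [x [g [lg ->]]].
apply: ge_ereal_inf; eexists; first by exists x, (fun i => cintegral P (g i)).
apply: ge_ereal_sup => _ [f f1 <-].
apply: le_ereal_sup_tmp; eexists; first by exists f.
rewrite L2norm_ge ?normc_ge0 // sqr_normc.
have i1 := L2_cintegrable (L2H f).
have iZ i := cintegrableZ (rkhs_fun H f (x i)) (L2_cintegrable (lg i)).
have iS := cintegrable_sum (index_enum 'I_n) (fun i => (iZ i).1).
have iN := cintegrableZ (-1) iS.1.
have lh : L2 P (fun t => rkhs_fun H f t + -1 * \sum_(i < n) rkhs_fun H f (x i) * g i t).
  by apply: L2D => //; apply: L2Z; apply: L2_sum => i; exact: L2Z.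
have E : (fun t => rkhs_fun H f t - \sum_(i < n) rkhs_fun H f (x i) * g i t) =
   fun t => rkhs_fun H f t + -1 * \sum_(i < n) rkhs_fun H f (x i) * g i t.
  by apply/funext => t; rewrite mulN1r.
rewrite E; apply: le_trans (sqn_cintegral_le lh).
rewrite (cintegrableD i1 iN.1).2 iN.2 iS.2 -sqnN opprD mulN1r opprK addrC.
rewrite lee_fin le_eqVlt; apply/orP; left; apply/eqP; congr (sqn (_ - _)).
by apply: eq_bigr => i _; rewrite (iZ i).2 mulrC.
Qed.

End IntegrationVersusSampling.

Section StarBounds.
Local Open Scope classical_set_scope.
Local Open Scope ring_scope.
Variables (R : realType) (sigma : nat -> R).

Lemma e_star_le_g_star n : (e_star sigma n <= g_star sigma n)%E.
Proof.
apply: ge_ereal_sup => _ [d [D [P [H [emb apx ->]]]]].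
apply: le_ereal_sup_tmp; exists (sampling_number P n H).
  by exists d, D, P, H.
exact: integration_error_le.
Qed.

Hypothesis sigma0 : forall k, 0 <= sigma k.

Lemma sampling_number_le_approximation0 d (D : measurableType d)
    (mu : {measure set D -> \bar R}) (H : rkhs R D) n :
  (sampling_number mu n H <= approximation_number mu 0 H)%E.
Proof.
apply: le_ereal_inf_tmp => _ [L [g [_ _ ->]]].
apply: ge_ereal_inf; eexists.
  by exists (fun=> point), (fun _ _ => 0); split; first by move=> _; exact: L2_0.
rewrite le_eqVlt; apply/orP; left; apply/eqP; congr ereal_sup.
apply: eq_imagel => f _; congr L2norm; apply/funext => t.
by rewrite big_ord0 big1 // => i _; rewrite mulr0.
Qed.

(** The zero algorithm settles the cases in which [sigma_star] is [sigma 0]. Otherwise [c <= 16^-1]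
    makes room for the 16 m points that [sampling_number_le] asks for. *)
Lemma g_star_le (c : R) (C : nat) n : 0 < c -> c <= 16^-1 -> (3 <= C)%N ->
  (g_star sigma n <= (C%:R * sigma_star sigma (Num.truncn (c * n%:R)))%:E)%E.
Proof.
move=> c0 c16 C3; apply: ge_ereal_sup => _ [d [D [mu [H [[L2H _ _] apx ->]]]]].
have C1 : 1 <= C%:R :> R by rewrite ler1n (leq_trans _ C3).
have C3R : 3 <= C%:R :> R by rewrite ler_nat.
have le0 : (sampling_number mu n H <= (C%:R * sigma 0)%:E)%E.
  apply: le_trans (sampling_number_le_approximation0 mu H n) _.
  by rewrite apx lee_fin ler_peMl.
set m := Num.truncn _; rewrite /sigma_star.
case: ifPn => // /norP[m0 /negP fin_].
have fin : (\sum_(0 <= k <oo) (sigma k ^+ 2)%:E < +oo)%E.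
  by rewrite ltey; apply/negP.
rewrite minr_pMr ?(le_trans _ C1) // EFin_min le_min le0 /=.
have mn : (16 * m <= n)%N.
  rewrite -(ler_nat R) natrM.
  have : m%:R <= c * n%:R by rewrite truncn_le // mulr_ge0 // ltW.
  have : c * n%:R <= 16^-1 * n%:R by rewrite ler_wpM2r.
  lra.
have mp : (0 < m)%N by rewrite lt0n.
have mR : 0 < m%:R :> R by rewrite ltr0n.
set Tm := (\sum_(m <= k <oo) _)%E.
have Tm0 : (0 <= Tm)%E by apply: nneseries_ge0 => k _ _; rewrite lee_fin sqr_ge0.
have Tfin : Tm \is a fin_num.
  rewrite ge0_fin_numE //; apply: le_lt_trans fin.
  rewrite [leRHS](nneseries_split 0 m) ?add0n; last by move=> k _; rewrite lee_fin sqr_ge0.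
  by rewrite leeDr // sume_ge0 // => k _; rewrite lee_fin sqr_ge0.
set T := fine Tm; have TE : Tm = T%:E by rewrite fineK.
have T0 : 0 <= T by rewrite fine_ge0.
have [v dv] := exists_dense_seq H.
apply/lee_addgt0Pr => delta delta0.
(* The tail [T] may be 0 while [eps] must be positive, hence the term in [delta]. With s^2 = T / m
   one has sqrt (6 eps) <= sqrt 6 s + delta, and sqrt 6 <= 3 explains the condition on [C]. *)
pose eps := m%:R^-1 * T + delta ^+ 2 / 6.
have mT0 : 0 <= m%:R^-1 * T by rewrite mulr_ge0 // invr_ge0 ltW.
have d20 : 0 < delta ^+ 2 by rewrite exprn_gt0.
have eps0 : 0 < eps by rewrite ltr_wpDl // divr_gt0.
have tail : (Tm <= (m%:R * eps)%:E)%E.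
  rewrite TE lee_fin /eps mulrDr mulrA divff ?gt_eqF // mul1r lerDl.
  by rewrite mulr_ge0 ?(ltW mR) // divr_ge0 // ltW.
apply: le_trans (sampling_number_le L2H sigma0 apx dv mp mn eps0 fin tail) _.
rewrite -EFinD lee_fin.
set s := Num.sqrt (m%:R^-1 * T).
have s0 : 0 <= s by rewrite sqrtr_ge0.
have s2 : s ^+ 2 = m%:R^-1 * T by rewrite sqr_sqrtr.
rewrite -[leRHS]ger0_norm ?addr_ge0 ?mulr_ge0 ?(ltW delta0) ?ler0n //.
rewrite -sqrtr_sqr ler_sqrt ?sqr_ge0 // /eps -s2.
have : 0 <= delta * s by rewrite mulr_ge0 // ltW.
have : 3 * s <= C%:R * s by rewrite ler_wpM2r.
move: (C%:R * s) => u us ds; have : (3 * s + delta) ^+ 2 <= (u + delta) ^+ 2.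
  by rewrite ler_pXn2r ?nnegrE ?addr_ge0 ?mulr_ge0 ?(ltW delta0) // ?lerD2r // (le_trans _ us) // mulr_ge0.
apply: le_trans.
rewrite (_ : 6 * (s ^+ 2 + delta ^+ 2 / 6) = 6 * s ^+ 2 + delta ^+ 2); last by field.
rewrite (_ : (3 * s + delta) ^+ 2 = 9 * s ^+ 2 + 6 * (delta * s) + delta ^+ 2); last by ring.
by have := sqr_ge0 s; lra.
Qed.

End StarBounds.

(** * Reproducing kernel Hilbert spaces on the integers *)

Section Ell2.
Local Open Scope classical_set_scope.
Local Open Scope ring_scope.
Local Open Scope complex_scope.
Variables (R : realType) (S : pred nat).

Definition part (n : nat) (c : nat -> R[i]) : R := \sum_(k < n) sqn (c k).

Lemma part_ge0 n c : 0 <= part n c.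
Proof. by apply: sumr_ge0 => k _; exact: sqn_ge0. Qed.

Lemma part_mono c : nondecreasing_seq (part ^~ c).
Proof.
apply/nondecreasing_seqP => n; rewrite /part big_ord_recr /= lerDl; exact: sqn_ge0.
Qed.

Lemma partD_le n c e : part n (fun k => c k + e k) <= 2 * part n c + 2 * part n e.
Proof.
rewrite /part !mulr_sumr -big_split /=; apply: ler_sum => k _; exact: sqnD_le.
Qed.

Lemma partZ n a c : part n (fun k => a * c k) = sqn a * part n c.
Proof. by rewrite /part mulr_sumr; apply: eq_bigr => k _; rewrite sqnM. Qed.

Definition ell2_pred : {pred nat -> R[i]^o} :=
  mem [set c : nat -> R[i]^o | (forall k, ~~ S k -> c k = 0) /\
         exists B, forall n, part n c <= B].

Lemma ell2_submod_closed : submod_closed ell2_pred.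
Proof.
split.
  rewrite inE /=; split=> //; exists 0 => n; rewrite /part big1 // => k _.
  by rewrite /sqn /= !expr0n addr0.
move=> a c e; rewrite !inE => -[cS [B cB]] [eS [B' eB]]; split=> [k Sk|].
  by rewrite -[LHS]/(a *: c k + e k) cS // eS // scaler0 addr0.
exists (2 * (sqn a * B) + 2 * B') => n.
rewrite -[X in part n X]/(fun k => a * c k + e k).
apply: le_trans (partD_le _ _ _) _; rewrite partZ lerD //.
  by rewrite ler_wpM2l // ler_wpM2l ?sqn_ge0.
by rewrite ler_wpM2l.
Qed.

(* The support is restricted to S so that multiplication by a sequence vanishing
   off S stays injective. *)
Record ell2 := Ell2 { ell2_fun : nat -> R[i]^o; ell2P : ell2_fun \in ell2_pred }.

HB.instance Definition _ := [isSub for ell2_fun].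
HB.instance Definition _ := [Choice of ell2 by <:].
HB.instance Definition _ := GRing.isSubmodClosed.Build _ _ ell2_pred ell2_submod_closed.
HB.instance Definition _ := [SubChoice_isSubLmodule of ell2 by <:].

Local Notation crd := ell2_fun.
Implicit Types x y : ell2.

Lemma crdZ (a : R[i]) x k : crd (a *: x) k = a * (crd x k : R[i]).
Proof. by []. Qed.

Lemma crd_inj x y : (forall k, crd x k = crd y k :> R[i]) -> x = y.
Proof. by move=> xy; apply: val_inj; apply/funext. Qed.

Lemma crd_supp x k : ~~ S k -> crd x k = 0 :> R[i].
Proof. by have := ell2P x; rewrite inE => -[+ _]; apply. Qed.

Lemma part_ubound x : has_ubound (range (part ^~ (crd x))).
Proof.
by have := ell2P x; rewrite inE => -[_ [B cB]]; exists B => _ [n _ <-].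
Qed.

Definition nsq x : R := sup (range (part ^~ (crd x))).

Lemma part_cvg x : part ^~ (crd x) @ \oo --> nsq x.
Proof. by apply: nondecreasing_cvgn; [exact: part_mono|exact: part_ubound]. Qed.

Lemma part_le x n : part n (crd x) <= nsq x.
Proof. by apply: ub_le_sup; [exact: part_ubound|exists n]. Qed.

Lemma nsq_le x B : (forall n, part n (crd x) <= B) -> nsq x <= B.
Proof.
move=> xB; apply: ge_sup; first by exists (part 0 (crd x)); exists 0%N.
by move=> _ [n _ <-].
Qed.

Lemma nsq_ge0 x : 0 <= nsq x.
Proof. by apply: le_trans (part_le x 0); exact: part_ge0. Qed.

Lemma sqn_crd_le x k : sqn (crd x k) <= nsq x.
Proof.
apply: le_trans (part_le x k.+1); rewrite /part big_ord_recr /= lerDr.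
by apply: sumr_ge0 => j _; exact: sqn_ge0.
Qed.

(** Convergence is taken componentwise, so that limit theorems for real sequences apply. *)
Definition ccvg (u : nat -> R[i]) (z : R[i]) :=
  (fun n => complex.Re (u n)) @ \oo --> complex.Re z /\
  (fun n => complex.Im (u n)) @ \oo --> complex.Im z.

Lemma ccvg_unique u z z' : ccvg u z -> ccvg u z' -> z = z'.
Proof.
move=> [r i] [r' i']; apply/eqP; rewrite eq_complex.
by rewrite (cvg_unique _ r r') // (cvg_unique _ i i') // !eqxx.
Qed.

Lemma ccvg_lin (a : R[i]) u w (y z : R[i]) : ccvg u y -> ccvg w z ->
  ccvg (fun n => a * u n + w n) (a * y + z).
Proof.
case: a => a b [ur ui] [wr wi]; split.
- rewrite (_ : complex.Re _ = a * complex.Re y - b * complex.Im y + complex.Re z); last first.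
    by case: y z {ur ui wr wi} => ? ? [].
  rewrite (_ : (fun _ => _) = fun n => a * complex.Re (u n) - b * complex.Im (u n) + complex.Re (w n)).
    by apply: cvgD => //; apply: cvgB; apply: cvgMr.
  by apply/funext => n; case: (u n) (w n) => ? ? [].
- rewrite (_ : complex.Im _ = a * complex.Im y + b * complex.Re y + complex.Im z); last first.
    by case: y z {ur ui wr wi} => ? ? [].
  rewrite (_ : (fun _ => _) = fun n => a * complex.Im (u n) + b * complex.Re (u n) + complex.Im (w n)).
    by apply: cvgD => //; apply: cvgD; apply: cvgMr.
  by apply/funext => n; case: (u n) (w n) => ? ? [].
Qed.

Lemma ccvg_conj u z : ccvg u z -> ccvg (fun n => Num.conj (u n)) (Num.conj z).
Proof.
move=> [r i]; split.
  rewrite (_ : complex.Re _ = complex.Re z); last by case: z {r i}.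
  by rewrite (_ : (fun _ => _) = fun n => complex.Re (u n)) //; apply/funext => n; case: (u n).
rewrite (_ : complex.Im _ = - complex.Im z); last by case: z {r i}.
rewrite (_ : (fun _ => _) = fun n => - complex.Im (u n)); first exact: cvgN.
by apply/funext => n; case: (u n).
Qed.

Definition pdot n (c e : nat -> R[i]) : R[i] := \sum_(k < n) c k * Num.conj (e k).

Lemma pdot_part n (c e : nat -> R[i]) :
  part n (fun k => c k + e k) = part n c + 2 * complex.Re (pdot n c e) + part n e.
Proof.
rewrite /part /pdot complex_Re_sum mulr_sumr -!big_split /=.
by apply: eq_bigr => k _; rewrite sqnD.
Qed.

(* Polarisation reduces the convergence of inner products to that of norms. *)
Definition redot x y : R := (nsq (x + y) - nsq x - nsq y) / 2.

Lemma redot_cvg x y : (fun n => complex.Re (pdot n (crd x) (crd y))) @ \oo --> redot x y.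
Proof.
rewrite (_ : (fun _ => _) = fun n => (part n (crd (x + y)) - part n (crd x) - part n (crd y)) / 2).
  by apply: cvgMl; apply: cvgB; [apply: cvgB|]; exact: part_cvg.
apply/funext => n; have := pdot_part n (crd x) (crd y).
rewrite -[part n (fun k => _)]/(part n (crd (x + y))) => ->; lra.
Qed.

(** The imaginary part of z is the real part of -i z. *)
Definition edot x y : R[i] := Complex (redot x y) (redot ((- 'i) *: x) y).

Lemma edot_cvg x y : ccvg (fun n => pdot n (crd x) (crd y)) (edot x y).
Proof.
split; first exact: redot_cvg.
rewrite /= (_ : (fun _ => _) = fun n => complex.Re (pdot n (crd ((- 'i) *: x)) (crd y))).
  exact: redot_cvg.
apply/funext => n; have -> : pdot n (crd ((- 'i) *: x)) (crd y) = - 'i * pdot n (crd x) (crd y).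
  by rewrite /pdot mulr_sumr; apply: eq_bigr => k _; rewrite crdZ mulrA.
by case: (pdot n _ _) => a b /=; rewrite mulN1r mulrC; ring.
Qed.

Lemma edot_linl (a : R[i]) x y z : edot (a *: x + y) z = a * edot x z + edot y z.
Proof.
apply: ccvg_unique (edot_cvg _ _) _.
rewrite (_ : (fun _ => _) = fun n => a * pdot n (crd x) (crd z) + pdot n (crd y) (crd z)).
  by apply: ccvg_lin; exact: edot_cvg.
apply/funext => n; rewrite /pdot mulr_sumr -big_split /=; apply: eq_bigr => k _.
by rewrite -[(a *: crd x + crd y) _]/(a * (crd x k : R[i]) + (crd y k : R[i])) mulrDl mulrA.
Qed.

Lemma edotC x y : edot x y = Num.conj (edot y x).
Proof.
apply: ccvg_unique (edot_cvg _ _) _.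
rewrite (_ : (fun _ => _) = fun n => Num.conj (pdot n (crd y) (crd x))).
  by apply: ccvg_conj; exact: edot_cvg.
apply/funext => n; rewrite /pdot rmorph_sum; apply: eq_bigr => k _.
by rewrite rmorphM /= conjCK mulrC.
Qed.

Lemma edot_nsq x : edot x x = (nsq x)%:C.
Proof.
apply: ccvg_unique (edot_cvg _ _) _.
have E n : pdot n (crd x) (crd x) = (part n (crd x))%:C.
  by rewrite /pdot /part rmorph_sum; apply: eq_bigr => k _; rewrite mulC_sqn.
split.
  rewrite (_ : (fun _ => _) = part ^~ (crd x)); first exact: part_cvg.
  by apply/funext => n; rewrite E.
rewrite (_ : (fun _ => _) = cst 0); first exact: cvg_cst.
by apply/funext => n; rewrite E.
Qed.

Lemma nsq_eq0 x : nsq x = 0 -> x = 0.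
Proof.
move=> x0; apply: crd_inj => k; apply/eqP; rewrite -sqn_eq0 eq_le sqn_ge0 andbT.
by rewrite -x0 sqn_crd_le.
Qed.

Lemma nsqZ a x : nsq (a *: x) = sqn a * nsq x.
Proof.
have H : part ^~ (crd (a *: x)) @ \oo --> sqn a * nsq x.
  rewrite (_ : part ^~ _ = fun n => sqn a * part n (crd x)).
    by apply: cvgMr; exact: part_cvg.
  by apply/funext => n; rewrite -partZ.
by rewrite (cvg_unique _ (@part_cvg (a *: x)) H).
Qed.

Definition enorm x : R[i] := (Num.sqrt (nsq x))%:C.

(** Cauchy-Schwarz on partial sums gives a bound uniform in their length, which passes to the
    supremum. *)
Lemma enormD x y : enorm (x + y) <= enorm x + enorm y.
Proof.
rewrite /enorm -rmorphD lecR.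
set a := Num.sqrt (nsq x); set b := Num.sqrt (nsq y).
have a0 : 0 <= a by rewrite sqrtr_ge0.
have b0 : 0 <= b by rewrite sqrtr_ge0.
have a2 : a ^+ 2 = nsq x by rewrite sqr_sqrtr ?nsq_ge0.
have b2 : b ^+ 2 = nsq y by rewrite sqr_sqrtr ?nsq_ge0.
rewrite -[leRHS]ger0_norm ?addr_ge0 // -sqrtr_sqr ler_wsqrtr //.
apply: nsq_le => n.
rewrite [leLHS](pdot_part n (crd x) (crd y)) sqrrD a2 b2 mulr2n.
rewrite lerD ?part_le // lerD ?part_le //.
rewrite -mulr2n -mulr_natl ler_wpM2l //.
have : sqn (pdot n (crd x) (crd y)) <= (a * b) ^+ 2.
  apply: le_trans (sqn_sum_le _ _ _) _; rewrite exprMn a2 b2.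
  have -> : \sum_(i < n) sqn (Num.conj (crd y i)) = part n (crd y).
    by apply: eq_bigr => i _; case: (crd y i) => u v; rewrite /sqn /= sqrrN.
  by apply: ler_pM; rewrite ?part_ge0 ?part_le.
case: (pdot _ _ _) => u w; rewrite /sqn /= => uw.
have ab0 : 0 <= a * b by rewrite mulr_ge0.
have [u0|u0] := lerP u 0; first exact: le_trans ab0.
rewrite -(@ler_pXn2r _ 2) ?nnegrE ?(ltW u0) //.
by apply: le_trans uw; rewrite lerDl sqr_ge0.
Qed.

Lemma enormZ (a : R[i]) x : enorm (a *: x) = `|a| * enorm x.
Proof.
by rewrite /enorm nsqZ sqrtrM ?sqn_ge0 // rmorphM normc_def.
Qed.

Lemma enorm_eq0 x : enorm x = 0 -> x = 0.
Proof.
rewrite /enorm -(rmorph0 (real_complex R)) => /complexI /eqP.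
by rewrite sqrtr_eq0 => x0; apply: nsq_eq0; apply/eqP; rewrite eq_le x0 nsq_ge0.
Qed.

HB.instance Definition _ := Lmodule_isNormed.Build R[i] ell2 enormD enormZ enorm_eq0.

HB.instance Definition _ := bilinear_isBilinear.Build R[i] ell2 ell2 R[i]
  ( *%R ) (@Num.conj R[i] \; *%R) edot
  (conj (fun z a x y => edot_linl a x y z)
   (fun z a x y => etrans (edotC _ _) (etrans (congr1 Num.conj (edot_linl a x y z))
     (etrans (rmorphD _ _ _) (f_equal2 +%R
       (etrans (rmorphM _ _ _) (f_equal2 *%R erefl (esym (edotC _ _))))
       (esym (edotC _ _))))))).

HB.instance Definition _ := isHermitianSesquilinear.Build R[i] ell2 false (@Num.conj R[i]) edot
  (fun x y => etrans (edotC x y) (esym (mul1r _))).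

Lemma edot_gt0 x : x != 0 -> 0 < edot x x.
Proof.
move=> x0; rewrite edot_nsq ltr0c lt_neqAle nsq_ge0 andbT eq_sym.
by apply: contra_neq x0; exact: nsq_eq0.
Qed.

HB.instance Definition _ := isDotProduct.Build R[i] ell2 edot edot_gt0.

Lemma ell2_normE x : `|x| = (Num.sqrt (nsq x))%:C.
Proof. by []. Qed.

Lemma ell2_ball x y (eps : R) : 0 < eps -> ball x eps%:C y <-> nsq (x - y) < eps ^+ 2.
Proof.
move=> eps0; rewrite -ball_normE /= ell2_normE ltcR.
rewrite -[X in (_ < X) <-> _]gtr0_norm // -sqrtr_sqr ltr_sqrt //.
by rewrite exprn_gt0.
Qed.

Lemma real_of_pos (e : R[i]) : 0 < e -> exists2 r : R, 0 < r & e = r%:C.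
Proof.
move=> e0; have E : (complex.Re e)%:C = e by rewrite RRe_real // gtr0_real.
by exists (complex.Re e); rewrite ?E // -ltr0c E.
Qed.

Lemma sqr_Re_le (z : R[i]) : complex.Re z ^+ 2 <= sqn z.
Proof. by rewrite /sqn lerDl sqr_ge0. Qed.

Lemma sqr_Im_le (z : R[i]) : complex.Im z ^+ 2 <= sqn z.
Proof. by rewrite /sqn lerDr sqr_ge0. Qed.

(** [phi] is the real or the imaginary part; as it is additive and dominated by the modulus, it
    sends Cauchy filters to Cauchy filters at each coordinate. *)
Lemma crd_cvg_real (F : set_system ell2) (phi : R[i] -> R) (FF : ProperFilter F) :
  (forall z, phi z ^+ 2 <= sqn z) -> {morph phi : z w / z - w} ->
  cauchy F -> forall k, cvg ((fun x => phi (crd x k)) @ F).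
Proof.
move=> phi_le phiB /cauchyP cF k; apply: cauchy_cvg; apply: cauchy_exP => eps eps0.
have eps0c : 0 < eps%:C by rewrite ltr0c.
have [x Fx] := cF eps%:C eps0c.
exists (phi (crd x k)).
suff : F [set y | ball (phi (crd x k)) eps (phi (crd y k))] by [].
apply: filterS Fx => y /(ell2_ball _ _ eps0) xy /=.
rewrite -ball_normE /= -phiB -[ltRHS]gtr0_norm // -!sqrtr_sqr ltr_sqrt ?exprn_gt0 //.
by apply: le_lt_trans xy; apply: le_trans (phi_le _) _; exact: (sqn_crd_le (x - y)).
Qed.

(** The limit is the coordinatewise one, [c]. A finite section of y - c is a limit of the same
    section of y - x with x close to y, so the Cauchy bound passes to y - c uniformly in the length
    of the section. *)
Lemma ell2_complete (F : set_system ell2) : ProperFilter F -> cauchy F -> cvg F.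
Proof.
move=> FF cF.
have cR := crd_cvg_real FF sqr_Re_le (fun z w => raddfB (@complex.Re R) z w) cF.
have cI := crd_cvg_real FF sqr_Im_le (fun z w => raddfB (@complex.Im R) z w) cF.
pose c k : R[i]^o := Complex (lim ((fun x => complex.Re (crd x k)) @ F))
                             (lim ((fun x => complex.Im (crd x k)) @ F)).
have cS k : ~~ S k -> c k = 0.
  move=> Sk; apply/eqP; rewrite eq_complex /=; apply/andP; split; apply/eqP.
    rewrite (_ : (fun _ => _) = cst 0) ?lim_cst //.
    by apply/funext => x; rewrite crd_supp.
  rewrite (_ : (fun _ => _) = cst 0) ?lim_cst //.
  by apply/funext => x; rewrite crd_supp.
have part_F y n : (fun x => part n (fun k => (crd y k : R[i]) - (crd x k : R[i]))) @ F -->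
    part n (fun k => (crd y k : R[i]) - (c k : R[i])).
  have sqn_F k : (fun x => sqn ((crd y k : R[i]) - (crd x k : R[i]))) @ F -->
      sqn ((crd y k : R[i]) - (c k : R[i])).
    rewrite (_ : (fun _ => _) = fun x =>
      (complex.Re (crd y k) - complex.Re (crd x k)) ^+ 2 +
      (complex.Im (crd y k) - complex.Im (crd x k)) ^+ 2); last first.
      by apply/funext => x; case: (crd y k) (crd x k) => ? ? [].
    have -> : sqn ((crd y k : R[i]) - (c k : R[i])) =
      (complex.Re (crd y k) - lim ((fun x => complex.Re (crd x k)) @ F)) ^+ 2 +
      (complex.Im (crd y k) - lim ((fun x => complex.Im (crd x k)) @ F)) ^+ 2.
      by rewrite /c; case: (crd y k).
    apply: cvgD; rewrite expr2; under eq_fun do rewrite expr2.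
      by apply: cvgM; apply: cvgB => //; exact: cvg_cst.
    by apply: cvgM; apply: cvgB => //; exact: cvg_cst.
  elim: n => [|n IH].
    rewrite /part big_ord0; under eq_fun do rewrite big_ord0; exact: cvg_cst.
  rewrite /part big_ord_recr; under eq_fun do rewrite big_ord_recr.
  exact: cvgD.
have close (eps : R) : 0 < eps -> exists2 y, F (ball y eps%:C) &
    forall n, part n (fun k => (crd y k : R[i]) - (c k : R[i])) <= eps ^+ 2.
  move=> eps0; have /cauchyP cF' := cF.
  have eps0c : 0 < eps%:C by rewrite ltr0c.
  have [y Fy] := cF' eps%:C eps0c; exists y => // n.
  apply: (cvgr_to_le (part_F y n)); apply: filterS Fy => x /(ell2_ball _ _ eps0) xy.
  by apply: le_trans (ltW xy); exact: (part_le (y - x)).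
have cP : c \in ell2_pred.
  rewrite inE /=; split=> //; have [y _ yc] := close 1 ltr01.
  exists (2 * nsq y + 2 * 1 ^+ 2) => n.
  have -> : c = fun k => (crd y k : R[i]) + - 1 * ((crd y k : R[i]) - (c k : R[i])).
    by apply/funext => k; rewrite mulN1r opprB addrC subrK.
  apply: le_trans (partD_le _ _ _) _; rewrite partZ.
  have -> : sqn (-1 : R[i]) = 1 by rewrite sqnN /sqn /= expr1n expr0n addr0.
  by rewrite mul1r lerD // ler_wpM2l // part_le.
apply/cvg_ex; exists (Ell2 cP); apply/cvg_ballP => e /real_of_pos [r r0 ->].
(* [close] gives only a non-strict bound, so r / 4 is used to get distances strictly below r / 2. *)
have r40 : 0 < r / 4 by rewrite divr_gt0.
have r20 : 0 < r / 2 by rewrite divr_gt0.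
have [y Fy yc] := close (r / 4) r40.
have r42 : (r / 4) ^+ 2 < (r / 2) ^+ 2.
  by rewrite ltr_pXn2r ?nnegrE ?(ltW r40) ?(ltW r20) //; lra.
have ball_c : ball (Ell2 cP) (r / 2)%:C y.
  apply: ball_sym; apply/ell2_ball => //; apply: le_lt_trans r42.
  by apply: nsq_le => n; exact: yc.
apply: filterS Fy => x /(ell2_ball _ _ r40) Hx; rewrite (splitr r) rmorphD.
apply: ball_triangle ball_c _; apply/ell2_ball => //; exact: lt_trans Hx r42.
Qed.

HB.instance Definition _ := Uniform_isComplete.Build ell2 ell2_complete.

Lemma ell2_unit_pred (m : nat) :
  (fun k => if S m && (k == m) then 1 else 0) \in ell2_pred.
Proof.
rewrite inE /=; split=> [k Sk|].
  by case: ifP => // /andP[Sm /eqP km]; rewrite km Sm in Sk.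
exists 1 => n; rewrite /part.
have [mn|nm] := ltnP m n.
  rewrite (bigD1 (Ordinal mn)) //= big1 => [|i im].
    by rewrite eqxx andbT addr0; case: ifP => _; rewrite /sqn /= ?expr1n ?expr0n /= ?addr0.
  rewrite (_ : (i == m :> nat) = false) ?andbF; last by apply: negbTE; exact: im.
  by rewrite /sqn /= expr0n addr0.
rewrite big1 // => i _; rewrite (_ : (i == m :> nat) = false) ?andbF.
  by rewrite /sqn /= expr0n addr0.
by rewrite ltn_eqF // (leq_trans (ltn_ord i)).
Qed.

(** The zero vector if [m] is outside the support, so that these families can be indexed by all of
    [nat]. *)
Definition eunit m : ell2 := Ell2 (ell2_unit_pred m).

Lemma crd_eunit m k : crd (eunit m) k = (if S m && (k == m) then 1 else 0) :> R[i].
Proof. by []. Qed.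

End Ell2.

Section Ell2Separable.
Local Open Scope classical_set_scope.
Local Open Scope ring_scope.
Local Open Scope complex_scope.
Variables (R : realType) (S : pred nat).
Local Notation ell2 := (@ell2 R S).

Definition ratvec (s : seq (rat * rat)) (k : nat) : R[i] :=
  if S k && (k < size s)%N
  then Complex (ratr (nth (0, 0) s k).1) (ratr (nth (0, 0) s k).2) else 0.

Lemma sqn0 : sqn (0 : R[i]) = 0.
Proof. by rewrite /sqn /= expr0n addr0. Qed.

Lemma ratvec_pred s : (ratvec s : nat -> R[i]^o) \in @ell2_pred R S.
Proof.
rewrite inE /=; split=> [k /negbTE Sk|]; first by rewrite /ratvec Sk.
exists (part (size s) (ratvec s)) => n.
have [ns|/ltnW sn] := leqP n (size s); first exact: part_mono.
rewrite /part -!(big_mkord xpredT (fun k => sqn (ratvec s k))).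
rewrite (@big_cat_nat _ _ _ (size s)) //= [X in _ + X <= _](_ : _ = 0) ?addr0 //.
rewrite big_nat_cond big1 // => k.
by rewrite /ratvec andbT => /andP[sk _]; rewrite ltnNge sk andbF sqn0.
Qed.

Lemma exists_rat_approx (z : R[i]) (delta : R) : 0 < delta ->
  exists q : rat * rat, sqn (z - Complex (ratr q.1) (ratr q.2)) <= delta.
Proof.
move=> d0; have approx (r : R) : exists q : rat, (r - ratr q) ^+ 2 <= delta / 2.
  have s0 : 0 < Num.sqrt (delta / 2) by rewrite sqrtr_gt0 divr_gt0.
  have [q] := @rat_in_itvoo R r (r + Num.sqrt (delta / 2)) (ltr_pwDr s0 (lexx r)).
  rewrite in_itv /= => /andP[q1 q2]; exists q.
  have d2 : 0 <= delta / 2 by rewrite divr_ge0 // ltW.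
  rewrite -[leRHS](sqr_sqrtr d2) -sqrrN opprB ler_pXn2r ?nnegrE ?sqrtr_ge0 ?subr_ge0 ?(ltW q1) //.
  by rewrite lerBlDl ltW.
case: z => a b; have [q1 h1] := approx a; have [q2 h2] := approx b.
by exists (q1, q2); rewrite (splitr delta); exact: lerD.
Qed.

Lemma ell2_separable : exists2 A : set ell2, countable A & dense A.
Proof.
exists (range (fun s => Ell2 (ratvec_pred s))).
  by apply: card_le_trans (card_image_le _ _) _; exact: countableP.
move=> O [c Oc] oO.
have /nbhs_ballP [e /= /real_of_pos [r r0 ->] sub] : nbhs c O by exact: open_nbhs_nbhs.
have r20 : 0 < r ^+ 2 / 2 by rewrite divr_gt0 // exprn_gt0.
have [n tail_n] : exists n, nsq c - part n (ell2_fun c) < r ^+ 2 / 2.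
  have := @part_cvg R S c; move=> /cvgrPdist_lt /(_ _ r20) [n _ /(_ n (leqnn n)) Hn].
  by exists n; apply: le_lt_trans Hn; exact: ler_norm.
(* The first [n] coordinates then add up to at most r^2 / 4, which with a tail below r^2 / 2 stays
   below r^2; [n.+1] avoids a division by 0. *)
pose delta : R := r ^+ 2 / 4 / n.+1%:R.
have delta0 : 0 < delta by rewrite !divr_gt0 ?ltr0n ?exprn_gt0.
have [Q HQ] := choice (fun k => exists_rat_approx (ell2_fun c k) delta0).
exists (Ell2 (ratvec_pred (mkseq Q n))); split; last by exists (mkseq Q n).
apply: sub; apply/ell2_ball => //.
set y := Ell2 _.
have near_n k : (k < n)%N -> sqn ((ell2_fun c k : R[i]) - (ell2_fun y k : R[i])) <= delta.
  move=> kn; rewrite /y /= /ratvec size_mkseq kn andbT.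
  case: ifPn => [_|Sk]; first by rewrite nth_mkseq.
  by rewrite (crd_supp c Sk) subr0 sqn0 ltW.
have head : part n (ell2_fun (c - y)) <= r ^+ 2 / 4.
  apply: (@le_trans _ _ (\sum_(k < n) delta)); first by apply: ler_sum => k _; exact: near_n.
  rewrite sumr_const card_ord -[leLHS]mulr_natl /delta mulrCA ler_piMr ?divr_ge0 ?sqr_ge0 //.
  by rewrite ler_pdivrMr ?ltr0n // mul1r ler_nat.
have tail m : part (n + m) (ell2_fun (c - y)) <= part n (ell2_fun (c - y)) +
    (part (n + m) (ell2_fun c) - part n (ell2_fun c)).
  rewrite /part !big_split_ord /= [X in _ <= _ + X]addrAC subrr add0r lerD //.
  apply: ler_sum => k _.
  rewrite le_eqVlt; apply/orP; left; apply/eqP; congr sqn.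
  rewrite -[LHS]/((ell2_fun c (n + k)%N : R[i]) - (ell2_fun y (n + k)%N : R[i])).
  by rewrite /y /= /ratvec size_mkseq ltnNge leq_addr andbF subr0.
apply: (@le_lt_trans _ _ (r ^+ 2 / 4 + (nsq c - part n (ell2_fun c)))); last by lra.
apply: nsq_le => m; apply: (@le_trans _ _ (part (n + m) (ell2_fun (c - y)))).
  exact: part_mono (leq_addl _ _).
apply: le_trans (tail m) _; apply: lerD => //.
by rewrite lerD2r part_le.
Qed.
End Ell2Separable.

(** * Purely atomic probability measures *)

Section DiscreteProbability.
Local Open Scope classical_set_scope.
Local Open Scope ring_scope.
Local Open Scope ereal_scope.
Variables (R : realType) (p : nat -> {nonneg R}).
Hypothesis p1 : \sum_(k <oo) ((p k)%:num)%:E = 1.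

(** The proof that the masses add up to 1 is an argument so that [atomic p1] can carry the structure
    of a probability measure. *)
Definition atomic (_ : \sum_(k <oo) ((p k)%:num)%:E = 1) : set nat -> \bar R :=
  mseries (fun k => mscale (p k) (dirac k)) 0.

HB.instance Definition _ := Measure.on (atomic p1).

Lemma atomic_setT : atomic p1 setT = 1.
Proof.
rewrite -[RHS]p1; apply: eq_eseriesr => k _.
have E : (p k)%:num%:E * (\d_k [set: nat] : \bar R) = (p k)%:num%:E.
  by rewrite diracT mule1.
exact: E.
Qed.

HB.instance Definition _ := Measure_isProbability.Build _ _ _ (atomic p1) atomic_setT.

Lemma integral_atomic (f : nat -> R) : (forall x, 0 <= f x)%R ->
  \int[atomic p1]_x (f x)%:E = \sum_(k <oo) ((p k)%:num * f k)%:E.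
Proof.
move=> f0; rewrite ge0_integral_measure_series //; last by move=> x _; rewrite lee_fin.
apply: eq_eseriesr => k _; rewrite ge0_integral_mscale //; last by move=> x _; rewrite lee_fin.
by rewrite integral_dirac // diracT mul1e.
Qed.

Lemma eseries_finite_support (g : nat -> \bar R) N : (forall k, (N <= k)%N -> g k = 0) ->
  (forall k, 0 <= g k) -> \sum_(k <oo) g k = \sum_(k < N) g k.
Proof.
move=> gN g0; rewrite (nneseries_split 0 N) // add0n big_mkord eseries0 ?adde0 // => k Nk _.
exact: gN.
Qed.

Lemma Rintegral_atomic (f : nat -> R) N : (forall x, (N <= x)%N -> f x = 0%R) ->
  Rintegral (atomic p1) setT f = (\sum_(k < N) (p k)%:num * f k)%R.
Proof.
move=> fN; rewrite /Rintegral integralE.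
have part_ (h : nat -> R) : (forall x, 0 <= h x)%R -> (forall x, (N <= x)%N -> h x = 0%R) ->
    \int[atomic p1]_x (h x)%:E = (\sum_(k < N) (p k)%:num * h k)%:E.
  move=> h0 hN; rewrite integral_atomic // (@eseries_finite_support _ N) ?sumEFin //.
    by move=> k Nk; rewrite hN // mulr0.
  by move=> k; rewrite lee_fin mulr_ge0.
under eq_integral do rewrite funeposE -EFin_max.
rewrite part_; last 2 first.
- by move=> x; rewrite le_max lexx orbT.
- by move=> x Nx; rewrite fN // maxxx.
under eq_integral do rewrite funenegE -EFinN -EFin_max.
rewrite part_; last 2 first.
- by move=> x; rewrite le_max lexx orbT.
- by move=> x Nx; rewrite fN // oppr0 maxxx.
rewrite -EFinB /= -sumrB; apply: eq_bigr => k _; rewrite -mulrBr; congr (_ * _)%R.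
have [h|/ltW h] := lerP (f k) 0%R.
  by rewrite max_l ?oppr_ge0 // sub0r opprK.
by rewrite max_r ?oppr_le0 // subr0.
Qed.

End DiscreteProbability.

Section LinearContinuous.
Local Open Scope classical_set_scope.
Local Open Scope ring_scope.
Local Open Scope complex_scope.
Variables (R : realType) (V : normedModType R[i]).

Lemma linear_continuous_sqn (phi : {linear V -> R[i]^o}) (K : R) :
  (forall c, sqn (phi c : R[i]) <= K * complex.Re `|c| ^+ 2) -> continuous phi.
Proof.
move=> phiK c; apply/cvgrPdist_lt => eps /real_of_pos [r r0 ->].
pose K' := Num.max K 1.
have K'0 : 0 < K' by rewrite lt_max ltr01 orbT.
have phiK' e : sqn (phi e : R[i]) <= K' * complex.Re `|e| ^+ 2.
  by apply: le_trans (phiK e) _; rewrite ler_wpM2r ?sqr_ge0 // le_max lexx.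
pose delta := r / Num.sqrt K'.
have sK0 : 0 < Num.sqrt K' by rewrite sqrtr_gt0.
have delta0 : 0 < delta by rewrite divr_gt0.
apply/nbhs_ballP; exists delta%:C; first by rewrite /= ltr0c.
move=> e; rewrite -ball_normE /= => ce.
have {}ce : complex.Re `|c - e| < delta.
  by rewrite -ltcR RRe_real // normr_real.
have Re0 : 0 <= complex.Re `|c - e|.
  by rewrite -ler0c RRe_real // normr_real.
rewrite -linearB normc_def ltcR -/(sqn _) -[ltRHS]gtr0_norm // -sqrtr_sqr ltr_sqrt ?exprn_gt0 //.
apply: le_lt_trans (phiK' _) _.
have -> : r ^+ 2 = K' * delta ^+ 2.
  by rewrite /delta exprMn exprVn sqr_sqrtr ?(ltW K'0) // mulrC divfK // gt_eqF.
by rewrite ltr_pM2l // ltr_pXn2r ?nnegrE ?(ltW delta0).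
Qed.
End LinearContinuous.

(** * Spaces with prescribed approximation numbers *)

Section DiscreteRkhs.
Local Open Scope classical_set_scope.
Local Open Scope ring_scope.
Local Open Scope complex_scope.
Variables (R : realType) (sigma : nat -> R) (b : nat -> nat -> R[i]) (bd : nat -> nat).

Definition supp : pred nat := fun k => sigma k != 0.
Local Notation E := (@ell2 R supp).

(** The functions sigma_k b_k with sigma_k nonzero are to be an orthonormal basis of the space. As
    [bd x] will bound the indices k with b_k(x) nonzero, each value is a finite sum and evaluation
    is continuous. *)
Definition synth (c : E) (x : nat) : R[i] :=
  \sum_(k < bd x) (ell2_fun c k : R[i]) * ((sigma k)%:C * b k x).

Lemma synth_linear : linear (synth : E -> (nat -> R[i])).
Proof.
move=> a c e; apply/funext => x.
rewrite -[RHS]/(a * synth c x + synth e x) /synth mulr_sumr -big_split /=.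
apply: eq_bigr => k _.
rewrite -[LHS]/((a * (ell2_fun c k : R[i]) + (ell2_fun e k : R[i])) * ((sigma k)%:C * b k x)).
rewrite mulrDl -!mulrA; reflexivity.
Qed.

HB.instance Definition _ := GRing.isLinear.Build R[i] E (nat -> R[i]) _ synth synth_linear.

Definition synth_bound (x : nat) : R := \sum_(k < bd x) sqn ((sigma k)%:C * b k x).

Lemma sqn_synth_le c x : sqn (synth c x) <= nsq c * synth_bound x.
Proof.
apply: le_trans (sqn_sum_le _ _ _) _; rewrite ler_wpM2r ?part_le //.
by apply: sumr_ge0 => k _; exact: sqn_ge0.
Qed.

Lemma synth_continuous x : continuous (fun c : E => (synth c x : R[i]^o)).
Proof.
have lin : linear (fun c : E => (synth c x : R[i]^o)).
  by move=> a c e; rewrite synth_linear.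
pose L := GRing.isLinear.Build R[i] E R[i]^o _ _ lin.
pose phi : {linear E -> R[i]^o} := HB.pack (fun c : E => (synth c x : R[i]^o)) L.
apply: (@linear_continuous_sqn _ _ phi (synth_bound x)) => c.
by rewrite ell2_normE /= sqr_sqrtr ?nsq_ge0 // mulrC; exact: sqn_synth_le.
Qed.

Hypothesis synth_inj : injective synth.

Definition discrete_rkhs : rkhs R nat.
refine (@RKHS R nat (E : completeNormedModType R[i])
  (@edot R supp : {dot _ for (@Num.conj R[i])}) _
  (synth : {linear _ -> (nat -> R[i])}) synth_inj synth_continuous (@ell2_separable R supp)).
by move=> f; rewrite ell2_normE -rmorphXn /= sqr_sqrtr ?nsq_ge0 // -edot_nsq.
Defined.

Lemma sqnorm_discrete_rkhs (c : discrete_rkhs) : sqnorm c = nsq c.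
Proof.
by rewrite -[LHS]/(complex.Re (edot (c : E) c)) edot_nsq.
Qed.

End DiscreteRkhs.

Section DiscreteApproximation.
Local Open Scope classical_set_scope.
Local Open Scope ring_scope.
Local Open Scope complex_scope.
Variables (R : realType) (sigma : nat -> R) (b : nat -> nat -> R[i]) (bd : nat -> nat).
Variable p : nat -> {nonneg R}.
Hypothesis p1 : (\sum_(k <oo) ((p k)%:num)%:E = 1)%E.
Hypothesis p_gt0 : forall x, 0 < (p x)%:num.
Hypothesis sigma_ge0 : forall k, 0 <= sigma k.
Hypothesis sigma_dec : forall k, sigma k.+1 <= sigma k.
Local Notation E := (@ell2 R (supp sigma)).
Local Notation syn := (synth b bd).
(** This expresses that the b_k with sigma_k nonzero are orthonormal in L_2; together with the
    monotonicity of [sigma] it determines the approximation numbers. *)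
Hypothesis parseval : forall c : E,
  (\sum_(x <oo) ((p x)%:num * sqn (syn c x))%R%:E =
   \sum_(k <oo) (sqn (ell2_fun c k) * sigma k ^+ 2)%R%:E)%E.
Local Notation P := (atomic p1 : probability nat R).

Lemma sigma_mono k l : (k <= l)%N -> sigma l <= sigma k.
Proof.
move=> /subnK <-; elim: (l - k)%N => // n IH.
by apply: le_trans IH; rewrite addSn.
Qed.

Lemma sqint_synth (c : E) :
  sqint P (syn c) = (\sum_(k <oo) (sqn (ell2_fun c k) * sigma k ^+ 2)%R%:E)%E.
Proof.
rewrite -parseval /sqint; apply: integral_atomic => x; exact: sqn_ge0.
Qed.

Lemma sqint_synth_tail m (c : E) : (forall k, (k < m)%N -> ell2_fun c k = 0 :> R[i]) ->
  (sqint P (syn c) <= (sigma m ^+ 2 * nsq c)%:E)%E.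
Proof.
move=> cm; rewrite sqint_synth; apply: lime_le.
  by apply: is_cvg_nneseries => k _ _; rewrite lee_fin mulr_ge0 ?sqn_ge0 ?sqr_ge0.
apply: nearW => n; rewrite sumEFin lee_fin big_mkord.
apply: (@le_trans _ _ (sigma m ^+ 2 * part n (ell2_fun c))); last first.
  by rewrite ler_wpM2l ?sqr_ge0 // part_le.
rewrite /part mulr_sumr; apply: ler_sum => k _.
have [km|mk] := ltnP k m; first by rewrite cm // sqn0 mul0r mulr0.
rewrite mulrC ler_wpM2r ?sqn_ge0 // ler_pXn2r ?nnegrE //.
exact: sigma_mono.
Qed.

Lemma sqint_synth_le (c : E) : (sqint P (syn c) <= (sigma 0 ^+ 2 * nsq c)%:E)%E.
Proof. exact: sqint_synth_tail. Qed.

Lemma Lfun2_dominated (f : nat -> R) (g : nat -> R[i]) :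
  (forall x, f x ^+ 2 <= sqn (g x)) -> (sqint P g < +oo)%E -> f \in Lfun P 2%:E.
Proof.
move=> fg gfin; rewrite inE; apply/andP; split; rewrite inE //=.
rewrite /finite_norm unlock poweR_lty //.
apply: le_lt_trans gfin; apply: ge0_le_integral => //.
- by move=> x _; exact: poweR_ge0.
- by move=> x _; rewrite /= lee_fin powR_mulrn // real_normK ?num_real.
Qed.

Lemma L2_synth (c : E) : L2 P (syn c).
Proof.
have fin : (sqint P (syn c) < +oo)%E by apply: le_lt_trans (sqint_synth_le c) _; rewrite ltry.
by split; apply: Lfun2_dominated fin => x; [exact: sqr_Re_le|exact: sqr_Im_le].
Qed.

Lemma synth_eq0 (c : E) : (forall x, syn c x = 0) -> c = 0.
Proof.
move=> c0; have H := parseval c.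
have S0 : (\sum_(x <oo) ((p x)%:num * sqn (syn c x))%R%:E = 0)%E.
  by apply: eseries0 => x _ _; rewrite c0 sqn0 mulr0.
rewrite S0 in H; apply: crd_inj => k.
have [sk|sk] := boolP (supp sigma k); last by rewrite !crd_supp.
have le0 : (sqn (ell2_fun c k) * sigma k ^+ 2 <= 0).
  suff : ((sqn (ell2_fun c k) * sigma k ^+ 2)%:E <= 0)%E by rewrite lee_fin.
  rewrite H.
  apply: le_trans (_ : \sum_(0 <= j < k.+1) (sqn (ell2_fun c j) * sigma j ^+ 2)%:E <= _)%E; last first.
    by apply: nneseries_lim_ge => j _ _; rewrite lee_fin mulr_ge0 ?sqn_ge0 ?sqr_ge0.
  rewrite sumEFin lee_fin big_nat_recr //= lerDr.
  by apply: sumr_ge0 => j _; rewrite mulr_ge0 ?sqn_ge0 ?sqr_ge0.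
have : sqn (ell2_fun c k) * sigma k ^+ 2 == 0.
  by rewrite eq_le le0 mulr_ge0 ?sqn_ge0 ?sqr_ge0.
by rewrite mulf_eq0 sqrf_eq0 (negbTE sk) orbF sqn_eq0 => /eqP.
Qed.

Lemma synthB (c e : E) x : syn (c - e) x = syn c x - syn e x.
Proof.
have := synth_linear b bd (-1) e c; rewrite scaleN1r (addrC (- e)) => ->.
by rewrite -[LHS]/(-1 * syn e x + syn c x) mulN1r addrC.
Qed.

Lemma synth_injective : injective (synth b bd : E -> _).
Proof.
move=> c e ce; apply/eqP; rewrite -subr_eq0; apply/eqP; apply: synth_eq0 => x.
by rewrite synthB ce subrr.
Qed.

Definition drkhs : rkhs R nat := discrete_rkhs synth_injective.

Lemma drkhs_embedded : embedded_in_L2 P drkhs.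
Proof.
split; first exact: L2_synth.
(* Every atom has positive mass, so a function that vanishes almost everywhere vanishes
   everywhere. *)
- move=> c; move=> [A [mA A0 sub]]; apply: synth_eq0 => x.
  apply: contrapT => cx; have Ax : A x by apply: sub.
  have : ((p x)%:num%:E <= (0 : \bar R))%E.
    rewrite -A0.
    have S_le : (mscale (p x) \d_x A <= \sum_(0 <= k < x.+1) mscale (p k) \d_k A)%E.
      rewrite big_nat_recr //= leeDr //; apply: sume_ge0 => k _; exact: measure_ge0.
    have S_le2 : (\sum_(0 <= k < x.+1) mscale (p k) \d_k A <= atomic p1 A)%E.
      by apply: nneseries_lim_ge => k _ _; exact: measure_ge0.
    apply: le_trans (le_trans S_le S_le2).
    have E1 : ((p x)%:num%:E * (\d_x A : \bar R) = (p x)%:num%:E)%E.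
      by rewrite diracE mem_set // mule1.
    by rewrite -[leLHS]E1.
  by rewrite lee_fin leNgt p_gt0.
- exists (sigma 0) => c; rewrite norm_sqnorm sqnorm_discrete_rkhs /=.
  rewrite L2norm_le ?mulr_ge0 ?sqrtr_ge0 // exprMn sqr_sqrtr ?nsq_ge0 //.
  exact: sqint_synth_le.
Qed.

Lemma crd_sum_eunit n (F : nat -> R[i]) k :
  ell2_fun (\sum_(i < n) F i *: eunit R (supp sigma) i) k =
  if (k < n)%N && supp sigma k then F k else 0 :> R[i].
Proof.
have -> : ell2_fun (\sum_(i < n) F i *: eunit R (supp sigma) i) k =
    \sum_(i < n) F i * (if supp sigma i && (k == i) then 1 else 0) :> R[i].
  by elim/big_ind2: _ => // x1 x2 y1 y2 <- <- //.
have [kn|nk] := ltnP k n.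
  rewrite (bigD1 (Ordinal kn)) //= eqxx andbT big1 ?addr0.
    by case: ifP; rewrite ?mulr1 ?mulr0.
  move=> i ik; rewrite (_ : (k == i :> nat) = false) ?andbF ?mulr0 //.
  by apply/negbTE; rewrite eq_sym; exact: ik.
rewrite big1 // => i _; rewrite (_ : (k == i :> nat) = false) ?andbF ?mulr0 //.
by rewrite gtn_eqF // (leq_trans (ltn_ord i)).
Qed.

Lemma approximation_number_drkhs_le m :
  (approximation_number P m drkhs <= (sigma m)%:E)%E.
Proof.
have crd_lin k : linear (fun c : E => (ell2_fun c k : R[i]^o)) by [].
pose L k : {linear drkhs -> R[i]^o} := HB.pack (fun c : E => (ell2_fun c k : R[i]^o))
  (GRing.isLinear.Build R[i] E R[i]^o _ _ (crd_lin k)).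
have Lc k : continuous (L k).
  apply: (@linear_continuous_sqn _ _ (L k) 1) => c.
  by rewrite ell2_normE /= sqr_sqrtr ?nsq_ge0 // mul1r; exact: sqn_crd_le.
apply: ge_ereal_inf; eexists.
  exists (fun i : 'I_m => L i), (fun i : 'I_m => syn (eunit R (supp sigma) i)); split=> //.
  by move=> i; exact: L2_synth.
apply: ge_ereal_sup => _ [c /unit_ballE c1 <-].
rewrite sqnorm_discrete_rkhs in c1.
pose c' : E := c - \sum_(i < m) (ell2_fun c i : R[i]) *: eunit R (supp sigma) i.
have crd' k : ell2_fun c' k = if (k < m)%N then 0 else ell2_fun c k :> R[i].
  rewrite -[LHS]/((ell2_fun c k : R[i]) - ell2_fun
    (\sum_(i < m) (ell2_fun c i : R[i]) *: eunit R (supp sigma) i) k).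
  rewrite (crd_sum_eunit m (fun l => ell2_fun c l : R[i])).
  case: ltnP => _ /=; last by rewrite subr0.
  by case: ifPn => [_|sk]; rewrite ?subrr // subr0 crd_supp.
have -> : (fun t => rkhs_fun drkhs c t -
    \sum_(i < m) (L i c : R[i]) * syn (eunit R (supp sigma) i) t) = syn c'.
  apply/funext => t; rewrite /c' synthB; congr (_ - _).
  rewrite -[RHS]/(rkhs_fun drkhs (\sum_(i < m) (ell2_fun c i : R[i]) *: eunit R (supp sigma) i) t).
  by rewrite eval_sum; apply: eq_bigr => i _; rewrite evalZ.
rewrite L2norm_le //; apply: le_trans (@sqint_synth_tail m c' _) _.
  by move=> k km; rewrite crd' km.
rewrite lee_fin ler_piMr ?sqr_ge0 //; apply: le_trans c1; apply: nsq_le => n.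
apply: le_trans (part_le c n); apply: ler_sum => k _.
by rewrite crd'; case: ifP => // _; rewrite sqn0 sqn_ge0.
Qed.

Lemma nsq_sum_eunit n (F : nat -> R[i]) :
  nsq (\sum_(i < n) F i *: eunit R (supp sigma) i) <= \sum_(i < n) sqn (F i).
Proof.
apply: nsq_le => j; apply: (@le_trans _ _ (\sum_(k < j) (if (k < n)%N then sqn (F k) else 0))).
  apply: ler_sum => k _; rewrite crd_sum_eunit; case: ifPn => [/andP[-> _]//|_].
  by rewrite sqn0; case: ifP => // _; exact: sqn_ge0.
rewrite -(big_mkord xpredT (fun k => if (k < n)%N then sqn (F k) else 0)).
rewrite -big_mkcond /= -(big_mkord xpredT (fun k => sqn (F k))).
have [jn|nj] := leqP j n.
  rewrite (@big_cat_nat _ _ _ j 0 n) //= big_nat_cond (eq_bigl (fun k => (0 <= k < j)%N && true)).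
    rewrite -big_nat_cond lerDl; apply: sumr_ge0 => k _; exact: sqn_ge0.
  move=> k; rewrite andbT; case: (ltnP k j) => [kj|]; rewrite ?andbF //=.
  by rewrite (leq_trans kj jn).
rewrite (@big_cat_nat _ _ _ n 0 j) ?(ltnW nj) //= [X in _ + X <= _](_ : _ = 0) ?addr0.
  rewrite big_nat_cond (eq_bigl (fun k => (0 <= k < n)%N && true)) -?big_nat_cond //.
  by move=> k; rewrite andbT /=; case: (k < n)%N.
by rewrite big_nat_cond big_pred0 // => k; case: (ltnP k n); rewrite ?andbF.
Qed.

Lemma approximation_number_drkhs_ge m :
  ((sigma m)%:E <= approximation_number P m drkhs)%E.
Proof.
have -> : sigma m = Num.sqrt (sigma m ^+ 2) by rewrite sqrtr_sqr ger0_norm.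
pose h (i : 'I_m.+1) : drkhs := eunit R (supp sigma) i.
have hE (a : 'rV_m.+1) : lincomb h a =
    \sum_(i < m.+1) (fun k => a 0 (inord k)) i *: eunit R (supp sigma) i :> E.
  by apply: eq_bigr => i _; rewrite inord_val.
apply: (@approximation_number_ge _ _ _ _ _ _ h); first exact: sqr_ge0.
  move=> a; rewrite sqnorm_discrete_rkhs hE.
  apply: le_trans (@nsq_sum_eunit m.+1 (fun k => a 0 (inord k))) _.
  by apply: ler_sum => i _; rewrite inord_val.
move=> a; rewrite -[X in sqint _ X]/(syn (lincomb h a)) sqint_synth.
apply: (@le_trans _ _ (\sum_(0 <= k < m.+1)
    (sqn (ell2_fun (lincomb h a : E) k) * sigma k ^+ 2)%R%:E)%E); last first.
  by apply: nneseries_lim_ge => k _ _; rewrite lee_fin mulr_ge0 ?sqn_ge0 ?sqr_ge0.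
rewrite sumEFin lee_fin big_mkord mulr_sumr; apply: ler_sum => k _.
have -> : ell2_fun (lincomb h a : E) k = if supp sigma k then a 0 k else 0 :> R[i].
  have := @crd_sum_eunit m.+1 (fun l => a 0 (inord l)) k.
  by rewrite -hE ltn_ord inord_val.
(* If [sigma k = 0] the unit vector of index [k] is 0, but then [sigma m = 0] as well and nothing is
   claimed. *)
case: ifPn => [_|]; last first.
  rewrite negbK => /eqP sk.
  have sm : sigma m = 0.
    by apply/eqP; rewrite eq_le sigma_ge0 andbT -sk sigma_mono // -ltnS.
  by rewrite sm expr0n /= mul0r mulr_ge0 ?sqn_ge0 ?sqr_ge0.
rewrite mulrC ler_wpM2l ?sqn_ge0 // ler_pXn2r ?nnegrE //.
by rewrite sigma_mono // -ltnS.
Qed.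

Lemma approximation_number_drkhs m : approximation_number P m drkhs = (sigma m)%:E.
Proof.
by apply/eqP; rewrite eq_le approximation_number_drkhs_le approximation_number_drkhs_ge.
Qed.

Hypothesis b_supp : forall k x, (bd x <= k)%N -> b k x = 0.

Lemma synth_eunit k x : syn (eunit R (supp sigma) k) x = (sigma k)%:C * b k x.
Proof.
rewrite /synth; have [kx|xk] := ltnP k (bd x); last first.
  rewrite b_supp // mulr0 big1 // => i _; rewrite crd_eunit.
  by rewrite ltn_eqF ?andbF ?mul0r // (leq_trans (ltn_ord i)).
rewrite (bigD1 (Ordinal kx)) //= eqxx andbT big1 ?addr0 => [|i ik].
  by case: ifPn => [_|]; rewrite ?mul1r // negbK => /eqP ->; rewrite !mul0r.
rewrite (_ : (i == k :> nat) = false) ?andbF ?mul0r //.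
by apply/negbTE; exact: ik.
Qed.

(** On the span of the first [K] basis functions the error functional has coefficients lam_k, hence
    norm [Lam], attained at its Riesz representer with coefficients conj (lam_k) / Lam. If Lam = 0,
    the convention 0^-1 = 0 turns this vector into 0, which suffices. *)
Lemma integration_error_drkhs_ge n K (r : R) : 0 <= r ->
  (forall (x : 'I_n -> nat) (a : 'I_n -> R[i]),
    r ^+ 2 <= \sum_(k < K) sqn (\sum_(i < n) a i * ((sigma k)%:C * b k (x i)) -
      cintegral P (fun x => (sigma k)%:C * b k x))) ->
  (r%:E <= integration_error P n drkhs)%E.
Proof.
move=> r0 lam_ge; apply: le_ereal_inf_tmp => _ [x [a ->]].
pose lam k := \sum_(i < n) a i * ((sigma k)%:C * b k (x i)) -
      cintegral P (fun x => (sigma k)%:C * b k x).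
pose Lam := Num.sqrt (\sum_(k < K) sqn (lam k)).
have Lam2 : Lam ^+ 2 = \sum_(k < K) sqn (lam k).
  by rewrite sqr_sqrtr // sumr_ge0 // => k _; exact: sqn_ge0.
have Lam0 : 0 <= Lam by exact: sqrtr_ge0.
have rLam : r <= Lam.
  by rewrite -(@ler_pXn2r _ 2) ?nnegrE // Lam2; exact: lam_ge.
pose F k := (Lam^-1)%:C * Num.conj (lam k).
pose f : E := \sum_(k < K) F k *: eunit R (supp sigma) k.
have sF k : sqn (F k) = Lam^-1 ^+ 2 * sqn (lam k).
  by rewrite sqn_scale; congr (_ * _); case: (lam k) => u v; rewrite /sqn /= sqrrN.
apply: le_ereal_sup_tmp; eexists.
  exists f => //; apply/unit_ballE; rewrite sqnorm_discrete_rkhs.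
  apply: le_trans (@nsq_sum_eunit K F) _.
  rewrite (eq_bigr (fun k : 'I_K => Lam^-1 ^+ 2 * sqn (lam k))) => [|k _]; last exact: sF.
  rewrite -mulr_sumr -Lam2 exprVn; have [->|L0] := eqVneq Lam 0.
    by rewrite expr0n /= mulr0.
  by rewrite mulVf // expf_neq0.
have fE t : rkhs_fun drkhs f t = \sum_(k < K) F k * ((sigma k)%:C * b k t).
  rewrite /f -[LHS]/(rkhs_fun drkhs (\sum_(k < K) F k *: eunit R (supp sigma) k) t).
  rewrite eval_sum; apply: eq_bigr => k _; rewrite evalZ; congr (_ * _).
  exact: synth_eunit.
have ib k : cintegrable P (fun x => (sigma k)%:C * b k x).
  apply: L2_cintegrable; have := L2_synth (eunit R (supp sigma) k).
  by rewrite (_ : synth _ _ _ = fun x => (sigma k)%:C * b k x) //; apply/funext => t; exact: synth_eunit.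
have intf : cintegral P (rkhs_fun drkhs f) =
    \sum_(k < K) F k * cintegral P (fun x => (sigma k)%:C * b k x).
  rewrite (_ : rkhs_fun drkhs f = fun t => \sum_(k < K) F k * ((sigma k)%:C * b k t)); last first.
    by apply/funext => t; exact: fE.
  rewrite (cintegrable_sum _ (fun k : 'I_K => (cintegrableZ (F k) (ib k)).1)).2.
  by apply: eq_bigr => k _; rewrite (cintegrableZ (F k) (ib k)).2.
have -> : \sum_(i < n) a i * rkhs_fun drkhs f (x i) - cintegral P (rkhs_fun drkhs f) = Lam%:C.
  rewrite intf; under eq_bigr do rewrite fE mulr_sumr.
  rewrite exchange_big /= -sumrB.
  rewrite (eq_bigr (fun k : 'I_K => (Lam^-1 * sqn (lam k))%:C)); last first.
    move=> k _; transitivity (F k * lam k).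
      rewrite [X in _ = _ * X]/lam mulrBr mulr_sumr; congr (_ - _).
      by apply: eq_bigr => i _; rewrite mulrCA.
    by rewrite /F [RHS]rmorphM /= -mulC_sqn -mulrA (mulrC (Num.conj _)).
  rewrite -rmorph_sum -mulr_sumr -Lam2 /=; congr (_%:C).
  have [->|L0] := eqVneq Lam 0; first by rewrite expr0n /= mulr0.
  by rewrite expr2 mulKf.
by rewrite lee_fin /= expr0n /= addr0 sqrtr_sqr ger0_norm.
Qed.

End DiscreteApproximation.

(** * Lower bound for integration errors *)

Section OrthogonalMatrix.
Local Open Scope ring_scope.
Variables (R : realType) (m : nat).

(* A real substitute for the Fourier matrix: symmetric, with constant first row and
   orthogonal rows. *)
Definition omx (i j : 'I_m.+2) : R :=
  if (i == 0) || (j == 0) then 1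
  else Num.sqrt m.+2%:R * (i == j)%:R - (Num.sqrt m.+2%:R - 1)^-1.

Lemma omx0l j : omx 0 j = 1.
Proof. by []. Qed.

Lemma omxC i j : omx i j = omx j i.
Proof. by rewrite /omx orbC (eq_sym i j). Qed.

(** With s = sqrt (m + 2) and q = 1 / (s - 1), the relations q (s - 1) = 1 and m + 1 = s^2 - 1 leave
    polynomial identities. In particular, without its entry in column 0 each row but the first sums
    to -1, which makes it orthogonal to the constant row. *)
Lemma omx_orthogonal i j : \sum_y omx i y * omx j y = m.+2%:R * (i == j)%:R.
Proof.
pose s : R := Num.sqrt m.+2%:R.
have s2 : s ^+ 2 = m.+2%:R by rewrite sqr_sqrtr.
have s1 : 1 < s by rewrite -sqrtr1 ltr_sqrt // ltr1n.
have ms : m.+1%:R = s ^+ 2 - 1 by rewrite s2 -[m.+2%:R]natr1 addrK.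
pose q := (s - 1)^-1.
have sq : q * (s - 1) = 1 by rewrite mulVf // subr_eq0 gt_eqF.
have omxS (k y : 'I_m.+1) : omx (lift ord0 k) (lift ord0 y) =
   s * (lift ord0 k == lift ord0 y)%:R - q by [].
clearbody s q.
have delta (k : 'I_m.+1) : \sum_(y < m.+1) (lift ord0 k == lift ord0 y)%:R = 1 :> R.
  rewrite (bigD1 k) //= eqxx big1 ?addr0 // => y yk.
  by rewrite (inj_eq lift_inj) eq_sym (negbTE yk).
have row k : \sum_(y < m.+1) omx (lift ord0 k) (lift ord0 y) = -1.
  under eq_bigr do rewrite omxS.
  rewrite sumrB -mulr_sumr delta sumr_const card_ord -[q *+ _]mulr_natr ms.
  rewrite (_ : q * (s ^+ 2 - 1) = q * (s - 1) * (s + 1)); last by ring.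
  by rewrite sq; ring.
rewrite big_ord_recl /= -[ord0]/(0 : 'I_m.+2) !(omxC _ 0) !omx0l mulr1.
case: (unliftP ord0 i) => [i'|] ->; case: (unliftP ord0 j) => [j'|] ->.
- rewrite (eq_bigr (fun y => s ^+ 2 * ((lift ord0 i' == lift ord0 j')%:R * (lift ord0 j' == lift ord0 y)%:R)
     - s * q * (lift ord0 i' == lift ord0 y)%:R - s * q * (lift ord0 j' == lift ord0 y)%:R
     + q ^+ 2)); last first.
    move=> y _; rewrite !omxS.
    have -> : (lift ord0 i' == lift ord0 j')%:R * (lift ord0 j' == lift ord0 y)%:R =
       (lift ord0 i' == lift ord0 y)%:R * (lift ord0 j' == lift ord0 y)%:R :> R.
      by case: (eqVneq (lift ord0 j') (lift ord0 y)) => [->//|_]; rewrite !mulr0.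
    ring.
  rewrite big_split /= !sumrB -!mulr_sumr !delta sumr_const card_ord -[q *+ _]mulr_natr ms -s2.
  have : q * (q * (s ^+ 2 - 1)) = q * (s + 1).
    rewrite (_ : q * (q * (s ^+ 2 - 1)) = q * (q * (s - 1)) * (s + 1)); last by ring.
    by rewrite sq mulr1.
  move=> ->; have : q * s = 1 + q by rewrite -sq; ring.
  by move=> qs; rewrite !mulr1 mulrDr mulr1 (mulrC s q) qs; ring.
- under eq_bigr do rewrite omx0l mulr1.
  by rewrite row subrr mulr0.
- under eq_bigr do rewrite omx0l mul1r.
  by rewrite row subrr mulr0.
- under eq_bigr do rewrite omx0l mul1r.
  by rewrite sumr_const card_ord eqxx mulr1 -natr1 addrC.
Qed.

End OrthogonalMatrix.

Section OrthogonalSystem.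
Local Open Scope ring_scope.
Local Open Scope complex_scope.

Lemma sqn_orthogonal_sum (R : realType) (I K : finType) (phi : K -> I -> R) (c : R) :
  (forall k l, \sum_i phi k i * phi l i = c * (k == l)%:R) ->
  forall d : K -> R[i], \sum_i sqn (\sum_k d k * (phi k i)%:C) = c * \sum_k sqn (d k).
Proof.
move=> phi_orth d.
have real_case (u : K -> R) :
    \sum_i (\sum_k u k * phi k i) ^+ 2 = c * \sum_k u k ^+ 2.
  under eq_bigr do rewrite expr2 mulr_suml.
  rewrite exchange_big mulr_sumr /=; apply: eq_bigr => k _.
  under eq_bigr do rewrite mulr_sumr.
  rewrite exchange_big /= (bigD1 k) //= [X in _ + X]big1 ?addr0 => [|l lk].
    rewrite (eq_bigr (fun i => u k ^+ 2 * (phi k i * phi k i))) => [|i _]; last by ring.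
    by rewrite -mulr_sumr phi_orth eqxx mulr1 mulrC.
  rewrite (eq_bigr (fun i => u k * u l * (phi k i * phi l i))) => [|i _]; last by ring.
  by rewrite -mulr_sumr phi_orth eq_sym (negbTE lk) !mulr0.
have ReC (z : R[i]) (a : R) : complex.Re (z * a%:C) = complex.Re z * a.
  by case: z => x y /=; rewrite mulr0 subr0.
have ImC (z : R[i]) (a : R) : complex.Im (z * a%:C) = complex.Im z * a.
  by case: z => x y /=; rewrite mulr0 add0r.
rewrite /sqn !big_split /= mulrDr -!real_case; congr (_ + _); apply: eq_bigr => i _.
  by rewrite raddf_sum; congr (_ ^+ 2); apply: eq_bigr => k _; exact: ReC.
by rewrite raddf_sum; congr (_ ^+ 2); apply: eq_bigr => k _; exact: ImC.
Qed.

End OrthogonalSystem.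

Section TensorSystem.
Local Open Scope ring_scope.
Variables (R : realType) (m J : nat).

Definition cube := {ffun 'I_J.+1 -> 'I_m.+2}.

Definition tensor_size := (J.+1 * m.+1)%N.

(* digit 0 = 0, and digit (j * m.+1 + r).+1 is r.+1 at j and 0 elsewhere, so the
   tensor products below depend on at most one coordinate. *)
Definition digit (k : nat) (j : 'I_J.+1) : 'I_m.+2 :=
  if k is k'.+1 then if (k' %/ m.+1 == j)%N then inord (k' %% m.+1).+1 else 0 else 0.

Definition tensor (k : nat) (w : cube) : R := \prod_j omx R (digit k j) (w j).

Lemma digit_block (j : 'I_J.+1) (r : 'I_m.+1) i :
  digit (j * m.+1 + r).+1 i = if j == i then lift ord0 r else 0.
Proof.
rewrite /digit divnMDl // divn_small ?ltn_ord // addn0 modnMDl modn_small ?ltn_ord //.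
rewrite -val_eqE /=; case: eqP => // _; apply: val_inj.
by rewrite /= inordK // ltnS ltn_ord.
Qed.

Lemma digit_inj k l : (k <= tensor_size)%N -> (l <= tensor_size)%N ->
  (forall j, digit k j = digit l j) -> k = l.
Proof.
have block k' : (k'.+1 <= tensor_size)%N ->
    exists j : 'I_J.+1, exists r : 'I_m.+1, k'.+1 = (j * m.+1 + r).+1.
  move=> kM; have jJ : (k' %/ m.+1 < J.+1)%N by rewrite ltn_divLR.
  have rm : (k' %% m.+1 < m.+1)%N by rewrite ltn_mod.
  by exists (Ordinal jJ), (Ordinal rm); rewrite /= -divn_eq.
case: k l => [|k] [|l] //.
- move=> _ /block[j [r ->]] /(_ j); rewrite digit_block eqxx => /(congr1 val).
  by [].
- move=> /block[j [r ->]] _ /(_ j); rewrite digit_block eqxx => /(congr1 val).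
  by [].
move=> /block[j [r ->]] /block[j' [r' ->]] /(_ j).
rewrite !digit_block eqxx; case: (eqVneq j' j) => [-> /lift_inj -> //|_] /(congr1 val).
by [].
Qed.

Lemma tensor0 w : tensor 0 w = 1.
Proof. by rewrite /tensor big1. Qed.

Lemma tensor_block (j : 'I_J.+1) (r : 'I_m.+1) w :
  tensor (j * m.+1 + r).+1 w = omx R (lift ord0 r) (w j).
Proof.
rewrite /tensor (bigD1 j) // digit_block eqxx big1 ?[LHS]mulr1 // => i ij.
by rewrite digit_block eq_sym (negbTE ij).
Qed.

(** The sum over the cube factors into one sum per coordinate, and a coordinate where the digits
    differ contributes the factor 0. *)
Lemma tensor_orthogonal k l : (k <= tensor_size)%N -> (l <= tensor_size)%N ->
  \sum_w tensor k w * tensor l w = #|{: cube}|%:R * (k == l)%:R.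
Proof.
move=> kM lM; under eq_bigr do rewrite -big_split /=.
rewrite -(bigA_distr_bigA (fun j y => omx R (digit k j) y * omx R (digit l j) y)) /=.
under eq_bigr do rewrite omx_orthogonal.
rewrite big_split /= prodr_const card_ord card_ffun !card_ord natrX; congr (_ * _).
have [->|kl] := eqVneq k l; first by rewrite big1 // => i _; rewrite eqxx.
have [/forallP eqd|] := boolP [forall j, digit k j == digit l j].
  by case/eqP: kl; apply: digit_inj => // j; apply/eqP.
rewrite negb_forall => /existsP[j /negbTE dj].
by rewrite (bigD1 j) //= dj mul0r.
Qed.

Lemma sqn_tensor_sum (d : nat -> R[i]) :
  \sum_w sqn (\sum_(k < tensor_size.+1) d k * (tensor k w)%:C%C) =
  #|{: cube}|%:R * \sum_(k < tensor_size.+1) sqn (d k).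
Proof.
apply: (sqn_orthogonal_sum (phi := fun (k : 'I_tensor_size.+1) w => tensor k w)).
by move=> k l; rewrite tensor_orthogonal // -ltnS.
Qed.

End TensorSystem.

Section CubeSystem.
Local Open Scope classical_set_scope.
Local Open Scope ring_scope.
Local Open Scope complex_scope.
Variables (R : realType) (m J : nat).
Local Notation Q := #|{: cube m J}|.
Local Notation M := (tensor_size m J).

Definition cube_point (x : nat) : cube m J := nth [ffun=> 0] (enum {: cube m J}) x.

Lemma sum_cube_point (F : cube m J -> R) : \sum_(x < Q) F (cube_point x) = \sum_w F w.
Proof.
by rewrite -[RHS]big_enum [RHS](big_nth [ffun=> 0]) -cardE big_mkord.
Qed.

Lemma card_cube_gt0 : (0 < Q)%N.
Proof. by apply/card_gt0P; exists [ffun=> 0]. Qed.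

(** The masses outside the cube are geometric with total 1/2; all masses are positive, as the
    injectivity of the embedding requires. *)
Definition massr (x : nat) : R :=
  if (x < Q)%N then (2 * Q%:R)^-1 else 2^-1 / (2 ^ (x - Q).+1)%:R.

Lemma massr_gt0 x : 0 < massr x.
Proof.
rewrite /massr; case: ifP => _; first by rewrite invr_gt0 mulr_gt0 // ltr0n card_cube_gt0.
by rewrite divr_gt0 ?invr_gt0 // ltr0n expn_gt0.
Qed.

Definition mass (x : nat) : {nonneg R} := NngNum (ltW (massr_gt0 x)).

Lemma massr_main x : (x < Q)%N -> massr x = (2 * Q%:R)^-1.
Proof. by rewrite /massr => ->. Qed.

Lemma sum_mass : (\sum_(k <oo) ((mass k)%:num)%:E = 1)%E.
Proof.
rewrite (nneseries_split 0 Q); last by move=> k _; rewrite lee_fin.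
rewrite add0n big_mkord sumEFin /= (eq_bigr (fun=> (2 * Q%:R)^-1)); last first.
  by move=> x _; rewrite massr_main.
rewrite sumr_const card_ord -nneseries_addn; last by move=> i; rewrite lee_fin ltW ?massr_gt0.
rewrite (_ : \sum_(i <oo) (massr (i + Q))%:E = (2^-1)%:E)%E.
  rewrite -EFinD -[_^-1 *+ _]mulr_natl invfM mulrCA mulfV ?mulr1; last first.
    by rewrite pnatr_eq0 -lt0n card_cube_gt0.
  by congr _%:E; lra.
apply/cvg_lim => //; rewrite (_ : (fun _ => _) = EFin \o series (fun k => 2^-1 / (2 ^ (k + 1))%:R)).
  apply: cvg_EFin; first by apply: nearW.
  have := @cvg_geometric_series_half R 2^-1 0.
  by rewrite expr0 divr1.
apply/funext => k /=; rewrite sumEFin; congr _%:E; apply: eq_bigr => i _.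
by rewrite /massr ltnNge leq_addl /= addnK addn1.
Qed.

(* The point x < Q is a point of the cube; Q + i is an atom carrying only the basis
   function of index M + 1 + i. *)
Definition amplitude (k x : nat) : R :=
  if (x < Q)%N then if (k <= M)%N then Num.sqrt 2 * tensor R k (cube_point x) else 0
  else if k == (M.+1 + (x - Q))%N then (Num.sqrt (massr x))^-1 else 0.

Definition amplitude_bound (x : nat) : nat := (M.+2 + x)%N.

Lemma amplitude_supp k x : (amplitude_bound x <= k)%N -> (amplitude k x)%:C = 0.
Proof.
rewrite /amplitude_bound /amplitude => bk.
case: ltnP => _.
  suff -> : (k <= M)%N = false by [].
  by apply/negbTE; rewrite -ltnNge; apply: leq_trans bk; rewrite ltnW // addSn addSn !ltnS leq_addr.
rewrite gtn_eqF //; apply: leq_trans bk.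
by rewrite !addSn !ltnS leq_add2l leq_subr.
Qed.

Variable sigma : nat -> R.
Local Notation E := (@ell2 R (supp sigma)).
Local Notation b := (fun k x => (amplitude k x)%:C).

Lemma synth_main (c : E) x : (x < Q)%N ->
  synth b amplitude_bound c x =
  (Num.sqrt 2)%:C * \sum_(k < M.+1) ((ell2_fun c k : R[i]) * (sigma k)%:C) * (tensor R k (cube_point x))%:C.
Proof.
move=> xQ; rewrite /synth.
rewrite -(big_mkord xpredT (fun k => (ell2_fun c k : R[i]) * ((sigma k)%:C * (amplitude k x)%:C))).
rewrite (@big_cat_nat _ _ _ M.+1) //=; last by rewrite /amplitude_bound addSn ltnW // ltnS ltnS leq_addr.
rewrite [X in _ + X]big_nat_cond [X in _ + X]big1 ?addr0; last first.
  by move=> k /andP[/andP[Mk _] _]; rewrite /amplitude xQ leqNgt Mk /= !mulr0.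
rewrite big_mkord mulr_sumr; apply: eq_bigr => k _.
rewrite /amplitude xQ -ltnS ltn_ord rmorphM /=.
by rewrite mulrA mulrCA.
Qed.

Lemma synth_tail (c : E) i :
  synth b amplitude_bound c (i + Q) =
  ((ell2_fun c (i + M.+1)%N : R[i]) * (sigma (i + M.+1)%N)%:C) * ((Num.sqrt (massr (i + Q)))^-1)%:C.
Proof.
have kb : (i + M.+1 < amplitude_bound (i + Q))%N.
  by rewrite /amplitude_bound addnC [in X in (_ < X)%N]addSn ltnS leq_add2l leq_addr.
rewrite /synth (bigD1 (Ordinal kb)) //= big1 ?addr0.
  by rewrite /amplitude ltnNge leq_addl /= addnK (addnC M.+1) eqxx mulrA.
move=> k; rewrite -val_eqE /= => ki; rewrite /amplitude ltnNge leq_addl /= addnK.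
by rewrite (addnC M.+1) (negbTE ki) !mulr0.
Qed.

(** The factor [Num.sqrt 2] makes up for the cube having half of the mass, so there the identity is
    the orthogonality of the tensors. On an atom the factor is the inverse root of its mass, and the
    terms agree one by one. *)
Lemma cube_parseval (c : E) :
  (\sum_(x <oo) ((mass x)%:num * sqn (synth b amplitude_bound c x))%R%:E =
   \sum_(k <oo) (sqn (ell2_fun c k) * sigma k ^+ 2)%R%:E)%E.
Proof.
have sqnd k : sqn ((ell2_fun c k : R[i]) * (sigma k)%:C) = sqn (ell2_fun c k) * sigma k ^+ 2.
  by rewrite mulrC sqn_scale mulrC.
rewrite (nneseries_split 0 Q); last by move=> k _; rewrite lee_fin mulr_ge0 ?sqn_ge0.
rewrite [in RHS](nneseries_split 0 M.+1); last first.
  by move=> k _; rewrite lee_fin mulr_ge0 ?sqn_ge0 ?sqr_ge0.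
rewrite !add0n; congr (_ + _)%E; last first.
  rewrite -[in LHS]nneseries_addn; last by move=> i; rewrite lee_fin mulr_ge0 ?sqn_ge0.
  rewrite -[in RHS]nneseries_addn; last by move=> i; rewrite lee_fin mulr_ge0 ?sqn_ge0 ?sqr_ge0.
  apply: eq_eseriesr => i _; rewrite synth_tail -sqnd (mulrC _ (_^-1)%:C) sqn_scale.
  rewrite exprVn sqr_sqrtr ?(ltW (massr_gt0 _)) //= mulrA.
  by rewrite mulfV ?mul1r // gt_eqF // massr_gt0.
rewrite !big_mkord !sumEFin; congr _%:E.
rewrite (eq_bigr (fun x : 'I_Q => Q%:R^-1 * sqn (\sum_(k < M.+1)
   ((ell2_fun c k : R[i]) * (sigma k)%:C) * (tensor R k (cube_point x))%:C))); last first.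
  move=> x _; rewrite synth_main // sqn_scale sqr_sqrtr //= massr_main // invfM mulrACA.
  by rewrite mulVf ?mul1r.
rewrite -mulr_sumr (sum_cube_point (fun w => sqn (\sum_(k < M.+1)
   ((ell2_fun c k : R[i]) * (sigma k)%:C) * (tensor R k w)%:C))).
rewrite (sqn_tensor_sum m J (fun k => (ell2_fun c k : R[i]) * (sigma k)%:C)).
rewrite mulKf; last by rewrite pnatr_eq0 -lt0n card_cube_gt0.
by apply: eq_bigr => k _; exact: sqnd.
Qed.

Local Notation P := (atomic sum_mass : probability nat R).

(** [tensor 0] is the constant 1, so the integral is an inner product with it; the division by 2 is
    the mass of the cube. *)
Lemma cintegral_amplitude k : (k <= M)%N ->
  cintegral P (fun x => (sigma k)%:C * (amplitude k x)%:C) =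
  (if k == 0 then sigma 0 * Num.sqrt 2 / 2 else 0)%:C.
Proof.
move=> kM.
have aQ x : (Q <= x)%N -> amplitude k x = 0.
  move=> Qx; rewrite /amplitude ltnNge Qx /= ltn_eqF //.
  by rewrite addSn ltnS (leq_trans kM) // leq_addr.
rewrite /cintegral.
rewrite (_ : (fun x => complex.Re _) = fun x => sigma k * amplitude k x); last first.
  by apply/funext => x /=; rewrite mul0r subr0.
rewrite (_ : (fun x => complex.Im _) = cst 0); last first.
  by apply/funext => x /=; rewrite mul0r mulr0 addr0.
rewrite (@Rintegral_atomic _ _ _ _ Q); last by move=> x Qx; rewrite aQ ?mulr0.
rewrite (@Rintegral_atomic _ _ _ _ 0) // big_ord0.
congr Complex.
rewrite (eq_bigr (fun x : 'I_Q => (sigma k * Num.sqrt 2 / 2) * Q%:R^-1 *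
  (tensor R k (cube_point x) * tensor R 0 (cube_point x)))); last first.
  move=> x _; rewrite /amplitude ltn_ord kM /= massr_main // tensor0 mulr1 invfM; ring.
rewrite -mulr_sumr (sum_cube_point (fun w => tensor R k w * tensor R 0 w)).
rewrite tensor_orthogonal // -mulrA mulKf; last by rewrite pnatr_eq0 -lt0n card_cube_gt0.
by case: eqP => [->|_]; rewrite ?mulr1 ?mulr0.
Qed.

End CubeSystem.

(** * Errors of quadrature rules on the cube *)

Section CubeLowerBound.
Local Open Scope ring_scope.
Local Open Scope complex_scope.
Variable R : realType.

(** Let z_x be the total weight at x. By orthogonality the sum over all rows, the constant one
    included, is (m + 2) sum_x |z_x|^2. At most n of the z_x are nonzero, so Cauchy-Schwarz makes
    this at least twice |sum_i a_i|^2, and the constant row accounts for only one of the two. *)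
Lemma omx_sample_ge (n m : nat) (a : 'I_n -> R[i]) (y : 'I_n -> 'I_m.+2) : (n.*2 <= m.+2)%N ->
  sqn (\sum_i a i) <= \sum_(r < m.+1) sqn (\sum_i a i * (omx R (lift ord0 r) (y i))%:C).
Proof.
move=> nm; pose z (x : 'I_m.+2) := \sum_(i | y i == x) a i.
have sum_z (F : 'I_m.+2 -> R[i]) : \sum_i a i * F (y i) = \sum_x z x * F x.
  rewrite (partition_big y xpredT) //=; apply: eq_bigr => x _.
  by rewrite mulr_suml; apply: eq_bigr => i /eqP ->.
have total : \sum_(r < m.+2) sqn (\sum_i a i * (omx R r (y i))%:C) =
    m.+2%:R * \sum_x sqn (z x).
  under eq_bigr do rewrite (sum_z (fun x => (omx R _ x)%:C)).
  apply: (sqn_orthogonal_sum (phi := fun x r => omx R r x)) => k l.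
  by rewrite -omx_orthogonal; apply: eq_bigr => r _; rewrite !(omxC _ r).
have zS : \sum_i a i = \sum_x z x.
  by have := sum_z (fun=> 1); under eq_bigr do rewrite mulr1; under [RHS]eq_bigr do rewrite mulr1.
have cs : sqn (\sum_i a i) <= n%:R * \sum_x sqn (z x).
  have -> : \sum_i a i = \sum_x z x * (if x \in codom y then 1 else 0).
    rewrite zS; apply: eq_bigr => x _; case: ifPn => [_|xy]; first by rewrite mulr1.
    rewrite mulr0 /z big_pred0 // => i; apply/eqP => yi.
    by case/codomP: xy; exists i.
  apply: le_trans (sqn_sum_le _ _ _) _; rewrite mulrC ler_wpM2r //.
    by apply: sumr_ge0 => x _; exact: sqn_ge0.
  rewrite (eq_bigr (fun x => if x \in codom y then 1 else 0 : R)); last first.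
    by move=> x _; case: ifP; rewrite /sqn /= ?expr1n ?expr0n /= ?addr0.
  rewrite -big_mkcond /= sumr_const ler_nat.
  by apply: leq_trans (card_size _) _; rewrite size_codom card_ord.
move: total; rewrite big_ord_recl.
rewrite (eq_bigr a) => [total|i _]; last by rewrite -[ord0]/(0 : 'I_m.+2) omx0l mulr1.
rewrite -(lerD2l (sqn (\sum_i a i))) total.
apply: (@le_trans _ _ (n.*2%:R * \sum_x sqn (z x))).
  by rewrite -mul2n natrM -mulrA; lra.
by rewrite ler_wpM2r ?ler_nat // sumr_ge0 // => x _; exact: sqn_ge0.
Qed.

Variables (n J : nat) (sigma : nat -> R).
Hypothesis sigma_ge0 : forall k, 0 <= sigma k.
Hypothesis sigma_dec : forall k, sigma k.+1 <= sigma k.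
Local Notation m := n.*2.
Local Notation Q := #|{: cube m J}|.
Local Notation M := (tensor_size m J).

Local Notation b := (fun k x => (amplitude R m J k x)%:C).
Local Notation P := (atomic (sum_mass R m J) : probability nat R).

Definition cube_rkhs : rkhs R nat :=
  drkhs (@cube_parseval R m J sigma).

Lemma sum_blocks (F : nat -> R) K l :
  \sum_(k < K * l) F k = \sum_(j < K) \sum_(r < l) F (j * l + r)%N.
Proof.
rewrite -(big_mkord xpredT F) big_nat_mul big_mkord; apply: eq_bigr => j _.
rewrite -{1}[(j * l)%N]add0n big_addn mulSn addnK big_mkord.
by apply: eq_bigr => r _; rewrite addnC.
Qed.

(** The minimum is attained at 1/4, midway between 0 and 1/2. *)
Lemma half_dist_ge (S : R[i]) : 8^-1 <= sqn (S - (2^-1)%:C) + sqn S.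
Proof.
case: S => u v; rewrite /sqn /= oppr0 addr0.
have := sqr_ge0 (u - 4^-1); have := sqr_ge0 v; nra.
Qed.

(** [S] is the total weight on the cube, since nodes on atoms see no function of index at most [M].
    [omx_sample_ge] applies to each coordinate with the same nodes; the block of coordinate j ends
    at index [j.+1 * m.+1], where sigma is smallest. That [S] vanishes without nodes serves the case
    [n = 0]. *)
Lemma dual_coefficients_ge (x : 'I_n -> nat) (a : 'I_n -> R[i]) :
  exists2 S : R[i], (n = 0 -> S = 0) &
  2 * (sigma 0 ^+ 2 * sqn (S - (2^-1)%:C) + (\sum_(j < J.+1) sigma (j.+1 * m.+1)%N ^+ 2) * sqn S) <=
  \sum_(k < M.+1) sqn (\sum_(i < n) a i * ((sigma k)%:C * b k (x i)) -
    cintegral P (fun t => (sigma k)%:C * b k t)).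
Proof.
pose a' i := if (x i < Q)%N then a i else 0.
pose w i := cube_point m J (x i).
have sumE k : (k <= M)%N -> \sum_(i < n) a i * ((sigma k)%:C * b k (x i)) =
    (Num.sqrt 2 * sigma k)%:C * \sum_i a' i * (tensor R k (w i))%:C.
  move=> kM; rewrite mulr_sumr; apply: eq_bigr => i _.
  rewrite /a' /w /amplitude kM; case: ifP => xQ.
    rewrite !rmorphM /=; ring.
  rewrite ltn_eqF ?mulr0 ?mul0r ?mulr0 //.
  by rewrite addSn ltnS (leq_trans kM) // leq_addr.
exists (\sum_i a' i).
  by move=> n0; rewrite big1 // => i _; have := ltn_ord i; rewrite {2}n0.
have sqnE k (z : R[i]) : sqn ((Num.sqrt 2 * sigma k)%:C * z) = 2 * (sigma k ^+ 2 * sqn z).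
  by rewrite sqn_scale exprMn sqr_sqrtr // mulrA.
rewrite [leRHS]big_ord_recl [leLHS]mulrDr; apply: lerD.
  rewrite sumE // cintegral_amplitude // eqxx.
  have -> : \sum_i a' i * (tensor R (ord0 : 'I_M.+1) (w i))%:C = \sum_i a' i.
    by apply: eq_bigr => i _; rewrite tensor0 mulr1.
  rewrite (_ : (sigma 0 * Num.sqrt 2 / 2)%:C = (Num.sqrt 2 * sigma 0)%:C * (2^-1)%:C); last first.
    by rewrite -rmorphM; congr (_%:C); rewrite (mulrC (sigma 0)).
  by rewrite -mulrBr sqnE.
rewrite (eq_bigr (fun k : 'I_M => (fun k => 2 * (sigma k.+1 ^+ 2 *
   sqn (\sum_i a' i * (tensor R k.+1 (w i))%:C))) k)); last first.
  move=> k _; rewrite lift0 sumE // cintegral_amplitude // subr0; exact: sqnE.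
rewrite (sum_blocks (fun k => 2 * (sigma k.+1 ^+ 2 *
   sqn (\sum_i a' i * (tensor R k.+1 (w i))%:C)))).
rewrite mulr_suml mulr_sumr; apply: ler_sum => j _.
under [leRHS]eq_bigr do under eq_bigr do rewrite tensor_block.
rewrite -mulr_sumr ler_wpM2l //.
apply: (@le_trans _ _ (\sum_(r < m.+1) sigma (j.+1 * m.+1)%N ^+ 2 *
   sqn (\sum_i a' i * (omx R (lift ord0 r) (w i j))%:C))).
  rewrite -mulr_sumr ler_wpM2l ?sqr_ge0 //.
  apply: omx_sample_ge; exact: leq_trans (leqnSn _) (leqnSn _).
apply: ler_sum => r _; rewrite ler_wpM2r ?sqn_ge0 // ler_pXn2r ?nnegrE //.
apply: sigma_mono => //.
by rewrite mulSn [leqRHS]addnC -addnS leq_add2l.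
Qed.

(** If both coefficients are at least 4 r^2, [half_dist_ge] gives 2 * 4 r^2 / 8 = r^2. For [n = 0]
    the constants alone give sigma_0^2 / 2, which is at least 2 r^2. *)
Lemma integration_error_cube_ge (r : R) : 0 <= r -> 4 * r ^+ 2 <= sigma 0 ^+ 2 ->
  (n = 0 \/ 4 * r ^+ 2 <= \sum_(j < J.+1) sigma (j.+1 * m.+1)%N ^+ 2) ->
  (r%:E <= integration_error P n cube_rkhs)%E.
Proof.
move=> r0 rs rB; apply: (@integration_error_drkhs_ge _ _ _ _ _ _ sigma_ge0 sigma_dec _ _ _ M.+1) => //.
  by move=> k x; exact: amplitude_supp.
move=> x a; have [S S0] := dual_coefficients_ge x a; apply: le_trans.
have half := half_dist_ge S; case: rB => [n0|rB].
  rewrite (S0 n0) sub0r sqn0 mulr0 addr0 /sqn /= oppr0 expr0n addr0 sqrrN.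
  by have := sqr_ge0 r; nra.
set B := \sum_(j < J.+1) _ in rB *.
have := sqn_ge0 S; have := sqn_ge0 (S - (2^-1)%:C); have := sqr_ge0 r.
set p := sqn (S - _) in half *; set q := sqn S in half *; move: half rs rB.
clearbody p q B; move: (r ^+ 2) (sigma 0 ^+ 2) => t s; nra.
Qed.

Lemma e_star_ge (r : R) : 0 <= r -> 4 * r ^+ 2 <= sigma 0 ^+ 2 ->
  (n = 0 \/ 4 * r ^+ 2 <= \sum_(j < J.+1) sigma (j.+1 * m.+1)%N ^+ 2) ->
  (r%:E <= e_star sigma n)%E.
Proof.
move=> r0 rs rB; apply: le_trans (integration_error_cube_ge r0 rs rB) _.
apply: ereal_sup_ubound; exists _, nat, P, cube_rkhs; split => //.
  by apply: drkhs_embedded => // x; exact: massr_gt0.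
by move=> k; exact: approximation_number_drkhs.
Qed.

End CubeLowerBound.

Section LowerBound.
Local Open Scope ring_scope.
Variables (R : realType) (sigma : nat -> R).
Hypothesis sigma_ge0 : forall k, 0 <= sigma k.
Hypothesis sigma_dec : forall k, sigma k.+1 <= sigma k.

Lemma sigma_star_ge0 n : 0 <= sigma_star sigma n.
Proof.
by rewrite /sigma_star; case: ifP => _ //; rewrite le_min sigma_ge0 sqrtr_ge0.
Qed.

Lemma sigma_star_le0 n : sigma_star sigma n <= sigma 0.
Proof. by rewrite /sigma_star; case: ifP => _ //; rewrite ge_min lexx. Qed.

(** Bounded partial sums exclude the convention for divergent series, so [sigma_star] is the minimum
    and at most the root in it. *)
Lemma sigma_star_tail_le n (x : R) : (0 < n)%N ->
  (forall K, \sum_(i < K) sigma (i + n)%N ^+ 2 <= x) ->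
  n%:R * sigma_star sigma n ^+ 2 <= x.
Proof.
move=> n0 partial_le.
have x0 : 0 <= x by have := partial_le 0%N; rewrite big_ord0.
have n0' : 0 < n%:R :> R by rewrite ltr0n.
have tail_le : (\sum_(n <= k <oo) (sigma k ^+ 2)%:E <= x%:E)%E.
  rewrite -nneseries_addn; last by move=> i; rewrite lee_fin sqr_ge0.
  apply: lime_le.
    by apply: is_cvg_nneseries => k _ _; rewrite lee_fin sqr_ge0.
  by apply: nearW => K; rewrite sumEFin lee_fin big_mkord; exact: partial_le.
have tail_ge0 : (0 <= \sum_(n <= k <oo) (sigma k ^+ 2)%:E)%E.
  by apply: nneseries_ge0 => k _ _; rewrite lee_fin sqr_ge0.
rewrite /sigma_star gtn_eqF //= ifF; last first.
  apply/negbTE; rewrite (nneseries_split 0 n); last by move=> k _; rewrite lee_fin sqr_ge0.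
  rewrite lt_eqF // sumEFin lte_add_pinfty ?ltry //.
  by apply: le_lt_trans tail_le _; rewrite ltry.
set t := fine _.
have t0 : 0 <= t by exact: fine_ge0.
have tx : t <= x.
  by rewrite -lee_fin /t fineK // ge0_fin_numE // (le_lt_trans tail_le) ?ltry.
rewrite mulrC -ler_pdivlMr // mulrC.
have nt0 : 0 <= t / n%:R by rewrite divr_ge0 // ltW.
apply: (@le_trans _ _ (t / n%:R)); last by rewrite ler_wpM2r // invr_ge0 ltW.
rewrite -[leRHS]sqr_sqrtr // ler_pXn2r ?nnegrE ?le_min ?sigma_ge0 ?sqrtr_ge0 //.
by rewrite ge_min lexx orbT.
Qed.

Lemma sum_sqr_blocks_le N J : (0 < N)%N ->
  \sum_(N <= k < (J.+2 * N)%N) sigma k ^+ 2 <=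
  N%:R * \sum_(j < J.+1) sigma (j.+1 * N)%N ^+ 2.
Proof.
move=> N0; rewrite -{1}[N]add0n big_addn mulSn addKn big_mkord.
rewrite (sum_blocks (fun k => sigma (k + N)%N ^+ 2)) mulr_sumr.
apply: ler_sum => j _.
apply: (@le_trans _ _ (\sum_(r < N) sigma (j.+1 * N)%N ^+ 2)).
  apply: ler_sum => r _; rewrite ler_pXn2r ?nnegrE //; apply: sigma_mono => //.
  by rewrite mulSn addnC leq_add2r leq_addr.
by rewrite sumr_const card_ord mulr_natl.
Qed.

(** The blocks have length N = 2n + 1 <= 3n, whence the 3. The number of coordinates comes from a
    contradiction, which treats convergent and divergent series alike: if no [J] were large enough,
    all partial sums of the tail would stay below N tau^2 / 256. *)
Lemma e_star_ge_sigma_star n : ((32^-1 * sigma_star sigma (3 * n)%N)%:E <= e_star sigma n)%E.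
Proof.
set tau := sigma_star sigma _.
have tau0 : 0 <= tau by exact: sigma_star_ge0.
have r0 : 0 <= 32^-1 * tau by rewrite mulr_ge0.
have rs : 4 * (32^-1 * tau) ^+ 2 <= sigma 0 ^+ 2.
  apply: (@le_trans _ _ (tau ^+ 2)).
    by rewrite exprMn; have := sqr_ge0 tau; lra.
  by rewrite ler_pXn2r ?nnegrE //; exact: sigma_star_le0.
have [n0|n0] := posnP n.
  by apply: (@e_star_ge _ _ 0) => //; left.
set N := n.*2.+1.
have N3 : (N <= 3 * n)%N by rewrite /N -addnn -[3%N]/(2 + 1)%N mulnDl mul1n mul2n -addnn -addn1 leq_add2l.
have [tau_eq0|tau_neq0] := eqVneq tau 0.
  apply: (@e_star_ge _ _ 0) => //; right.
  by rewrite tau_eq0 mulr0 expr0n mulr0 sumr_ge0 // => j _; exact: sqr_ge0.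
have [J HJ] : exists J, 4 * N%:R * (32^-1 * tau) ^+ 2 <= \sum_(N <= k < (J.+2 * N)%N) sigma k ^+ 2.
  apply: contrapT => /forallNP noJ.
  have : (3 * n)%:R * tau ^+ 2 <= 4 * N%:R * (32^-1 * tau) ^+ 2.
    apply: sigma_star_tail_le => [|K]; first by rewrite muln_gt0.
    (* This choice of [J] makes the blocks reach at least to index [3 * n + K]. *)
    rewrite leNgt; apply/negP => lt_K; apply: (noJ (3 * n + K)%N); apply: le_trans (ltW lt_K) _.
    rewrite -(big_mkord xpredT (fun i => sigma (i + 3 * n)%N ^+ 2)).
    have -> : \sum_(0 <= i < K) sigma (i + 3 * n)%N ^+ 2 = \sum_(3 * n <= k < 3 * n + K) sigma k ^+ 2.
      by rewrite -[RHS]/(\sum_(0 + 3 * n <= k < 3 * n + K) sigma k ^+ 2) [RHS]big_addn addKn.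
    have le2 : (3 * n + K <= (3 * n + K).+2 * N)%N.
      by apply: leq_trans (leq_pmulr _ _) => //; exact: leq_trans (leqnSn _) (leqnSn _).
    rewrite [leRHS](@big_cat_nat _ _ _ (3 * n)%N) ?(leq_trans (leq_addr K _) le2) //=.
    rewrite [X in _ + X](@big_cat_nat _ _ _ (3 * n + K)%N) ?leq_addr //= addrCA.
    by rewrite lerDl addr_ge0 // sumr_ge0 // => k _; exact: sqr_ge0.
  have tau2 : 0 < tau ^+ 2 by rewrite exprn_gt0 // lt_neqAle eq_sym tau_neq0.
  have NR : N%:R <= (3 * n)%:R :> R by rewrite ler_nat.
  have NR0 : 0 < (3 * n)%:R :> R by rewrite ltr0n muln_gt0.
  have NT : N%:R * tau ^+ 2 <= (3 * n)%:R * tau ^+ 2 by rewrite ler_wpM2r // ltW.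
  have T0 : 0 < (3 * n)%:R * tau ^+ 2 by rewrite mulr_gt0.
  rewrite exprMn mulrCA -[4 * _ * _]mulrA; lra.
apply: (@e_star_ge _ _ J) => //; right.
have := le_trans HJ (sum_sqr_blocks_le J (ltn0Sn _)).
by rewrite -mulrA mulrCA ler_pM2l // ltr0n.
Qed.

End LowerBound.

Local Open Scope ring_scope.

Theorem corollary3 (R : realType) :
  exists (c : R) (C : nat),
    [/\ 0 < c, c < 1, (1 < C)%N &
      forall sigma : nat -> R,
        (forall k : nat, sigma k.+1 <= sigma k) ->
        (forall k : nat, 0 <= sigma k) ->
        forall n : nat,
          [/\ ((c * sigma_star sigma (C * n)%N)%:E <= e_star sigma n)%E,
              (e_star sigma n <= g_star sigma n)%E &
              (g_star sigma n
                 <= (C%:R * sigma_star sigma (Num.truncn (c * n%:R)))%:E)%E]].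
Proof.
(* The upper bound needs [c <= 16^-1], and 32^-1 leaves ample room in the lower one; 3 serves both
   for 2n + 1 <= 3n and for sqrt 6 <= 3. *)
exists 32^-1, 3%N; split; [lra|lra|by []|].
move=> sigma sigma_dec sigma_ge0 n; split.
- exact: e_star_ge_sigma_star.
- exact: e_star_le_g_star.
by apply: g_star_le => //; lra.
Qed.
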